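(* Let $d\ge 1$ and let $\Omega\subset\mathbb{R}^d$ be a bounded, connected, open set with boundary of class $C^2$. Let $P\colon L^2(\Omega)\to L^2(\Omega)$ be a bounded linear operator such that: (A1) for every $\varphi\in H^2(\Omega)\cap H^1_0(\Omega)$ we have $P[\varphi]\in H^2(\Omega)\cap H^1_0(\Omega)$ and $P[\Delta\varphi]=\Delta P[\varphi]$; (A2) $P$ is an orthogonal projection, i.e. $P^2=P$ and $P$ is self-adjoint. Let $Q=\mathrm{Id}-P$. Let $u_0\in H^1_0(\Omega)$ and $v_0\in L^2(\Omega)$, and let $(u(t),v(t))=S_P(t)(u_0,v_0)$ be the unique (semigroup) solution with initial datum $(u_0,v_0)$ to $$\partial_{tt}u-\Delta u+P[\partial_t u(t,\cdot)]=0\ \text{ in }(0,+\infty)\times\Omega,\qquad u=0\ \text{ on }(0,+\infty)\times\partial\Omega,\qquad u(0,\cdot)=u_0,\ \ \partial_t u(0,\cdot)=v_0 .$$ Then $$(u(t),v(t))=(Q[u(t)],Q[v(t)])+(P[u(t)],P[v(t)]),$$ where $(Q[u(t)],Q[v(t)])$ is the unique (semigroup) solution to the undamped wave equation with initial datum $(Q[u_0],Q[v_0])$, $$\partial_{tt}z-\Delta z=0\ \text{ in }(0,+\infty)\times\Omega,\qquad z=0\ \text{ on }(0,+\infty)\times\partial\Omega,\qquad z(0,\cdot)=Q[u_0],\ \ \partial_t z(0,\cdot)=Q[v_0],$$ and there exist constants $\gamma,M>0$ such that $$\|u(t)-Q[u(t)]\|_{H^1_0(\Omega)}+\|v(t)-Q[v(t)]\|_{L^2(\Omega)}\le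 Me^{-\gamma t},\qquad\text{for all }t\ge 0.$$
   Context: Functions are real-valued. $H=H^1_0(\Omega)\times L^2(\Omega)$ is the Hilbert space endowed with the scalar product $\langle (u,v),(w,z)\rangle_H=\langle\nabla u,\nabla w\rangle_{L^2(\Omega)}+\langle v,z\rangle_{L^2(\Omega)}$, and $\|u\|_{H^1_0(\Omega)}=\|\nabla u\|_{L^2(\Omega)}$ (equivalent to the full $H^1$ norm by Poincaré's inequality). For any bounded linear operator $R\colon L^2(\Omega)\to L^2(\Omega)$ with $\langle R[w],w\rangle_{L^2(\Omega)}\ge0$ for all $w\in L^2(\Omega)$, let $\mathscr{A}_R(u,v)=(-v,-\Delta u+R[v])$ with domain $\{(u,v)\in H: u\in H^2(\Omega)\cap H^1_0(\Omega),\ v\in H^1_0(\Omega)\}$, and let $\{S_R(t)\}_{t\ge0}$ be the strongly continuous contraction semigroup on $H$ generated by it (in the sense of the equation $U'+\mathscr{A}_RU=0$, i.e. with infinitesimal generator $-\mathscr{A}_R$). The semigroup solution $(u(t),v(t))$, with $v=\partial_t u$, of $\partial_{tt}u-\Delta u+R[\partial_t u]=0$ with homogeneous Dirichlet boundary conditions and initial datum $U_0\in H$ is $S_R(t)U_0$. The problem for $u$ corresponds to $R=P$ and the undamped wave equation to $R=0$. Under (A1)–(A2) the operators $P$ and $Q$ map $H^1_0(\Omega)$ into itself, so the initial datum $(Q[u_0],Q[v_0])$ belongs to $H$. *)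

(* Defs.v *)
From HB Require Import structures.
From mathcomp Require Import all_boot all_order all_algebra.
From mathcomp Require Import all_classical all_reals all_analysis.
From mathcomp Require Import measurable_realfun.
Set Implicit Arguments.
Unset Strict Implicit.
Unset Printing Implicit Defensive.
Import Order.TTheory GRing.Theory Num.Theory.
Import numFieldNormedType.Exports.
Local Open Scope classical_set_scope.
Local Open Scope ring_scope.
Local Open Scope quotient_scope.

Section measurable_rV.
Context (R : realType) (n : nat).

Definition rV_coord (i : 'I_n) (x : 'rV[R]_n) : measurableTypeR R := x 0 i.

Let rV_set0 : g_sigma_preimage rV_coord set0.
Proof. exact: sigma_algebra0. Qed.

Let rV_setC A : g_sigma_preimage rV_coord A -> g_sigma_preimage rV_coord (~` A).
Proof. exact: sigma_algebraC. Qed.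

Let rV_bigcup (F : _^nat) : (forall i, g_sigma_preimage rV_coord (F i)) ->
  g_sigma_preimage rV_coord (\bigcup_i (F i)).
Proof. exact: sigma_algebra_bigcup. Qed.

(* The Borel sigma-algebra of R^n, presented as the one generated by the
   coordinates, in the way of the library's instance on n.-tuple; see
   open_measurable_rV. *)
HB.instance Definition _ := @isMeasurable.Build default_measure_display
  'rV[R]_n (g_sigma_preimage rV_coord) rV_set0 rV_setC rV_bigcup.

Lemma measurable_rV_coord i : measurable_fun setT (rV_coord i).
Proof.
move=> _ Y mY; rewrite setTI; apply: sub_sigma_algebra => /=.
rewrite -bigcup_seq/=; exists i => /=; first by rewrite mem_index_enum.
by exists Y => //; rewrite setTI.
Qed.

Lemma measurable_fun_rV d (T : measurableType d) (f : T -> 'rV[R]_n) :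
  (forall i, measurable_fun setT (rV_coord i \o f)) -> measurable_fun setT f.
Proof.
move=> mf _ A mA; rewrite setTI.
have : g_sigma_preimage (fun i => rV_coord i \o f) `<=` measurable.
  apply: smallest_sub; first exact: sigma_algebra_measurable.
  by rewrite -bigcup_seq; apply: bigcup_sub => i _ B [C mC <-]; exact: mf.
rewrite g_sigma_preimage_comp; apply; exists A => //; exact: setTI.
Qed.

Lemma open_measurable_rV (A : set 'rV[R]_n) : open A -> measurable A.
Proof.
move=> oA.
pose c (p : 'rV[rat]_n * nat) : 'rV[R]_n := map_mx ratr p.1.
pose r (p : 'rV[rat]_n * nat) : R := p.2.+1%:R^-1.
pose B p := if `[< ball (c p) (r p) `<=` A >] then ball (c p) (r p) else set0.
have mB p : measurable (B p).
  rewrite /B; case: ifP => _; last exact: measurable0.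
  have -> : ball (c p) (r p) =
      \bigcap_(i in [set: 'I_n]) rV_coord i @^-1` (ball (c p 0 i) (r p)).
    apply/seteqP; split => [y [_ cy] i _ /=|y cy]; first exact: cy.
    split; first by rewrite /r invr_gt0.
    by move=> i j; rewrite ord1; exact: cy.
  apply: fin_bigcap_measurable => // i _.
  rewrite -[X in measurable X]setTI; apply: measurable_rV_coord => //.
  exact: measurable_ball.
have -> : A = \bigcup_p B p.
  apply/seteqP; split => [x Ax|x [p _]]; last first.
    by rewrite /B; case: ifPn => // /asboolP; apply.
  have /nbhs_ballP[e /= e0 eA] : nbhs x A by exact: open_nbhs_nbhs.
  have [k ke] : exists k : nat, k.+1%:R^-1 *+ 2 < e.
    have e20 : 0 < e / 2 by rewrite divr_gt0.
    have [k _ /(_ k)/(_ (leqnn _)) /= ke] := near_infty_natSinv_lt (PosNum e20).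
    by exists k; rewrite -(mulr_natr _^-1) -ltr_pdivlMr.
  have /choice[q qP] : forall i : 'I_n, exists q : rat,
      (ball (x 0 i) k.+1%:R^-1 : set R) (ratr q).
    move=> i; have : ball (x 0 i) k.+1%:R^-1 `&` range (@ratr R) !=set0.
      by apply: dense_rat; [exists (x 0 i); apply: ballxx; rewrite invr_gt0|
        exact: ball_open].
    by case=> y [xy [q _ qy]]; exists q; rewrite qy.
  exists (\row_i q i, k) => //.
  have cx : ball (c (\row_i q i, k)) (r (\row_i q i, k)) x.
    by split=> [|i j]; rewrite ?invr_gt0// ord1 !mxE;
      exact/ball_sym/qP.
  rewrite /B; case: ifPn => // /asboolP[] y cy; apply: eA.
  apply: (@le_ball _ _ _ (k.+1%:R^-1 *+ 2)); first exact: ltW.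
  rewrite mulr2n; apply: ball_triangle cy; exact/ball_sym.
by apply: countable_bigcupT_measurable => //; exact: countableP.
Qed.

End measurable_rV.

Section lebesgue_rV.
Context (R : realType).

Definition cons_rV n (p : measurableTypeR R * 'rV[R]_n) : 'rV[R]_n.+1 :=
  \row_i (if unlift ord0 i is Some j then p.2 0 j else p.1).

Lemma measurable_cons_rV n : measurable_fun setT (@cons_rV n).
Proof.
apply: measurable_fun_rV => i.
have -> : @rV_coord R n.+1 i \o @cons_rV n =
  if unlift ord0 i is Some j then @rV_coord R n j \o snd else fst.
  by apply/funext => -[x y]; rewrite /rV_coord /= mxE; case: unlift.
case: unliftP => [j _|_]; last exact: measurable_fst.
by apply: measurableT_comp => //; exact: measurable_rV_coord.
Qed.

Section step.
Variables (n : nat) (m : {sigma_finite_measure set 'rV[R]_n -> \bar R}).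

Definition cons_measure : set 'rV[R]_n.+1 -> \bar R :=
  pushforward (@lebesgue_measure R \x m)%E (@cons_rV n).

Let mu1 : {measure set (measurableTypeR R * 'rV[R]_n)%type -> \bar R} :=
  (@lebesgue_measure R \x m)%E.

Let nu : {measure set 'rV[R]_n.+1 -> \bar R} :=
  measure_function_pushforward__canonical__measure_function_Measure mu1
    (@measurable_cons_rV n).

Let cons_measure0 : cons_measure set0 = 0%E.
Proof. exact: (measure0 nu). Qed.

Let cons_measure_ge0 A : (0 <= cons_measure A)%E.
Proof. exact: (measure_ge0 nu). Qed.

Let cons_measure_sigma_additive : semi_sigma_additive cons_measure.
Proof.
exact: (@measure_semi_sigma_additive _ _ _ nu).
Qed.

HB.instance Definition _ := isMeasure.Build _ _ _ cons_measure
  cons_measure0 cons_measure_ge0 cons_measure_sigma_additive.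

Let uncons (x : 'rV[R]_n.+1) : measurableTypeR R * 'rV[R]_n :=
  (x 0 ord0, \row_j x 0 (lift ord0 j)).

Let measurable_uncons : measurable_fun setT uncons.
Proof.
apply: measurable_fun_pair; first exact: (measurable_rV_coord ord0).
apply: measurable_fun_rV => i.
have -> : rV_coord i \o (fun x : 'rV[R]_n.+1 => \row_j x 0 (lift ord0 j)) =
    rV_coord (lift ord0 i).
  by apply/funext => x; rewrite /rV_coord /= mxE.
exact: measurable_rV_coord.
Qed.

Let consK : cancel (@cons_rV n) uncons.
Proof.
case=> x y; rewrite /uncons /cons_rV mxE unlift_none; congr pair.
by apply/rowP => j; rewrite !mxE liftK.
Qed.

Let cons_measure_sigma_finite : sigma_finite setT cons_measure.
Proof.
have /sigma_finiteP[F [TF ndF Foo]] := sigma_finiteT (@lebesgue_measure R).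
have /sigma_finiteP[G [TG ndG Goo]] := sigma_finiteT m.
exists (fun i => uncons @^-1` (F i `*` G i)).
  rewrite -preimage_bigcup; apply/esym; rewrite -subTset => x _ /=.
  have : setT (uncons x).1 by [].
  rewrite TF => -[i _ Fi].
  have : setT (uncons x).2 by [].
  rewrite TG => -[j _ Gj].
  exists (maxn i j) => //; split.
    by move: Fi; exact/subsetPset/ndF/leq_maxl.
  by move: Gj; exact/subsetPset/ndG/leq_maxr.
move=> i; have [mF Fi] := Foo i; have [mG Gi] := Goo i; split.
  rewrite -[X in measurable X]setTI; apply: measurable_uncons => //.
  exact: measurableX.
rewrite /cons_measure /pushforward -comp_preimage.
rewrite (_ : uncons \o _ = id) ?preimage_id.
  by rewrite product_measure1E// lte_mul_pinfty// ge0_fin_numE.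
by apply/funext => p; rewrite /= consK.
Qed.

HB.instance Definition _ := Measure_isSigmaFinite.Build _ _ _ cons_measure
  cons_measure_sigma_finite.

Lemma cons_measureE (A : set (measurableTypeR R)) (B : set 'rV[R]_n) :
  measurable A -> measurable B ->
  cons_measure [set x | A (x 0 ord0) /\ B (\row_j x 0 (lift ord0 j))] =
  (@lebesgue_measure R A * m B)%E.
Proof.
move=> mA mB; rewrite -product_measure1E// /cons_measure /pushforward.
congr product_measure1; apply/seteqP; split => -[x y] /=;
  by have [xE yE] := consK (x, y); rewrite xE yE.
Qed.

End step.

(* Lebesgue measure on R^n as an iterated product; lebesgue_rV_box gives its
   value on boxes. *)
Fixpoint lebesgue_rV n : {sigma_finite_measure set 'rV[R]_n -> \bar R} :=
  if n is n'.+1 then cons_measure (lebesgue_rV n') else \d_(0 : 'rV[R]_0).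

Lemma lebesgue_rV_box n (a b : 'rV[R]_n) : (forall i, a 0 i <= b 0 i) ->
  lebesgue_rV n [set x | forall i, x 0 i \in `[a 0 i, b 0 i]] =
  (\prod_(i < n) (b 0 i - a 0 i))%:E.
Proof.
elim: n => [|n IHn] in a b * => ab.
  rewrite big_ord0 /= diracE mem_set//=.
  by case.
pose tl (x : 'rV[R]_n.+1) : 'rV[R]_n := \row_j x 0 (lift ord0 j).
pose B := [set x : 'rV[R]_n | forall i, x 0 i \in `[tl a 0 i, tl b 0 i]].
have mB : measurable B.
  have -> : B = \bigcap_(i in [set: 'I_n])
      rV_coord i @^-1` `[tl a 0 i, tl b 0 i].
    by apply/seteqP; split => [y By i _|y By i]; exact: By.
  apply: fin_bigcap_measurable => // i _.
  by rewrite -[X in measurable X]setTI; apply: measurable_rV_coord.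
transitivity (cons_measure (lebesgue_rV n)
    [set x : 'rV[R]_n.+1 |
      `[a 0 ord0, b 0 ord0]%classic (x 0 ord0) /\ B (tl x)]).
  congr (_ _); apply/seteqP; split => x /=.
    by move=> H; split; [exact: H|move=> i; rewrite !mxE; exact: H].
  move=> [H0 H] i; case: (unliftP ord0 i) => [j ->|-> //].
  by have := H j; rewrite !mxE.
rewrite cons_measureE// IHn; last by move=> i; rewrite !mxE.
rewrite lebesgue_measure_itv /= lte_fin big_ord_recl EFinM.
case: ltP => [_|ba].
  by rewrite EFinB; congr (_ * _%:E)%E; apply: eq_bigr => i _; rewrite !mxE.
have -> : b 0 ord0 = a 0 ord0 by apply/eqP; rewrite eq_le ba ab.
by rewrite subrr !mul0e.
Qed.

End lebesgue_rV.

Lemma ae_eq_Lnorm2 d (T : measurableType d) (R : realType)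
    (mu : {measure set T -> \bar R}) (f g : T -> R) :
  measurable_fun setT f -> measurable_fun setT g -> f = g %[ae mu] ->
  'N[mu]_2%:E[EFin \o f]%E = 'N[mu]_2%:E[EFin \o g]%E.
Proof.
move=> mf mg fg.
have mL (h : T -> R) : measurable_fun setT h ->
    measurable_fun setT (fun x : T => `|(EFin \o h) x| `^ 2)%E.
  move=> mh; apply: (measurableT_comp (measurable_poweR _)) => //.
  by apply: measurableT_comp => //; exact/measurable_EFinP.
rewrite unlock; congr (_ `^ _)%E.
apply: ae_eq_integral => //; [exact: mL|exact: mL|].
by apply: filterS fg => x /= fgx /fgx ->.
Qed.

(* The library's L^2 space of almost-everywhere classes. It comes without
   algebraic structure; the instances below make it a normed space. *)
Definition L2 d (T : measurableType d) (R : realType)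
  (mu : {measure set T -> \bar R}) : Type := LspaceType2 mu.

Section L2_classes.
Context d (T : measurableType d) (R : realType).
Variable mu : {measure set T -> \bar R}.
Local Notation L2 := (L2 mu).
Local Notation mfunq := (aeEqMfun (measurableTypeR R) mu).

Definition L2_fun (f : L2) : T -> R := (f : LspaceType2 mu) : T -> R.
Coercion L2_fun : L2 >-> Funclass.

Lemma L2_measurable (f : L2) : measurable_fun setT (f : T -> R).
Proof.
exact: (@measurable_funP _ _ _ _ setT (repr ((f : LspaceType2 mu) : mfunq))).
Qed.

Lemma L2_Lfun (f : L2) : (f : T -> R) \in Lfun mu 2%:E.
Proof.
apply/andP; split; rewrite inE /=; first exact: L2_measurable.
exact: (@Lebesgue_finite _ _ _ _ _ _ (f : LspaceType2 mu)).
Qed.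

Lemma L2_eq_ae (f g : L2) : (f : T -> R) = g %[ae mu] -> f = g.
Proof.
case: f => f [[fP]]; case: g => g [[gP]] /= fg.
have fgE : f = g.
  rewrite -[f]reprK -[g]reprK; apply/eqmodP/asboolP; exact: fg.
subst g; congr LebesgueSpace.Pack; congr LebesgueSpace.Class.
by congr isFinLebesgue.Axioms_; exact: bool_irrelevance.
Qed.

Section class_of.
Variables (f : T -> R) (fL : f \in Lfun mu 2%:E).

Let mf : measurable_fun setT f.
Proof. by case/andP: fL; rewrite inE. Qed.

Let fm : {mfun T >-> measurableTypeR R} :=
  HB.pack (f : T -> measurableTypeR R)
    (@isMeasurableFun.Build _ _ T (measurableTypeR R) f mf).

Let fq : mfunq := \pi_mfunq fm.

Let fqE : (fq : T -> R) = f %[ae mu].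
Proof.
have : repr fq = fm %[mod mfunq] by rewrite reprK.
by move=> /eqmodP /asboolP.
Qed.

Let fq_finite : finite_norm mu 2%:E (fq : T -> R).
Proof.
rewrite /finite_norm.
have mfq : measurable_fun setT (fq : T -> R).
  exact: (@measurable_funP _ _ _ _ setT (repr fq)).
rewrite (ae_eq_Lnorm2 mfq mf fqE).
by case/andP: fL => _; rewrite inE.
Qed.

Definition L2_class : L2 :=
  LebesgueSpace.Pack (LebesgueSpace.Class
    (isFinLebesgue.Build _ _ _ _ _ _ fq fq_finite)).

Lemma L2_classE : (L2_class : T -> R) = f %[ae mu].
Proof. exact: fqE. Qed.

End class_of.

Let Lfun0 : (cst 0 : T -> R) \in Lfun mu 2%:E.
Proof. by have [] := Lfun_submod_closed mu (lee1n 2). Qed.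

Let LfunN (f : L2) : (\- f : T -> R) \in Lfun mu 2%:E.
Proof. exact: (Lfun_oppr_closed (L2_Lfun f)). Qed.

Let LfunD (f g : L2) : (f \+ g : T -> R) \in Lfun mu 2%:E.
Proof.
have [_] := Lfun_addr_closed mu (lee1n 2).
by apply; exact: L2_Lfun.
Qed.

Let LfunZ (a : R) (f : L2) : (a \*: (f : T -> R)) \in Lfun mu 2%:E.
Proof.
have [_ /(_ a f (cst 0) (L2_Lfun f) Lfun0)] :=
  Lfun_submod_closed mu (lee1n 2).
by rewrite addr0.
Qed.

Definition L2_zero : L2 := L2_class Lfun0.
Definition L2_opp (f : L2) : L2 := L2_class (LfunN f).
Definition L2_add (f g : L2) : L2 := L2_class (LfunD f g).
Definition L2_scale (a : R) (f : L2) : L2 := L2_class (LfunZ a f).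

Lemma L2_zeroE : (L2_zero : T -> R) = cst 0 %[ae mu].
Proof. exact: L2_classE. Qed.
Lemma L2_oppE f : (L2_opp f : T -> R) = \- f %[ae mu].
Proof. exact: L2_classE. Qed.
Lemma L2_addE f g : (L2_add f g : T -> R) = f \+ g %[ae mu].
Proof. exact: L2_classE. Qed.
Lemma L2_scaleE a f : (L2_scale a f : T -> R) = a \*: (f : T -> R) %[ae mu].
Proof. exact: L2_classE. Qed.

Let L2_addA : associative L2_add.
Proof.
move=> f g h; apply: L2_eq_ae.
by apply: filterS3 (L2_addE f (L2_add g h)) (L2_addE g h)
  (filterI (L2_addE (L2_add f g) h) (L2_addE f g)) =>
  x /(_ I)/= + /(_ I)/= + [/(_ I)/= + /(_ I)/= +] _
  => -> -> -> ->; rewrite addrA.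
Qed.

Let L2_addC : commutative L2_add.
Proof.
move=> f g.
by apply: L2_eq_ae; apply: filterS2 (L2_addE f g) (L2_addE g f) =>
  x /(_ I) /= + /(_ I) /= + _ => -> ->; rewrite addrC.
Qed.

Let L2_add0 : left_id L2_zero L2_add.
Proof.
move=> f.
by apply: L2_eq_ae; apply: filterS2 (L2_addE L2_zero f) L2_zeroE =>
  x /(_ I) /= + /(_ I) /= + _ => -> ->; rewrite add0r.
Qed.

Let L2_addN : left_inverse L2_zero L2_opp L2_add.
Proof.
move=> f; apply: L2_eq_ae.
by apply: filterS3 (L2_addE (L2_opp f) f) (L2_oppE f) L2_zeroE =>
  x /(_ I) /= + /(_ I) /= + /(_ I) /= + _ => -> -> ->; rewrite addNr.
Qed.

HB.instance Definition _ := gen_eqMixin L2.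
HB.instance Definition _ := gen_choiceMixin L2.
HB.instance Definition _ :=
  GRing.isZmodule.Build L2 L2_addA L2_addC L2_add0 L2_addN.

Let L2_scaleA a b f : L2_scale a (L2_scale b f) = L2_scale (a * b) f.
Proof.
apply: L2_eq_ae.
by apply: filterS3 (L2_scaleE a (L2_scale b f)) (L2_scaleE b f)
  (L2_scaleE (a * b) f) =>
  x /(_ I) /= + /(_ I) /= + /(_ I) /= + _ => -> -> ->; rewrite scalerA.
Qed.

Let L2_scale1 : left_id 1 L2_scale.
Proof.
move=> f.
by apply: L2_eq_ae; apply: filterS (L2_scaleE 1 f) =>
  x /(_ I) /= + _ => ->; rewrite scale1r.
Qed.

Let L2_scaleDr : right_distributive L2_scale +%R.
Proof.
move=> a f g; apply: L2_eq_ae.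
by apply: filterS3 (L2_addE (L2_scale a f) (L2_scale a g))
  (L2_scaleE a (f + g))
  (filterI (L2_scaleE a f) (filterI (L2_scaleE a g) (L2_addE f g))) =>
  x /(_ I)/= + /(_ I)/= +
    [/(_ I)/= + [/(_ I)/= + /(_ I)/= +]] _
  => -> -> -> -> ->; rewrite scalerDr.
Qed.

Let L2_scaleDl f : {morph L2_scale^~ f : a b / a + b}.
Proof.
move=> a b; apply: L2_eq_ae.
by apply: filterS3 (L2_addE (L2_scale a f) (L2_scale b f)) (L2_scaleE (a + b) f)
  (filterI (L2_scaleE a f) (L2_scaleE b f)) =>
  x /(_ I)/= + /(_ I)/= + [/(_ I)/= + /(_ I)/= +] _
  => -> -> -> ->; rewrite scalerDl.
Qed.

HB.instance Definition _ := GRing.Zmodule_isLmodule.Build R L2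
  L2_scaleA L2_scale1 L2_scaleDr L2_scaleDl.

Definition L2_norm (f : L2) : R := fine 'N[mu]_2%:E[EFin \o f].

Let toLfun (f : L2) : LfunType mu (lee1n 2) := Lfun_Sub (lee1n 2) (L2_Lfun f).

Let L2_norm_ae (f : L2) (g : T -> R) : g \in Lfun mu 2%:E ->
  (f : T -> R) = g %[ae mu] -> L2_norm f = fine 'N[mu]_2%:E[EFin \o g].
Proof.
case/andP; rewrite inE => mg _ fg.
by rewrite /L2_norm (ae_eq_Lnorm2 (L2_measurable f) mg fg).
Qed.

Let L2_normD f g : L2_norm (f + g) <= L2_norm f + L2_norm g.
Proof.
rewrite (L2_norm_ae (LfunD f g) (L2_addE f g)).
exact: (ler_LnormD (toLfun f) (toLfun g)).
Qed.

Let L2_normZ a f : L2_norm (a *: f) = `|a| * L2_norm f.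
Proof.
rewrite (L2_norm_ae (LfunZ a f) (L2_scaleE a f)).
have := LnormZ (toLfun f) a.
rewrite -finite_norm_fine -EFinM.
by rewrite /L2_norm => ->.
Qed.

Let L2_norm_eq0 f : L2_norm f = 0 -> f = 0.
Proof.
move=> /(fine_Lnormr_eq0 (f := toLfun f)) f0; apply: L2_eq_ae.
by apply: filterS2 f0 L2_zeroE =>
  x /(_ I) /= + /(_ I) /= + _ => -> ->.
Qed.

HB.instance Definition _ := Lmodule_isNormed.Build R L2
  L2_normD L2_normZ L2_norm_eq0.

Definition L2_inner (f g : L2) : R := \int[mu]_x (f x * g x).

Lemma L2_inner_norm (f : L2) : L2_inner f f = `|f| ^+ 2.
Proof.
have /= := @finite_norm_fine _ _ _ mu _ (lee1n 2) (toLfun f).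
rewrite -/(L2_norm f) => fE.
have /= := poweR_Lnorm mu (EFin \o f) (_ : 2 != 0 :> R).
rewrite -fE => /(_ _)/= H.
have : ((L2_norm f ^+ 2)%:E = \int[mu]_x ((f x * f x)%:E))%E.
  have := H (lt0r_neq0 (ltr0n _ 2)).
  rewrite powR_mulrn; last by rewrite fine_ge0// Lnorm_ge0.
  move=> ->; apply: eq_integral => x _.
  by rewrite powR_mulrn// real_normK// num_real.
by rewrite /L2_inner /Rintegral => <-.
Qed.

End L2_classes.

Section Ck_functions.
Context {R : realType} {n : nat}.
Implicit Types (k : nat) (f : 'rV[R]_n -> R).

Definition basis_vec (i : 'I_n) : 'rV[R]_n := delta_mx 0 i.

Fixpoint Ck k f : Prop :=
  continuous f /\
  if k is k'.+1 then
    forall i, (forall x, derivable f x (basis_vec i)) /\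
              Ck k' ('D_(basis_vec i) f)
  else True.

Definition smooth f := forall k, Ck k f.

End Ck_functions.

(* Near every boundary point, up to the choice of one coordinate axis i and of
   its orientation s, Omega is the region strictly above the graph of a C^2
   function of the remaining coordinates. *)
Definition C2_boundary {R : realType} {d : nat} (Omega : set 'rV[R]_d) : Prop :=
  forall x0, (closure Omega `\` interior Omega) x0 ->
  exists r : R, 0 < r /\
  exists (i : 'I_d) (s : bool) (h : 'rV[R]_d.-1 -> R), Ck 2 h /\
  forall x, ball x0 r x ->
    (Omega x <-> 0 < (-1) ^+ s * (x 0 i - h (col' i x))).

Section Sobolev.
Context {R : realType} {d : nat} {Omega : set 'rV[R]_d}.

Definition lebesgue_on (Omega_open : open Omega) :
    {measure set 'rV[R]_d -> \bar R} :=
  mrestr (lebesgue_rV R d) (open_measurable_rV Omega_open).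

Definition L2on (Omega_open : open Omega) : normedModType R :=
  L2 (lebesgue_on Omega_open).

Definition test_function (phi : 'rV[R]_d -> R) : Prop :=
  [/\ smooth phi, compact (closure [set x | phi x != 0]) &
      closure [set x | phi x != 0] `<=` Omega].

Variable Omega_open : open Omega.
Local Notation mu := (lebesgue_on Omega_open).
Local Notation L2O := (L2on Omega_open).
Implicit Types (u v f g : L2O) (U V : L2O * L2O).

Definition is_weak_derivative (i : 'I_d) u g : Prop :=
  forall phi, test_function phi ->
    \int[mu]_x ((u : L2 _) x * 'D_(basis_vec i) phi x) =
    - \int[mu]_x ((g : L2 _) x * phi x).

Definition H1 : set L2O :=
  [set u | forall i, exists g, is_weak_derivative i u g].

(* Meaningful when the i-th weak derivative of u exists in L^2. *)
Definition weak_derivative (i : 'I_d) u : L2O :=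
  xget 0 [set g | is_weak_derivative i u g].

Definition H2 : set L2O :=
  [set u | H1 u /\ forall i, H1 (weak_derivative i u)].

Definition laplacian u : L2O :=
  \sum_(i < d) weak_derivative i (weak_derivative i u).

Definition H1_norm u : R :=
  Num.sqrt (`|u| ^+ 2 + \sum_(i < d) `|weak_derivative i u| ^+ 2).

Definition test_class : set L2O :=
  [set f | exists2 phi, test_function phi &
    ((f : L2 _) : 'rV[R]_d -> R) = phi %[ae mu]].

Definition H10 : set L2O :=
  [set u | H1 u /\
    forall e, 0 < e -> exists2 f, test_class f & H1_norm (u - f) < e].

Definition grad_inner u v : R :=
  \sum_(i < d) L2_inner (weak_derivative i u) (weak_derivative i v).

Definition H10_norm u : R := Num.sqrt (grad_inner u u).

Definition energy_space : set (L2O * L2O) := [set U | H10 U.1].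

Definition energy_inner U V : R := grad_inner U.1 V.1 + L2_inner U.2 V.2.

Definition energy_norm U : R := Num.sqrt (energy_inner U U).

Definition bounded_operator (A : L2O -> L2O) : Prop :=
  exists M : R, forall f, `|A f| <= M * `|f|.

Definition orthogonal_projection (A : L2O -> L2O) : Prop :=
  (forall f, A (A f) = A f) /\
  (forall f g, L2_inner (A f) g = L2_inner f (A g)).

Definition commutes_with_laplacian (A : L2O -> L2O) : Prop :=
  forall phi, H2 phi -> H10 phi ->
    [/\ H2 (A phi), H10 (A phi) & A (laplacian phi) = laplacian (A phi)].

Definition wave_operator (A : L2O -> L2O) U : L2O * L2O :=
  (- U.2, - laplacian U.1 + A U.2).

Definition wave_domain : set (L2O * L2O) :=
  [set U | [/\ H2 U.1, H10 U.1 & H10 U.2]].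

(* Only the values S t U with 0 <= t and U in energy_space matter. *)
Record contraction_semigroup (S : R -> L2O * L2O -> L2O * L2O) : Prop := {
  semigroup_stable : forall t U, 0 <= t -> energy_space U ->
    energy_space (S t U) ;
  semigroup_linear : forall t (a : R) U V, 0 <= t ->
    energy_space U -> energy_space V ->
    S t (a *: U + V) = a *: S t U + S t V ;
  semigroup_contraction : forall t U, 0 <= t -> energy_space U ->
    energy_norm (S t U) <= energy_norm U ;
  semigroup_0 : forall U, energy_space U -> S 0 U = U ;
  semigroup_D : forall s t U, 0 <= s -> 0 <= t -> energy_space U ->
    S (s + t) U = S s (S t U) ;
  semigroup_continuous : forall U, energy_space U ->
    energy_norm (S t U - U) @[t --> 0^'+] --> 0
}.

(* The infinitesimal generator of S on the energy space is A, with domain D. *)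
Definition has_generator (S : R -> L2O * L2O -> L2O * L2O)
    (D : set (L2O * L2O)) (A : L2O * L2O -> L2O * L2O) : Prop :=
  forall U V, energy_space U -> energy_space V ->
    (energy_norm (t^-1 *: (S t U - U) - V) @[t --> 0^'+] --> 0) <->
    (D U /\ V = A U).

Definition wave_semigroup (A : L2O -> L2O)
    (S : R -> L2O * L2O -> L2O * L2O) : Prop :=
  contraction_semigroup S /\
  has_generator S wave_domain (fun U => - wave_operator A U).

Definition semigroup_solution (S : R -> L2O * L2O -> L2O * L2O)
    U (sol : R -> L2O * L2O) : Prop :=
  energy_space U /\ forall t, 0 <= t -> sol t = S t U.

End Sobolev.

(* Main.v *)
(* Green's formula and the commutation of P with the Laplacian give
   |grad (P u)| <= |grad u| for test functions u, so that, by density and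
   completeness, P acts as a contraction on H^1_0 and on the energy space.
   Let U = S_P(t) U_0 with U_0 in the domain of the generator.
   The component Q U satisfies the undamped equation, because Q P = 0, and the
   energy of its difference with S_0(t) Q U_0 has zero derivative. The component
   P U = (y, z) satisfies the fully damped equation, because P P = P, and the
   functional |grad y|^2 + |z|^2 + 2 eps (y, z) decays exponentially by
   Poincare's inequality. Both conclusions extend to the whole energy space
   because the semigroups are contractions and test functions are dense in
   H^1_0 x L^2, the density in L^2 coming from the fundamental lemma of the
   calculus of variations. *)

(* A missing weak derivative takes the default value 0, so the form (grad u, grad v) is bilinear
   only where weak derivatives exist; moreover the energy norm is not the norm carried by the
   product type. The energy arguments therefore take place on an abstract vector space, for
   semi-inner products that are linear on a subset only, with limits written in epsilons. The
   Sobolev facts enter there as hypotheses.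

   A semigroup is given by its axioms and its generator, that is, by right derivatives at time 0.
   Energy estimates need two-sided derivatives at every t > 0 and right continuity at 0. The missing
   left derivative comes from the contraction property together with strong continuity at the image
   of the generator.

   If C is the Poincare constant, eps = 1 / (4 (1 + C)) keeps the modified functional between 3/4
   and 5/4 of the energy and gives the rate gamma = eps / 4. The constant M is 4 times the initial
   energy norm, plus 1 to be positive for the zero datum. *)
Require Import Defs.
From mathcomp Require Import all_boot all_order all_algebra.
From mathcomp Require Import all_classical all_reals all_analysis.
From mathcomp Require Import measurable_realfun.
From mathcomp Require Import ring lra.
Set Implicit Arguments.
Unset Strict Implicit.
Unset Printing Implicit Defensive.
Import Order.TTheory GRing.Theory Num.Theory.
Import numFieldNormedType.Exports.
Local Open Scope classical_set_scope.
Local Open Scope ring_scope.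

(** * The Hilbert space L^2 *)

Section L2_inner_product.
Context d (T : measurableType d) (R : realType).
Variable mu : {measure set T -> \bar R}.
Implicit Types f g h : L2 mu.

Lemma L2_mul_integrable f g : mu.-integrable setT (EFin \o (f \* g)).
Proof. by apply/Lfun1_integrable/Lfun2_mul_Lfun1; exact: L2_Lfun. Qed.

Lemma L2D_ae f g : (f + g : L2 mu) = (f : T -> R) \+ g %[ae mu].
Proof. exact: L2_addE. Qed.

Lemma L2Z_ae a f : (a *: f : L2 mu) = a \*: (f : T -> R) %[ae mu].
Proof. exact: L2_scaleE. Qed.

Lemma L2N_ae f : (- f : L2 mu) = \- (f : T -> R) %[ae mu].
Proof. exact: L2_oppE. Qed.

Lemma L2B_ae f g : (f - g : L2 mu) = (f : T -> R) \- g %[ae mu].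
Proof.
apply: filterS2 (L2D_ae f (- g)) (L2N_ae g) => x /(_ I) /= -> /(_ I) /= ->.
by [].
Qed.

(** Sums and multiples of classes have representatives that agree with the pointwise operations only
    almost everywhere; the bilinearity of the inner product goes through this change of
    representatives. *)
Lemma L2_inner_ae f g (F G : T -> R) : measurable_fun setT F ->
  measurable_fun setT G -> (f : T -> R) = F %[ae mu] ->
  (g : T -> R) = G %[ae mu] -> L2_inner f g = \int[mu]_x (F x * G x).
Proof.
move=> mF mG fF gG; rewrite /L2_inner /Rintegral; congr fine.
apply: ae_eq_integral => //.
- by apply/measurable_EFinP/measurable_funM; exact: L2_measurable.
- exact/measurable_EFinP/measurable_funM.
- by apply: filterS2 fF gG => x /(_ I) + /(_ I) + _ => -> ->.
Qed.

Lemma L2_innerC f g : L2_inner f g = L2_inner g f.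
Proof. by apply: eq_Rintegral => x _; rewrite mulrC. Qed.

Lemma L2_innerDl f g h : L2_inner (f + g) h = L2_inner f h + L2_inner g h.
Proof.
rewrite (@L2_inner_ae (f + g) h (f \+ g) h)//.
- rewrite -RintegralD//; try exact: L2_mul_integrable.
  by apply: eq_Rintegral => x _ /=; rewrite mulrDl.
- by apply: measurable_funD; exact: L2_measurable.
- exact: L2_measurable.
- exact: L2D_ae.
- exact: ae_eq_refl.
Qed.

Lemma L2_innerZl a f h : L2_inner (a *: f) h = a * L2_inner f h.
Proof.
rewrite (@L2_inner_ae (a *: f) h (a \*: (f : T -> R)) h)//.
- rewrite -RintegralZl//; last exact: L2_mul_integrable.
  by apply: eq_Rintegral => x _ /=; rewrite -[a *: _]/(a * _) mulrA.
- by apply: measurable_funM => //; exact: L2_measurable.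
- exact: L2_measurable.
- exact: L2Z_ae.
- exact: ae_eq_refl.
Qed.

Lemma L2_innerDr f g h : L2_inner h (f + g) = L2_inner h f + L2_inner h g.
Proof. by rewrite L2_innerC L2_innerDl !(L2_innerC h). Qed.
Lemma L2_innerZr a f h : L2_inner h (a *: f) = a * L2_inner h f.
Proof. by rewrite L2_innerC L2_innerZl (L2_innerC h). Qed.
Lemma L2_innerNl f h : L2_inner (- f) h = - L2_inner f h.
Proof. by rewrite -scaleN1r L2_innerZl mulN1r. Qed.
Lemma L2_innerNr f h : L2_inner h (- f) = - L2_inner h f.
Proof. by rewrite L2_innerC L2_innerNl (L2_innerC h). Qed.
Lemma L2_innerBl f g h : L2_inner (f - g) h = L2_inner f h - L2_inner g h.
Proof. by rewrite L2_innerDl L2_innerNl. Qed.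
Lemma L2_innerBr f g h : L2_inner h (f - g) = L2_inner h f - L2_inner h g.
Proof. by rewrite L2_innerDr L2_innerNr. Qed.
Lemma L2_inner0l f : L2_inner 0 f = 0.
Proof. by rewrite -(scale0r f) L2_innerZl mul0r. Qed.
Lemma L2_inner0r f : L2_inner f 0 = 0.
Proof. by rewrite L2_innerC L2_inner0l. Qed.

Lemma L2_inner_suml I (r : seq I) (P : pred I) (F : I -> L2 mu) h :
  L2_inner (\sum_(i <- r | P i) F i) h = \sum_(i <- r | P i) L2_inner (F i) h.
Proof.
elim/big_rec2 : _ => [|i y x _ <-]; first exact: L2_inner0l.
exact: L2_innerDl.
Qed.

Lemma L2_inner_eq0 f : L2_inner f f = 0 -> f = 0.
Proof. by rewrite L2_inner_norm => /eqP;
  rewrite sqrf_eq0 normr_eq0 => /eqP. Qed.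

Lemma L2_cauchy_schwarz f g : `|L2_inner f g| <= `|f| * `|g|.
Proof.
have [->|g0] := eqVneq g 0; first by rewrite L2_inner0r !normr0 mulr0.
have gg : 0 < `|g| ^+ 2 by rewrite exprn_gt0// normr_gt0.
(* Projecting [f] on [g] and clearing the denominator [|g| ^+ 2] turns this square into [|g| ^+ 2]
   times the defect in the inequality. *)
have : 0 <= L2_inner (`|g| ^+ 2 *: f - L2_inner f g *: g)
               (`|g| ^+ 2 *: f - L2_inner f g *: g).
  by rewrite L2_inner_norm sqr_ge0.
rewrite !(L2_innerBl, L2_innerBr, L2_innerZl, L2_innerZr) !L2_inner_norm.
rewrite (L2_innerC g f) => h.
have {}h : 0 <= `|g| ^+ 2 * ((`|f| * `|g|) ^+ 2 - L2_inner f g ^+ 2).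
  by apply: le_trans h _; rewrite le_eqVlt; apply/orP; left; apply/eqP; ring.
rewrite pmulr_rge0// subr_ge0 in h.
by rewrite -(@ler_pXn2r _ 2) ?nnegrE ?mulr_ge0// real_normK// num_real.
Qed.

End L2_inner_product.

(** * Completeness of L^2 *)

Section Riesz_Fischer.
Context d (T : measurableType d) (R : realType).
Variable mu : {measure set T -> \bar R}.

Lemma L2_norm_integral (f : L2 mu) :
  (\int[mu]_x ((f : T -> R) x ^+ 2)%:E = (`|f| ^+ 2)%:E)%E.
Proof.
rewrite -L2_inner_norm /L2_inner /Rintegral fineK.
  by apply: eq_integral => x _; rewrite expr2.
by apply: (integrable_fin_num measurableT); exact: L2_mul_integrable.
Qed.

Lemma Lfun2P (F : T -> R) : measurable_fun setT F ->
  (\int[mu]_x (F x ^+ 2)%:E < +oo)%E -> F \in Lfun mu 2%:E.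
Proof.
move=> mF Foo; apply/andP; split; rewrite inE//=.
rewrite /finite_norm unlock /=; apply: poweR_lty.
rewrite (eq_integral (fun x => (F x ^+ 2)%:E))// => x _.
by rewrite powR_mulrn// real_normK// num_real.
Qed.

(* Since |h| <= 2^-k + 2^k h^2, absolute convergence follows from the
   integrability of the sum of the 2^k h_k^2. *)
Lemma L2_series_cvg_ae (f : (L2 mu)^nat) :
  (forall k, `|f k.+1 - f k| ^+ 2 <= 4^-1 ^+ k) ->
  {ae mu, forall x, cvgn (fun k => (f k : T -> R) x)}.
Proof.
move=> fk.
pose h k x := (f k.+1 : T -> R) x - (f k : T -> R) x.
have mh k : measurable_fun setT (h k).
  by apply: measurable_funB; exact: L2_measurable.
have hk k : (\int[mu]_x (h k x ^+ 2)%:E = (`|f k.+1 - f k| ^+ 2)%:E)%E.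
  rewrite -L2_norm_integral; apply: ae_eq_integral => //.
  - exact/measurable_EFinP/measurable_funX.
  - by apply/measurable_EFinP/measurable_funX; exact: L2_measurable.
  - by apply: filterS (L2B_ae (f k.+1) (f k)) => x /(_ I) /= ->.
have mS k : measurable_fun setT (fun x => (2 ^+ k * h k x ^+ 2)%:E).
  by apply/measurable_EFinP/measurable_funM => //; exact: measurable_funX.
have S0 k x : (0 <= (2 ^+ k * h k x ^+ 2)%:E)%E.
  by rewrite lee_fin mulr_ge0 ?sqr_ge0// exprn_ge0.
have Soo : (\int[mu]_x (\sum_(k <oo) (2 ^+ k * h k x ^+ 2)%:E) < +oo)%E.
  rewrite integral_nneseries//.
  apply: (@le_lt_trans _ _ (\sum_(k <oo) (2^-1 ^+ k)%:E)%E).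
    apply: lee_nneseries => [k _ _|k _]; first exact: integral_ge0.
    under eq_integral do rewrite EFinM.
    rewrite ge0_integralZl_EFin//;
      [|by move=> x _; rewrite lee_fin sqr_ge0
       |exact/measurable_EFinP/measurable_funX].
    rewrite hk -EFinM lee_fin.
    apply: le_trans (ler_wpM2l _ (fk k)) _; first by rewrite exprn_ge0.
    rewrite -exprMn (_ : 2 * 4^-1 = 2^-1 :> R)//; lra.
  rewrite (_ : (\sum_(k <oo) _)%E = (2 / 2 ^+ 0)%:E) ?ltry//.
  apply/cvg_lim => //; have := @cvg_geometric_eseries_half R 2 0.
  apply: cvg_trans.
  apply: near_eq_cvg; apply: nearW => n; apply: eq_bigr => k _.
  by rewrite addn1 natrX exprS invfM mulrA divff// mul1r exprVn.
have iS : mu.-integrable setT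
    (fun x => \sum_(k <oo) (2 ^+ k * h k x ^+ 2)%:E)%E.
  apply/integrableP; split.
    exact: ge0_emeasurable_sum.
  under eq_integral do rewrite gee0_abs ?nneseries_ge0//.
  done.
have := integrable_ae measurableT iS.
apply: filterS => x /(_ I) Sx.
have cS : cvgn (series (fun k => 2 ^+ k * h k x ^+ 2)).
  apply: nondecreasing_is_cvgn.
    by apply/nondecreasing_series => k _ _; rewrite -lee_fin.
  exists (fine (\sum_(k <oo) (2 ^+ k * h k x ^+ 2)%:E)%E) => _ [n _ <-].
  rewrite -lee_fin fineK// /series /= -sumEFin; exact: nneseries_lim_ge.
have cg : cvgn (series (fun k => 2^-1 ^+ k : R)).
  have := @is_cvg_geometric_series R 1 2^-1.
  rewrite exprn_geometric; apply; rewrite gtr0_norm; lra.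
have /normed_cvg : cvgn (series (fun k => `|h k x|)).
  apply: (@series_le_cvg _ _ (fun k => 2^-1 ^+ k + 2 ^+ k * h k x ^+ 2)) =>
    [k|k|k|].
  - by [].
  - apply: addr_ge0; first by rewrite exprn_ge0// invr_ge0.
    by apply: mulr_ge0; rewrite ?sqr_ge0// exprn_ge0.
  - rewrite -[h k x ^+ 2]real_normK ?num_real//.
    move: (`|h k x|) (normr_ge0 (h k x)) => a a0.
    have P0 : 0 < 2 ^+ k :> R by rewrite exprn_gt0.
    rewrite -subr_ge0 exprVn (_ : _ - _ =
      (2 ^+ k)^-1 * ((2 ^+ k * a - 2^-1) ^+ 2 + 3 / 4)).
      by apply: mulr_ge0; rewrite ?invr_ge0 ?(ltW P0)// addr_ge0 ?sqr_ge0//.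
    by field; rewrite gt_eqF.
  rewrite [X in cvgn X](_ : _ = series (fun k =>
    2^-1 ^+ k) + series (fun k => 2 ^+ k * h k x ^+ 2)).
    exact: is_cvgD.
  by apply/funext => n; rewrite /series/= big_split.
move=> /cvg_ex[/= l hl].
apply/cvg_ex; exists (l + (f 0%N : T -> R) x).
have -> : (fun k => (f k : T -> R) x) =
    series (fun k => h k x) \+ cst ((f 0%N : T -> R) x).
  apply/funext => n; rewrite /series/= telescope_sumr//; ring.
by apply: cvgD => //; exact: cvg_cst.
Qed.

(** Fatou's lemma applied to the squares of [f k - g]. The limit [F] is a mere measurable function:
    that [F - g] is square-integrable is deduced from this bound. *)
Lemma L2_fatou (f : (L2 mu)^nat) (g : L2 mu) (F : T -> R) (e : R) :
  0 <= e -> measurable_fun setT F ->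
  {ae mu, forall x, (f k : T -> R) x @[k --> \oo] --> F x} ->
  (forall k, `|f k - g| <= e) ->
  (\int[mu]_x ((F x - (g : T -> R) x) ^+ 2)%:E <= (e ^+ 2)%:E)%E.
Proof.
move=> e0 mF fF fg.
pose r k x := ((((f k : T -> R) x - (g : T -> R) x) ^+ 2)%:E : \bar R).
have mr k : measurable_fun setT (r k).
  by apply/measurable_EFinP/measurable_funX/measurable_funB;
    exact: L2_measurable.
have rE k : (\int[mu]_x r k x = (`|f k - g| ^+ 2)%:E)%E.
  rewrite -L2_norm_integral; apply: ae_eq_integral => //.
    by apply/measurable_EFinP/measurable_funX; exact: L2_measurable.
  by apply: filterS (L2B_ae (f k) g) => x /(_ I) /= -> _.
rewrite (@ae_eq_integral _ _ _ mu setT (fun x => limn_einf (r ^~ x)))//;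
  first last.
- apply: filterS fF => x fx _.
  have /cvg_limn_einf_sup [-> _] // : r ^~ x @ \oo --> ((F x - (g : T ->
    R) x) ^+ 2)%:E.
  apply: cvg_EFin; first exact: nearW.
  by apply: cvgM; apply: cvgB => //; exact: cvg_cst.
- rewrite (_ : (fun x => _) = (fun x => - limn_esup ((fun k x =>
  - r k x) ^~ x)))%E.
    apply: measurableT_comp => //; apply: measurable_fun_limn_esup => n.
    exact: measurableT_comp.
  apply/funext => x; rewrite -limn_einfN; congr limn_einf.
  by apply/funext => n; apply/esym; exact: oppeK.
- apply/measurable_EFinP/measurable_funX/measurable_funB => //.
  exact: L2_measurable.
apply: (le_trans (fatou _ _ _ _)) => //.
  by move=> n x _; rewrite lee_fin sqr_ge0.
rewrite limn_einf_lim; apply: lime_le; first exact: is_cvg_einfs.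
apply: nearW => n; apply: le_trans (ereal_inf_lbound _) _;
  first by exists n => /=.
by rewrite lee_fin ler_sqr ?nnegrE.
Qed.

(** A subsequence with increments at most 2^-k converges almost everywhere. Fatou's lemma, with a
    term of the sequence in the role of [g], then bounds the distance from the pointwise limit to
    every late term. *)
Lemma L2_complete (f : (L2 mu)^nat) :
  (forall e, 0 < e -> exists N, forall m n, (N <= m)%N -> (N <= n)%N ->
    `|f m - f n| <= e) ->
  exists g : L2 mu, f @ \oo --> g.
Proof.
move=> cf.
have /choice[N NP] k : exists N, forall m n, (N <= m)%N -> (N <= n)%N ->
    `|f m - f n| <= 2^-1 ^+ k by apply: cf; rewrite exprn_gt0// invr_gt0.
(* Partial sums of [N] give a nondecreasing choice of indices that still dominates [N k]. *)
pose s k := (\sum_(j < k.+1) N j)%N.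
have Ns k : (N k <= s k)%N by rewrite /s big_ord_recr/= leq_addl.
have ss k : (s k <= s k.+1)%N by rewrite /s [leqRHS]big_ord_recr/= leq_addr.
have {}Ns k m : (k <= m)%N -> (N k <= s m)%N.
  elim: m => [|m IH]; first by rewrite leqn0 => /eqP ->.
  rewrite leq_eqVlt => /predU1P[-> //|]; rewrite ltnS => /IH.
  by move/leq_trans; apply.
(* The upper limit is defined and measurable everywhere and equals the limit wherever the
   subsequence converges. *)
pose F x := fine (limn_esup (fun k => ((f (s k) : T -> R) x)%:E)).
have mF : measurable_fun setT F.
  apply: measurableT_comp => //.
  apply: (@measurable_fun_limn_esup _ _ _ setT (fun k x => ((f (s k) : T ->
    R) x)%:E)) => k.
  by apply/measurable_EFinP; exact: L2_measurable.
have fF : {ae mu, forall x, (f (s k) : T -> R) x @[k --> \oo] --> F x}.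
  suff /L2_series_cvg_ae : forall k,
    `|(f \o s) k.+1 - (f \o s) k| ^+ 2 <= 4^-1 ^+ k.
    apply: filterS => x /cvg_ex[/= l fl].
    rewrite /F (_ : limn_esup _ = l%:E)//.
    by apply: (cvg_limn_einf_sup _).2; apply: cvg_EFin => //; exact: nearW.
  move=> k; apply: (@le_trans _ _ ((2^-1 ^+ k) ^+ 2)).
    by rewrite ler_sqr ?nnegrE ?exprn_ge0 ?invr_ge0//; apply: NP; exact: Ns.
  by rewrite -exprM mulnC exprM (_ : 2^-1 ^+ 2 = 4^-1 :> R)//; field.
have fatou n k : (N k <= n)%N ->
    (\int[mu]_x ((F x - (f n : T -> R) x) ^+ 2)%:E <= ((2^-1 ^+ k) ^+ 2)%:E)%E.
  move=> kn; apply: (@L2_fatou (fun m => f (s (m + k)%N))).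
  - by rewrite exprn_ge0 ?invr_ge0.
  - exact: mF.
  - apply: filterS fF => x.
    by rewrite -(cvg_shiftn k).
  - move=> m; apply: NP => //; apply: Ns; exact: leq_addl.
have FL n k : (N k <= n)%N -> (fun x => F x - (f n : T ->
  R) x) \in Lfun mu 2%:E.
  move=> kn; apply: Lfun2P; first by apply: measurable_funB => //;
    exact: L2_measurable.
  exact: le_lt_trans (fatou _ _ kn) (ltry _).
(* Only the difference of [F] and a term is known to be in L^2, so the limit class is that
   difference plus the term. *)
pose h := L2_class (FL _ _ (leqnn (N 0%N))).
exists (h + f (N 0%N)).
apply/cvgrPdist_le => e e0.
have [k ke] : exists k, 2^-1 ^+ k <= e.
  have /cvgrPdist_le /(_ e e0)[k _ /(_ k (leqnn k))] :=
    @cvg_geometric R 1 2^-1 ltac:(rewrite gtr0_norm; lra).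
  by rewrite /= mul1r sub0r normrN normrX gtr0_norm ?invr_gt0// => ?; exists k.
exists (N k) => // n /= kn; apply: le_trans ke.
rewrite -(@ler_pXn2r _ 2) ?nnegrE ?exprn_ge0 ?invr_ge0// -lee_fin.
apply: le_trans (fatou _ _ kn).
rewrite -L2_norm_integral le_eqVlt; apply/orP; left; apply/eqP.
apply: ae_eq_integral => //.
- by apply/measurable_EFinP/measurable_funX; exact: L2_measurable.
- apply/measurable_EFinP/measurable_funX/measurable_funB => //;
  exact: L2_measurable.
- apply: filterS3 (L2B_ae (h + f (N 0%N)) (f n)) (L2D_ae h (f (N 0%N)))
  (L2_classE (FL _ _ (leqnn (N 0%N)))).
  by move=> x /(_ I) /= -> /(_ I) /= -> /(_ I) -> _; rewrite subrK.
Qed.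
End Riesz_Fischer.

(** * Smooth functions and test functions *)

Lemma cvg_is_derive (R : realType) (V : normedModType R) (f : V -> R) (x v : V)
    (df : R) :
  h^-1 *: (f (h *: v + x) - f x) @[h --> 0^'] --> df -> is_derive x v f df.
Proof.
move=> fdf; apply: DeriveDef; last exact/cvg_lim.
by apply/cvg_ex; exists df.
Qed.

Section directional_derivatives.
Context (R : realType) (V : normedModType R).
Implicit Types (f g : V -> R) (x v : V).

(** A directional derivative sees only one line, so the chain rule and the slicing used in
    integration by parts reduce to functions of one real variable. *)
Lemma is_derive_line f x v (df : R) :
  is_derive x v f df <-> is_derive (0 : R) 1 (fun h => f (h *: v + x)) df.
Proof.
have E : (fun h : R => h^-1 *: (f (h *: v + x) - f x)) =
    (fun h : R => h^-1 *: (f ((h *: 1 + 0 : R) *: v + x) - f ((0 : R) *: v +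
      x))).
  by apply/funext => h; rewrite addr0 scale0r add0r [_%:A]mulr1.
split=> -[dfx <-].
  apply: cvg_is_derive; rewrite -E; exact: dfx.
apply: cvg_is_derive; rewrite E; exact: dfx.
Qed.

Lemma is_derive_comp f (g : R -> R) x v (df dg : R) :
  is_derive x v f df -> is_derive (f x) 1 g dg ->
  is_derive x v (g \o f) (dg * df).
Proof.
move=> /is_derive_line fdf gdg; apply/is_derive_line.
have := @derive1_comp R (fun h =>
  f (h *: v + x)) g 0 (@ex_derive _ _ _ _ _ _ _ fdf).
rewrite scale0r add0r => /(_ (@ex_derive _ _ _ _ _ _ _ gdg)).
rewrite !derive1E !derive_val => gf.
apply: DeriveDef => //.
apply/derivable1_diffP; 
apply: (@differentiable_comp _ _ _ _ (fun h : R => f (h *: v + x)) g).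
  apply/derivable1_diffP; exact: (@ex_derive _ _ _ _ _ _ _ fdf).
rewrite scale0r add0r; apply/derivable1_diffP.
exact: (@ex_derive _ _ _ _ _ _ _ gdg).
Qed.

End directional_derivatives.

Section flat_functions.
Context {R : realType}.

(* This family of flat functions is closed under differentiation, up to linear
   combinations (see is_derive_flat), which makes their smoothness immediate. *)
Definition flat (m : nat) (x : R) : R :=
  if 0 < x then x^-1 ^+ m * expR (- x^-1) else 0.

Lemma flat_le0 m x : x <= 0 -> flat m x = 0.
Proof. by move=> x0; rewrite /flat ltNge x0. Qed.

Lemma flat_ge0 m x : 0 <= flat m x.
Proof.
rewrite /flat; case: ifPn => // x0.
by rewrite mulr_ge0 ?expR_ge0// exprn_ge0// invr_ge0 ltW.
Qed.

Lemma flat0_gt0 x : 0 < x -> 0 < flat 0 x.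
Proof. by move=> x0; rewrite /flat x0 mul1r expR_gt0. Qed.

Lemma flat0_le1 x : flat 0 x <= 1.
Proof.
rewrite /flat; case: ifPn => // x0; rewrite mul1r -expR0 ler_expR.
by rewrite oppr_le0 invr_ge0 ltW.
Qed.

(** From e^y >= y^(m+2) / (m+2)! at y = 1/x. The quadratic bound makes the difference quotient of
    [flat m] at 0 tend to 0. *)
Lemma flat_quadratic m x : flat m x <= m.+2`!%:R * x ^+ 2.
Proof.
rewrite /flat; case: ifPn => [x0|_]; last by rewrite mulr_ge0// sqr_ge0.
have y0 : 0 < x^-1 by rewrite invr_gt0.
have F0 : (0 : R) < m.+2`!%:R by rewrite ltr0n fact_gt0.
have h : x^-1 ^+ m.+2 <= m.+2`!%:R * expR x^-1.
  rewrite mulrC -ler_pdivrMr//.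
  by apply: le_trans (expR_ge1Dxn m.+1 (ltW y0)); rewrite lerDr.
rewrite expRN ler_pdivrMr ?expR_gt0// mulrAC.
rewrite -[leLHS]mulr1 -[X in _ * X](@divff _ (x ^+ 2)) ?sqrf_eq0 ?gt_eqF//.
rewrite mulrCA mulrC ler_wpM2r ?sqr_ge0//.
by rewrite -exprVn -exprD addn2.
Qed.

Lemma is_derive_flat m (x : R) :
  is_derive x (1 : R) (flat m) (- m%:R * flat m.+1 x + flat m.+2 x).
Proof.
have [x0|x0|->] := ltgtP x 0.
- rewrite !flat_le0 ?ltW// mulr0 addr0.
  apply: (@near_eq_is_derive _ _ _ (cst 0)).
  near=> y; rewrite flat_le0//; apply: ltW; near: y.
  exact: lt_nbhsl.
- have dV : is_derive x (1 : R) (fun y : R => y^-1) (- x ^- 2).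
    apply: DeriveDef; first by apply: derivableV => //; rewrite gt_eqF.
    by rewrite deriveV ?gt_eqF// derive_val [_ *: 1]mulr1.
  have dE := is_derive_comp (is_deriveN dV) (is_derive_expR (- x^-1)).
  have dX := @is_deriveX _ _ _ m x 1 _ dV.
  have := is_deriveM dX dE.
  rewrite (_ : _ + _ = - m%:R * flat m.+1 x + flat m.+2 x).
    apply: near_eq_is_derive; near=> y.
    have y0 : 0 < y by near: y; exact: lt_nbhsr.
    by rewrite !fctE /= /flat y0.
  rewrite !fctE /= /flat x0.
  rewrite -[LHS]/(_ * _ + _ * (_ * _)) opprK -!exprVn.
  by case: m {dX} => [|m] /=; rewrite ?exprS; ring.
- rewrite !flat_le0// mulr0 addr0; apply: cvg_is_derive.
  apply/cvgrPdist_le => e e0; near=> h.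
  rewrite addr0 [_%:A]mulr1 (@flat_le0 m 0)// subr0 sub0r normrN.
  have h0 : h != 0 by near: h; exact: nbhs_dnbhs_neq.
  rewrite -[_ *: _]/(_ * _) normrM normfV (ger0_norm (flat_ge0 _ _)).
  rewrite mulrC ler_pdivrMr ?normr_gt0//.
  apply: le_trans (flat_quadratic _ _) _.
  rewrite -real_normK ?num_real// expr2 mulrA ler_wpM2r//.
  rewrite -ler_pdivlMl ?ltr0n ?fact_gt0//.
  near: h; apply: dnbhs0_le; rewrite mulr_gt0// invr_gt0 ltr0n fact_gt0//.
Unshelve. all: by end_near.
Qed.

Lemma continuous_flat m : continuous (flat m).
Proof.
move=> x; apply: differentiable_continuous; apply/derivable1_diffP.
by have [] := is_derive_flat m x.
Qed.

End flat_functions.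

Section Ck_closure.
Context {R : realType} {n : nat}.
Implicit Types (k : nat) (f g : 'rV[R]_n -> R).

Lemma CkS k f (df : 'I_n -> 'rV[R]_n -> R) : continuous f ->
  (forall i x, is_derive x (basis_vec i) f (df i x)) ->
  (forall i, Ck k (df i)) -> Ck k.+1 f.
Proof.
move=> cf fdf Cdf; split=> // i; split=> [x|]; first by case: (fdf i x).
rewrite (_ : 'D_(basis_vec i) f = df i)//; apply/funext => x.
exact: (@derive_val _ _ _ _ _ _ _ (fdf i x)).
Qed.

Lemma Ck_continuous k f : Ck k f ->
  continuous f. Proof. by case: k => [|k] []. Qed.

Lemma CkS_is_derive k f i x : Ck k.+1 f ->
  is_derive x (basis_vec i) f ('D_(basis_vec i) f x).
Proof. by case=> _ /(_ i)[+ _]; move=> /(_ x)/derivableP. Qed.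

Lemma CkW k f : Ck k.+1 f -> Ck k f.
Proof.
elim: k f => [|k IH] f [cf Cf]; first by split.
by split=> // i; have [df Cdf] := Cf i; split=> //; exact: IH.
Qed.

Lemma Ck_cst k (c : R) : Ck k (fun _ : 'rV[R]_n => c).
Proof.
elim: k c => [|k IH] c; first by split => //; exact: cst_continuous.
apply: (@CkS _ _ (fun _ _ => 0)) => //; exact: cst_continuous.
Qed.

Lemma Ck_coord k i : Ck k (fun x : 'rV[R]_n => x 0 i).
Proof.
have c : continuous (fun x : 'rV[R]_n => x 0 i) by exact: coord_continuous.
case: k => [|k]; first by split.
apply: (@CkS _ _ (fun j _ => (i == j)%:R)) => //.
  move=> j x; apply: cvg_is_derive; apply: cvg_near_cst; near=> h.
  have h0 : h != 0 by near: h; exact: nbhs_dnbhs_neq.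
  rewrite /basis_vec 3!mxE eqxx /= addrK; exact: mulKf.
move=> j; exact: Ck_cst.
Unshelve. all: by end_near. Qed.

Lemma CkD k f g : Ck k f -> Ck k g -> Ck k (fun x => f x + g x).
Proof.
elim: k f g => [|k IH] f g Cf Cg;
  have cf : continuous f := Ck_continuous Cf;
    have cg : continuous g := Ck_continuous Cg.
  by split=> // x; exact: cvgD (cf x) (cg x).
apply: (@CkS _ _ (fun i x => 'D_(basis_vec i) f x + 'D_(basis_vec i) g x)).
- by move=> x; exact: cvgD (cf x) (cg x).
- by move=> i x; exact: is_deriveD (CkS_is_derive _ _ Cf) (CkS_is_derive _ _
  Cg).
- by move=> i; apply: IH; [exact: (Cf.2 i).2|exact: (Cg.2 i).2].
Qed.

Lemma CkM k f g : Ck k f -> Ck k g -> Ck k (fun x => f x * g x).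
Proof.
elim: k f g => [|k IH] f g Cf Cg;
  have cf : continuous f := Ck_continuous Cf;
    have cg : continuous g := Ck_continuous Cg.
  by split=> // x; exact: cvgM (cf x) (cg x).
apply: (@CkS _ _ (fun i x =>
  f x * 'D_(basis_vec i) g x + g x * 'D_(basis_vec i) f x)).
- by move=> x; exact: cvgM (cf x) (cg x).
- by move=> i x; exact: is_deriveM (CkS_is_derive _ _ Cf) (CkS_is_derive _ _
  Cg).
- by move=> i; apply: CkD; apply: IH; try exact: CkW;
  [exact: (Cg.2 i).2|exact: (Cf.2 i).2].
Qed.

(** The induction on [k] is uniform in [m], because differentiating [flat m] produces [flat m.+1]
    and [flat m.+2]. *)
Lemma Ck_flat k m f : Ck k f -> Ck k (fun x => flat m (f x)).
Proof.
elim: k m f => [|k IH] m f Cf.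
  split=> // x; apply: continuous_comp;
    [exact: (Ck_continuous Cf)|exact: continuous_flat].
apply: (@CkS _ _ (fun i x => (- m%:R * flat m.+1 (f x) + flat m.+2 (f x)) *
                             'D_(basis_vec i) f x)).
- move=> x; apply: continuous_comp;
  [exact: (Ck_continuous Cf)|exact: continuous_flat].
- move=> i x.
  exact: is_derive_comp (CkS_is_derive _ _ Cf) (is_derive_flat m (f x)).
- move=> i; apply: CkM; last exact: (Cf.2 i).2.
  have := CkW Cf => {}Cf.
  by apply: CkD; [apply: CkM; [exact: Ck_cst|exact: IH]|exact: IH].
Qed.

Lemma Ck_prod k I (r : seq I) (P : pred I) (F : I -> 'rV[R]_n -> R) :
  (forall i, P i -> Ck k (F i)) -> Ck k (fun x => \prod_(i <- r | P i) F i x).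
Proof.
move=> CF; elim: r => [|i r IH].
  by under eq_fun do rewrite big_nil; exact: Ck_cst.
case Pi: (P i); under eq_fun do rewrite big_cons Pi; last exact: IH.
by apply: CkM; first exact: CF.
Qed.

End Ck_closure.

Lemma rV_norm_coord (R : realType) n (x : 'rV[R]_n) i : `|x 0 i| <= `|x|.
Proof.
rewrite -[leRHS]/(mx_norm x) mx_normrE.
exact: (le_bigmax _ (fun i : 'I_1 * 'I_n => `|x i.1 i.2|) (ord0, i)).
Qed.

(** * Test functions and smooth bumps *)

Section test_functions.
Context {R : realType} {d : nat} {Omega : set 'rV[R]_d}.
Local Notation test := (@test_function R d Omega).
Implicit Types phi psi : 'rV[R]_d -> R.

Lemma smooth_continuous phi : smooth phi -> continuous phi.
Proof. by move=> /(_ 0%N)[]. Qed.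

Lemma smooth_derivable phi i x : smooth phi -> derivable phi x (basis_vec i).
Proof. by move=> /(_ 1%N)[_ /(_ i)[]]. Qed.

Lemma smooth_derive phi i : smooth phi -> smooth ('D_(basis_vec i) phi).
Proof. by move=> sphi k; have [_ /(_ i)[]] := sphi k.+1. Qed.

Lemma support_derive phi i :
  [set x | 'D_(basis_vec i) phi x != 0] `<=` closure [set x | phi x != 0].
Proof.
move=> x; apply: contraPP => /= xs; apply/negP; rewrite negbK; apply/eqP.
rewrite -(derive_cst (0 : R) x (basis_vec i)); apply: near_eq_derive.
have : open (~` closure [set x | phi x != 0]) by
  exact/closed_openC/closed_closure.
move=> oC; apply: filterS (open_nbhs_nbhs (conj oC xs)) => y /= yC.
apply/eqP; apply: contra_notT yC => y0; exact: subset_closure.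
Qed.

Lemma test_function_sub phi psi : smooth psi ->
  [set x | psi x != 0] `<=` closure [set x | phi x != 0] -> test phi ->
    test psi.
Proof.
move=> spsi sub [_ cphi phiO].
have {}sub : closure [set x | psi x != 0] `<=` closure [set x | phi x != 0].
  by move=> x /(closure_subset sub); rewrite -(closure_id _).1//;
    exact: closed_closure.
split=> //; last exact: subset_trans phiO.
apply: subclosed_compact sub => //; exact: closed_closure.
Qed.

Lemma test_derive phi i : test phi -> test ('D_(basis_vec i) phi).
Proof.
move=> tphi; apply: (test_function_sub _ (@support_derive phi i) tphi).
by apply: smooth_derive; case: tphi.
Qed.

Lemma test_function_mull phi psi : smooth psi -> test phi ->
  test (fun x => psi x * phi x).
Proof.
move=> spsi tphi; apply: (test_function_sub _ _ tphi).
  by move=> k; apply: CkM; [exact: spsi|by case: tphi].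
move=> x /=; rewrite mulf_eq0 negb_or => /andP[_ px]; exact: subset_closure.
Qed.

Lemma test_function_flat phi m : test phi -> test (fun x => flat m (phi x)).
Proof.
move=> tphi; apply: (test_function_sub _ _ tphi).
  by move=> k; apply: Ck_flat; case: tphi.
move=> x /= fx; apply: subset_closure => /=; apply: contraNN fx => /eqP ->.
by rewrite flat_le0.
Qed.

Lemma test_functionZ a phi : test phi -> test (fun x => a * phi x).
Proof. by apply: test_function_mull => k; exact: Ck_cst. Qed.

Lemma test_functionD phi psi : test phi -> test psi ->
  test (fun x => phi x + psi x).
Proof.
move=> [sphi cphi phiO] [spsi cpsi psiO].
have sub : closure [set x | phi x + psi x != 0] `<=`
    closure [set x | phi x != 0] `|` closure [set x | psi x != 0].
  rewrite -closureU; apply: closure_subset => x /= xs.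
  have [p0|] := eqVneq (phi x) 0; last by left.
  by right; apply: contraNN xs => /eqP q0; rewrite p0 q0 addr0.
split; first by move=> k; exact: CkD.
- apply: subclosed_compact sub; first exact: closed_closure.
  exact: compactU.
- by move=> x /sub[/phiO|/psiO].
Qed.

Lemma test_function0 : test (fun=> 0).
Proof.
have E : [set x : 'rV[R]_d | (0 : R) != 0] = set0.
  by apply/seteqP; split=> x //=; rewrite eqxx.
split; first by move=> k; exact: Ck_cst.
- by rewrite E closure0; exact: compact0.
- by rewrite E closure0.
Qed.

Lemma test_function_sum I (r : seq I) (F : I -> 'rV[R]_d -> R) :
  (forall i, test (F i)) -> test (fun x => \sum_(i <- r) F i x).
Proof.
move=> tF; elim: r => [|i r IH].
  by under eq_fun do rewrite big_nil; exact: test_function0.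
by under eq_fun do rewrite big_cons; exact: test_functionD.
Qed.

Lemma test_support_bounded phi : test phi ->
  exists K, forall x, phi x != 0 -> forall i, `|x 0 i| <= K.
Proof.
move=> [_ /compact_bounded[K [Kr KP]] _]; exists (K + 1) => x px i.
have : `|x| <= K + 1 by apply: KP; [rewrite ltrDl|exact: subset_closure].
exact/le_trans/rV_norm_coord.
Qed.

Lemma test_function_bounded phi : test phi -> exists M, forall x, `|phi x| <= M.
Proof.
move=> [sphi cphi _].
have : compact (phi @` closure [set x | phi x != 0]).
  apply: continuous_compact => //; apply: continuous_subspaceT.
  exact: smooth_continuous.
move=> /compact_bounded[M [Mr MP]]; exists (`|M| + 1) => x.
have [->|px] := eqVneq (phi x) 0; first by rewrite normr0 addr_ge0.
apply: (MP (`|M| + 1)).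
  by rewrite (le_lt_trans (ler_norm M))// ltrDl.
exists x => //; exact: subset_closure.
Qed.

(** Positive on the open cube of centre [c] and half-side [r], and zero off it. The opposite of a
    coordinate is written as a product by -1 so that [CkM] applies. *)
Definition smooth_bump (c : 'rV[R]_d) (r : R) (x : 'rV[R]_d) : R :=
  \prod_(i < d) (flat 0 (x 0 i + (r - c 0 i)) * flat 0 (-1 * x 0 i + (r + c 0
    i))).

Lemma smooth_bump_ge0 c r x : 0 <= smooth_bump c r x.
Proof. by apply: prodr_ge0 => i _; rewrite mulr_ge0// flat_ge0. Qed.

Lemma smooth_bump_gt0 (c : 'rV[R]_d) r (x : 'rV[R]_d) : (forall i,
  `|x 0 i - c 0 i| < r) -> 0 < smooth_bump c r x.
Proof.
move=> xc; apply: prodr_gt0 => i _; have := xc i;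
  rewrite ltr_norml => /andP[h1 h2].
by rewrite mulr_gt0// flat0_gt0//; lra.
Qed.

Lemma test_smooth_bump (c : 'rV[R]_d) r : [set x : 'rV[R]_d | forall i,
  `|x 0 i - c 0 i| <= r] `<=` Omega ->
  test (smooth_bump c r).
Proof.
move=> BO.
pose B := [set x : 'rV[R]_d | forall i, x 0 i \in `[c 0 i - r, c 0 i + r]].
have cB : compact B.
  apply: (@rV_compact _ _ (fun i => `[c 0 i - r, c 0 i + r]%classic)) => i.
  exact: segment_compact.
have sB : closure [set x | smooth_bump c r x != 0] `<=` B.
  rewrite [X in _ `<=` X](closure_id _).1; last first.
    by apply: compact_closed => //; exact: norm_hausdorff.
  apply: closure_subset => x /= /prodf_neq0 h i.
  have := h i isT; rewrite mulf_eq0 negb_or => /andP[h1 h2].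
  rewrite in_itv /=; apply/andP; split.
    by apply: contraNT h1; rewrite -ltNge => h1; rewrite flat_le0//; lra.
  by apply: contraNT h2; rewrite -ltNge => h2; rewrite flat_le0//; lra.
split.
- move=> k; apply: Ck_prod => i _; apply: CkM; apply: Ck_flat; apply: CkD.
  + exact: Ck_coord.
  + exact: Ck_cst.
  + by apply: CkM; [exact: Ck_cst|exact: Ck_coord].
  + exact: Ck_cst.
- by apply: subclosed_compact sB => //; exact: closed_closure.
- move=> x /sB xB; apply: BO => i.
  have := xB i; rewrite in_itv /= => /andP[h1 h2].
  by rewrite ler_norml; apply/andP; split; lra.
Qed.

End test_functions.

Lemma continuous_measurable_rV (R : realType) n (f : 'rV[R]_n -> R) :
  continuous f -> measurable_fun setT f.
Proof.
move=> cf; apply: (measurability _ (RGenOInfty.measurableE R)).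
move=> _ [_ [a ->] <-]; rewrite setTI; apply: open_measurable_rV.
by apply: open_comp => // x _; exact: cf.
Qed.

(** * Integration by parts and the fundamental lemma *)

Lemma basis_vecE (R : realType) n (i j : 'I_n) : basis_vec i 0 j = (j == i)%:R
  :> R.
Proof. by rewrite mxE eqxx. Qed.

Section cons_rV_slices.
Context (R : realType) (n : nat).
Implicit Types (s : R) (y : 'rV[R]_n).

Lemma cons_rV0 s y : cons_rV (s, y) 0 ord0 = s.
Proof. by rewrite /cons_rV mxE unlift_none. Qed.

Lemma cons_rV_lift s y j : cons_rV (s, y) 0 (lift ord0 j) = y 0 j.
Proof. by rewrite /cons_rV mxE liftK. Qed.

Lemma cons_rV_shift0 h s y :
  cons_rV (h + s, y) = h *: basis_vec ord0 + cons_rV (s, y).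
Proof.
apply/rowP => i; case: (unliftP ord0 i) => [j ->|->].
  by rewrite [RHS]mxE [X in _ = X + _]mxE basis_vecE !cons_rV_lift /= mulr0
    add0r.
by rewrite [RHS]mxE [X in _ = X + _]mxE basis_vecE !cons_rV0 eqxx mulr1.
Qed.

Lemma cons_rV_shift_lift h s y j :
  cons_rV (s, h *: basis_vec j + y) =
  h *: basis_vec (lift ord0 j) + cons_rV (s, y).
Proof.
apply/rowP => i; case: (unliftP ord0 i) => [k ->|->].
  rewrite [RHS]mxE [X in _ = X + _]mxE basis_vecE !cons_rV_lift (inj_eq
    lift_inj).
  by rewrite [LHS]mxE [X in X + _ = _]mxE basis_vecE.
by rewrite [RHS]mxE [X in _ = X + _]mxE basis_vecE !cons_rV0 /= mulr0 add0r.
Qed.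

Lemma continuous_cons_rVl y : continuous (fun s => cons_rV (s, y)).
Proof.
have -> : (fun s => cons_rV (s, y)) =
    (fun s => s *: basis_vec ord0 + cons_rV (0, y)).
  by apply/funext => s; rewrite -cons_rV_shift0 addr0.
by move=> s; apply: cvgD; [apply: cvgZl; exact: cvg_id|exact: cvg_cst].
Qed.

Lemma continuous_cons_rVr s : continuous (fun y => cons_rV (s, y)).
Proof.
move=> y A /nbhs_ballP[e e0 eA].
apply: (filterS _ (nbhsx_ballx (y : 'rV[R]_n) e e0)) => z [_ yz]; apply: eA.
split=> // i j; rewrite ord1; case: (unliftP ord0 j) => [k ->|->].
  by rewrite !cons_rV_lift; exact: yz.
by rewrite !cons_rV0; exact: ballxx.
Qed.

End cons_rV_slices.

(** * Integrals of derivatives of compactly supported functions *)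

Section compact_support_integral.
Context (R : realType).

Definition box n (M : R) := [set x : 'rV[R]_n | forall i, `|x 0 i| <= M].

Lemma box_compact n M : compact (@box n M).
Proof.
rewrite (_ : box M = [set x : 'rV[R]_n | forall i, `[- M, M]%classic (x 0 i)]).
  by apply: (@rV_compact _ _ (fun=> `[- M, M]%classic)) => i;
    exact: segment_compact.
by apply/seteqP; split=> x /= xM i; have := xM i; rewrite in_itv /= ler_norml.
Qed.

Lemma box_closed n M : closed (@box n M).
Proof. by apply: compact_closed;
  [exact: norm_hausdorff|exact: box_compact]. Qed.

Lemma measurable_box n M : measurable (@box n M).
Proof.
rewrite -[box M]setCK; apply: measurableC; apply: open_measurable_rV.
exact/closed_openC/box_closed.
Qed.

Lemma lebesgue_box n M : 0 <= M -> (lebesgue_rV R n (box M) < +oo)%E.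
Proof.
move=> M0; rewrite (_ : box M = [set x | forall i, x 0 i \in
    `[(const_mx (- M) : 'rV[R]_n) 0 i, (const_mx M : 'rV[R]_n) 0 i]]).
  rewrite lebesgue_rV_box ?ltry// => i; rewrite !mxE; lra.
by apply/seteqP; split=> x /= xM i; have := xM i;
  rewrite !mxE in_itv /= ler_norml.
Qed.

Lemma box_support_integrable n (f : 'rV[R]_n -> R) M : 0 <= M -> continuous f ->
  (forall x, f x != 0 -> box M x) ->
  (lebesgue_rV R n).-integrable setT (EFin \o f).
Proof.
move=> M0 cf fM.
have -> : EFin \o f = (EFin \o f) \_ (box M).
  apply/funext => x; rewrite /patch /=; case: ifPn => // /negP xM.
  congr EFin; apply/eqP; apply: contra_notT xM => /fM xM; exact/mem_set.
rewrite -integrable_mkcond; last exact: measurable_box.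
apply: measurable_bounded_integrable.
- exact: measurable_box.
- exact: lebesgue_box.
- by apply: measurable_funTS; exact: continuous_measurable_rV.
- have : compact (f @` box M).
    apply: continuous_compact; last exact: box_compact.
    exact: continuous_subspaceT.
  move=> /compact_bounded[N [Nr NP]]; exists N; split=> // K NK x xM.
  by apply: (NP K NK); exists x.
Qed.

Lemma derive_support n (psi dpsi : 'rV[R]_n -> R) v M :
  (forall x, is_derive x v psi (dpsi x)) ->
  (forall x, psi x != 0 -> box M x) -> forall x, dpsi x != 0 -> box M x.
Proof.
move=> dP pM x; apply: contraPP => xM.
have oC : open (~` @box n M) by exact/closed_openC/box_closed.
rewrite -(@derive_val _ _ _ _ _ _ _ (dP x)) -(derive_cst (0 : R) x v).
apply/negP; rewrite negbK; apply/eqP; apply: near_eq_derive.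
apply: filterS (open_nbhs_nbhs (conj oC xM)) => y /= yC.
by apply/eqP; apply: contra_notT yC; exact: pM.
Qed.

Lemma integral_derive_R (g dg : R -> R) M : 0 <= M -> continuous dg ->
  (forall x, is_derive x (1 : R) g (dg x)) -> (forall x, M < `|x| -> g x = 0) ->
  (\int[@lebesgue_measure R]_x (dg x)%:E = 0)%E.
Proof.
move=> M0 cdg dgP gM.
have dg0 x : M < `|x| -> dg x = 0.
  move=> xM; rewrite -(@derive_val _ _ _ _ _ _ _ (dgP x)) -(derive_cst (0 : R)
    x (1:R)).
  apply: near_eq_derive.
  have xM0 : 0 < `|x| - M by rewrite subr_gt0.
  apply: filterS (nbhsx_ballx x _ xM0) => y; rewrite -ball_normE /= => xy.
  apply: gM; have := lerB_dist x y; move: xy.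
  move: (`|x - y|) (`|x|) (`|y|) => a b c; lra.
have gc : continuous g.
  move=> x; apply: differentiable_continuous; apply/derivable1_diffP.
  exact: (@ex_derive _ _ _ _ _ _ _ (dgP x)).
(* The margin 1 puts both endpoints where [gM], which is strict in [M], gives the value 0. *)
have := @continuous_FTC2 R dg g (- (M + 1)) (M + 1).
rewrite (gM (M + 1)) ?(gM (- (M + 1))) ?normrN ?(ger0_norm (addr_ge0 M0 ler01))
  ?ltrDl//.
rewrite subee// => <-.
- rewrite [RHS]integral_mkcond; apply: eq_integral => x _.
  rewrite /patch; case: ifPn => // /negP xM; congr EFin; apply: dg0.
  rewrite ltNge; apply/negP => h; apply: xM; rewrite inE /= in_itv /=.
  move: h; rewrite ler_norml => /andP[]; lra.
- lra.
- exact: continuous_subspaceT.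
- split.
  + by move=> x _; exact: (@ex_derive _ _ _ _ _ _ _ (dgP x)).
  + exact: cvg_at_right_filter (gc _).
  + exact: cvg_at_left_filter (gc _).
- by move=> x _; rewrite derive1E; exact: (@derive_val _ _ _ _ _ _ _ (dgP x)).
Qed.

End compact_support_integral.
Section integral_derive.
Context (R : realType).

Lemma integral_cons_measure n (f : 'rV[R]_n.+1 -> \bar R) :
  (lebesgue_rV R n.+1).-integrable setT f ->
  (@lebesgue_measure R \x lebesgue_rV R n)%E.-integrable setT (f \o @cons_rV R
    n) /\
  (\int[lebesgue_rV R n.+1]_x f x =
   \int[(@lebesgue_measure R \x lebesgue_rV R n)%E]_p f (cons_rV p))%E.
Proof.
move=> /integrableP[mf foo].
have mc := @measurable_cons_rV R n.
have fi : (@lebesgue_measure R \x lebesgue_rV R n)%E.-integrable setT (f \o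
  @cons_rV R n).
  apply/integrableP; split; first exact: measurableT_comp.
  apply: le_lt_trans foo.
  have := @ge0_integral_pushforward _ _ _ _ R _ mc (@lebesgue_measure R \x
    lebesgue_rV R n)%E setT (abse \o f) measurableT.
  move=> <-//.
    exact: measurableT_comp.
  by move=> x _; exact: abse_ge0.
split=> //.
have := @integral_pushforward _ _ _ _ R _ mc (@lebesgue_measure R \x
  lebesgue_rV R n)%E setT f mf.
by move=> <-.
Qed.

(** Fubini, in the order that puts the differentiated variable in the inner integral: the inner
    integral vanishes by induction on the dimension, or by [integral_derive_R] when this variable is
    the first coordinate. *)
Lemma integral_derive_rV n (i : 'I_n) (psi dpsi : 'rV[R]_n -> R) (M : R) :
  0 <= M -> continuous psi -> continuous dpsi ->
  (forall x, is_derive x (basis_vec i) psi (dpsi x)) ->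
  (forall x, psi x != 0 -> box M x) ->
  (\int[lebesgue_rV R n]_x (dpsi x)%:E = 0)%E.
Proof.
elim: n i psi dpsi => [[]//|n IH] i psi dpsi M0 cpsi cdpsi dP pM.
have fi := box_support_integrable M0 cdpsi (derive_support dP pM).
have [pfi ->] := integral_cons_measure fi.
case: (unliftP ord0 i) => [j|] iE; subst i.
- rewrite -(integral12_prod_meas1 pfi) /=.
  apply: integral0_eq => s _;
    apply: (IH j (fun y => psi (cons_rV (s, y)))) => //.
  + by move=> y; apply: continuous_comp;
    [exact: continuous_cons_rVr|exact: cpsi].
  + by move=> y; apply: continuous_comp;
    [exact: continuous_cons_rVr|exact: cdpsi].
  + move=> y; apply/is_derive_line; have /is_derive_line := dP (cons_rV (s, y)).
    by under [X in is_derive _ _ X _ -> _]eq_fun do rewrite -cons_rV_shift_lift.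
  + by move=> y /pM yM k; rewrite -(cons_rV_lift s); exact: yM.
- rewrite -(integral21_prod_meas1 pfi) /=.
  apply: integral0_eq => y _.
  apply: (@integral_derive_R _ (fun s => psi (cons_rV (s, y))) _ M) => //.
  + by move=> s; apply: continuous_comp;
    [exact: continuous_cons_rVl|exact: cdpsi].
  + move=> s; apply/is_derive_line; have /is_derive_line := dP (cons_rV (s, y)).
    under [X in is_derive _ _ X _ -> _]eq_fun do rewrite -cons_rV_shift0.
    by under [X in _ -> is_derive _ _ X _]eq_fun do rewrite [_%:A]mulr1.
  + move=> s sM; apply/eqP; apply: contraTT isT => /pM/(_ ord0).
    by rewrite cons_rV0 leNgt sM.
Qed.

End integral_derive.

(** * The fundamental lemma of the calculus of variations *)

Section fundamental_lemma.
Context {R : realType} {n : nat}.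

(** Coordinates are continuous, so the sigma-algebra they generate is contained in the one generated
    by the open sets. This makes open sets a generating pi-system for [ae_eq0_open]. *)
Lemma measurable_rV_open : (measurable : set (set 'rV[R]_n)) `<=` <<s @open
  'rV[R]_n >>.
Proof.
move=> A mA.
pose T := g_sigma_algebraType (@open 'rV[R]_n).
have mid : measurable_fun setT (id : T -> 'rV[R]_n).
  apply: measurable_fun_rV => i.
  apply: (measurability _ (RGenOInfty.measurableE R)).
  move=> _ [_ [a ->] <-]; rewrite setTI; apply: sub_sigma_algebra.
  by apply: open_comp => // x _; exact: coord_continuous.
by have := mid measurableT A mA; rewrite setTI.
Qed.

(** The measurable sets over which [g] integrates to 0 form a Dynkin system, and it contains the
    open sets, which are stable under intersection; hence it contains every measurable set. *)
Lemma ae_eq0_open (mu : {measure set 'rV[R]_n -> \bar R}) (g : 'rV[R]_n ->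
  \bar R) :
  mu.-integrable setT g ->
  (forall U, open U -> (\int[mu]_(x in U) g x = 0)%E) -> g = cst 0%E %[ae mu].
Proof.
move=> ig gU.
pose H : set (set 'rV[R]_n) :=
  [set A | measurable A /\ (\int[mu]_(x in A) g x = 0)%E].
have igA A : measurable A -> mu.-integrable A g.
  by move=> mA; apply: integrableS ig.
have dH : dynkin H.
  split.
  - by split=> //; apply: gU; exact: openT.
  - move=> A [mA gA]; split; first exact: measurableC.
    have := gU setT openT; rewrite -(setUv A) integral_setU//.
    + by rewrite gA add0e.
    + exact: measurableC.
    + by apply: measurable_funTS; exact: measurable_int ig.
    + exact/disj_setPCl.
  - move=> F tF HF; split; first by apply: bigcup_measurable => k _;
    case: (HF k).
    rewrite integral_bigcup//.
    + by rewrite eseries0// => k _ _; case: (HF k).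
    + by move=> k; case: (HF k).
    + by apply: igA; apply: bigcup_measurable => k _; case: (HF k).
have mH A : measurable A -> H A.
  move=> /measurable_rV_open.
  apply: (@lambda_system_subset _ _ _ setT).
  - by move=> B C; exact: openI.
  - exact/dynkin_lambda_system.
  - by move=> U oU; split; [exact: open_measurable_rV|exact: gU].
  - by [].
apply: integral_ae_eq => // E _ /mH[_ ->]; by rewrite integral0.
Qed.

(** Cubes with rational centre and half-side 1/(k+1) are countably many, and those contained in [U]
    cover it. Finite sums of their bumps are test functions; multiplying by k and applying [flat 0]
    keeps the values in [0, 1] and pushes them to 1 on [U]. *)
Lemma indicator_test_approx (U : set 'rV[R]_n) : open U ->
  exists chi : nat -> 'rV[R]_n -> R,
  [/\ forall k, @test_function R n U (chi k),
      forall k x, 0 <= chi k x <= 1 &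
      forall x, chi k x @[k --> \oo] --> (\1_U x : R)].
Proof.
move=> oU.
pose c (p : 'rV[rat]_n * nat) : 'rV[R]_n := map_mx ratr p.1.
pose r (p : 'rV[rat]_n * nat) : R := p.2.+1%:R^-1.
pose B p := [set x : 'rV[R]_n | forall i, `|x 0 i - c p 0 i| <= r p].
pose psi k : 'rV[R]_n -> R :=
  if unpickle k is Some p then
    if `[< B p `<=` U >] then smooth_bump (c p) (r p) else fun=> 0
  else fun=> 0.
have tpsi k : @test_function R n U (psi k).
  rewrite /psi; case: unpickle => [p|]; last exact: test_function0.
  by case: asboolP => [BU|_]; [exact: test_smooth_bump|exact: test_function0].
have psi0 k x : 0 <= psi k x.
  rewrite /psi; case: unpickle => [p|]//.
  by case: asboolP => // _; exact: smooth_bump_ge0.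
have psiU x : U x -> exists k, 0 < psi k x.
  move=> Ux.
  have /nbhs_ballP[e /= e0 eU] : nbhs x U by exact: open_nbhs_nbhs.
  (* A cube of half-side 1/(k+1) with centre that close to [x] lies within 2/(k+1) of [x], hence in
     [U]. *)
  have [k ke] : exists k : nat, k.+1%:R^-1 *+ 2 < e.
    have e20 : 0 < e / 2 by rewrite divr_gt0.
    have [k _ /(_ k)/(_ (leqnn _)) /= ke] := near_infty_natSinv_lt (PosNum e20).
    by exists k; rewrite -(mulr_natr _^-1) -ltr_pdivlMr.
  have k0 : (0 : R) < k.+1%:R^-1 by rewrite invr_gt0.
  have /choice[q qP] : forall i : 'I_n, exists q : rat,
      (ball (x 0 i) k.+1%:R^-1 : set R) (ratr q).
    move=> i; have : ball (x 0 i) k.+1%:R^-1 `&` range (@ratr R) !=set0.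
      by apply: dense_rat; [exists (x 0 i); apply: ballxx|exact: ball_open].
    by case=> y [xy [q _ qy]]; exists q; rewrite qy.
  pose p : 'rV[rat]_n * nat := (\row_i q i, k).
  have cx i : `|x 0 i - c p 0 i| < r p.
    by have := qP i; rewrite -ball_normE /= /c /= !mxE.
  exists (pickle p); rewrite /psi pickleK; case: asboolP => [_|[]].
    exact: smooth_bump_gt0.
  move=> y By; apply: eU; split=> // i j; rewrite ord1 -ball_normE /=.
  apply: le_lt_trans ke; rewrite (le_trans (ler_distD (c p 0 j) _ _))// mulr2n.
  by rewrite lerD// ?(ltW (cx _))// distrC; exact: By.
pose s k x := \sum_(j < k) psi j x.
have s0 k x : 0 <= s k x by apply: sumr_ge0.
(* Where some bump is positive the argument of flat 0 tends to +oo, hence the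
   value to 1. *)
exists (fun k x => flat 0 (k%:R * s k x)); split.
- move=> k; apply: (@test_function_flat _ _ _ (fun x => k%:R * s k x)).
  by apply: test_functionZ; apply: test_function_sum => i; exact: tpsi.
- by move=> k x; rewrite flat_ge0 flat0_le1.
- move=> x; rewrite indicE; case: (boolP (x \in U)) => [/set_mem Ux|/negP xU].
    have [m pm] := psiU x Ux.
    rewrite -[true%:R]/(1 : R); apply/cvgrPdist_le => e e0; near=> k.
    have k0 : (0 : R) < k%:R by rewrite ltr0n; near: k; exact: nbhs_infty_gt.
    have mk : (m < k)%N by near: k; exact: nbhs_infty_gt.
    have ks : k%:R * psi m x <= k%:R * s k x.
      rewrite ler_pM2l// /s (bigD1 (Ordinal mk))//= lerDl.
      by apply: sumr_ge0.
    have kp : 0 < k%:R * psi m x by rewrite mulr_gt0.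
    rewrite ger0_norm ?subr_ge0 ?flat0_le1//.
    rewrite /flat (lt_le_trans kp ks) mul1r.
    apply: (@le_trans _ _ ((k%:R * s k x)^-1)).
      by have := expR_ge1Dx (- (k%:R * s k x)^-1); lra.
    apply: (@le_trans _ _ ((k%:R * psi m x)^-1)).
      by rewrite lef_pV2 ?posrE// (lt_le_trans kp ks).
    rewrite invf_ple ?posrE//.
    rewrite -ler_pdivrMr//; near: k; exact: nbhs_infty_ger.
  rewrite -[false%:R]/(0 : R) (_ : (fun _ => _) = cst 0); first exact: cvg_cst.
  apply/funext => k; rewrite flat_le0// /s big1 ?mulr0// => i _.
  apply/eqP; apply: contra_notT xU => px; apply/mem_set.
  by have [_ _] := tpsi i; apply; exact: subset_closure.
Unshelve. all: by end_near. Qed.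

End fundamental_lemma.

(** * Test functions in L^2 and their weak derivatives *)

Section L2on_test.
Context {R : realType} {d : nat} {Omega : set 'rV[R]_d}.
Variable Omega_open : open Omega.
Hypothesis Omega_bounded : bounded_set Omega.
Local Notation mu := (lebesgue_on Omega_open).
Local Notation L2O := (L2on Omega_open).
Local Notation test := (@test_function R d Omega).
Implicit Types (f g u v w : L2O) (phi psi : 'rV[R]_d -> R).

Lemma bounded_subset_box : exists2 M, 0 <= M & Omega `<=` box M.
Proof.
have [M [Mr MP]] := Omega_bounded; exists (`|M| + 1); first by rewrite addr_ge0.
move=> x Ox i; apply: le_trans (rV_norm_coord _ _) _.
by apply: (MP (`|M| + 1)) => //; rewrite (le_lt_trans (ler_norm M))// ltrDl.
Qed.

Lemma lebesgue_on_finite : (mu setT < +oo)%E.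
Proof.
have [M M0 MP] := bounded_subset_box.
rewrite /lebesgue_on /= /mrestr setTI.
apply: le_lt_trans (lebesgue_box d M0).
apply: le_measure; rewrite ?inE//; first exact: open_measurable_rV.
exact: measurable_box.
Qed.

Lemma lebesgue_on_ae : \forall x \ae mu, Omega x.
Proof.
exists (~` Omega); split => //=.
  by apply: measurableC; exact: open_measurable_rV.
by rewrite /mrestr setICl measure0.
Qed.

Lemma integral_lebesgue_on (f : 'rV[R]_d -> \bar R) :
  (forall x, f x != 0%E -> Omega x) ->
  (\int[mu]_x f x = \int[lebesgue_rV R d]_x f x)%E.
Proof.
move=> fO.
have fE : f = f \_ Omega.
  apply/funext => x; rewrite /patch; case: ifPn => // /negP xO.
  by apply/eqP; apply: contra_notT xO => /fO xO; apply/mem_set.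
rewrite fE -!integral_mkcond; apply: eq_measure_integral => A mA AO.
by rewrite /lebesgue_on /= /mrestr setIidl.
Qed.

Lemma test_measurable phi : test phi -> measurable_fun setT phi.
Proof. by case=> /smooth_continuous cphi _ _;
  exact: continuous_measurable_rV. Qed.

Lemma test_Lfun phi : test phi -> phi \in Lfun mu 2%:E.
Proof.
move=> tphi; have [M MP] := test_function_bounded tphi.
apply: Lfun2P; first exact: test_measurable.
have : mu.-integrable setT (EFin \o (fun x => phi x ^+ 2)).
  apply: measurable_bounded_integrable => //.
  - exact: lebesgue_on_finite.
  - by apply: measurable_funX; exact: test_measurable.
  - exists (M ^+ 2); split; first exact: num_real.
    move=> K MK x _; apply: ltW; apply: le_lt_trans MK.
    by rewrite normrX ler_pXn2r ?nnegrE//; exact: le_trans (MP x).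
move=> /integrableP[_]; apply: le_lt_trans.
rewrite le_eqVlt; apply/orP; left; apply/eqP; apply: eq_integral => x _.
by rewrite /= ger0_norm// sqr_ge0.
Qed.

Definition test_L2 phi (tphi : test phi) : L2O := L2_class (test_Lfun tphi).

Lemma test_L2E phi (tphi : test phi) :
  ((test_L2 tphi : L2 mu) : 'rV[R]_d -> R) = phi %[ae mu].
Proof. exact: L2_classE. Qed.

Lemma test_class_test_L2 phi (tphi : test phi) : test_class (test_L2 tphi).
Proof. by exists phi => //; exact: test_L2E. Qed.

Lemma test_classP f : test_class f ->
  exists phi (tphi : test phi), f = test_L2 tphi.
Proof.
move=> [phi tphi fphi]; exists phi, tphi; apply: L2_eq_ae.
apply: filterS2 fphi (test_L2E tphi) => x /(_ I) + /(_ I) + _.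
by move=> -> ->.
Qed.

Lemma L2_inner_test f phi (tphi : test phi) :
  L2_inner f (test_L2 tphi) = \int[mu]_x ((f : L2 _) x * phi x).
Proof.
apply: L2_inner_ae; [exact: L2_measurable|exact: test_measurable|exact:
  ae_eq_refl|].
exact: test_L2E.
Qed.

Lemma L2_inner_test_test phi psi (tphi : test phi) (tpsi : test psi) :
  L2_inner (test_L2 tphi) (test_L2 tpsi) = \int[mu]_x (phi x * psi x).
Proof.
by apply: L2_inner_ae; [exact: test_measurable..|exact: test_L2E|exact:
  test_L2E].
Qed.

(** Rewriting the integrals as inner products with classes reduces linearity and closedness of weak
    derivatives to linearity and continuity of the inner product. *)
Lemma is_weak_derivativeP i u g : is_weak_derivative i u g <->
  forall phi (tphi : test phi),
    L2_inner u (test_L2 (test_derive i tphi)) = - L2_inner g (test_L2 tphi).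
Proof.
split=> ug phi tphi; first by rewrite !L2_inner_test; exact: ug.
by have := ug phi tphi; rewrite !L2_inner_test.
Qed.

Lemma integral_test_derive phi i (tphi : test phi) :
  \int[mu]_x 'D_(basis_vec i) phi x = 0.
Proof.
have [M MP] := test_support_bounded tphi.
have [_ _ dO] := test_derive i tphi.
rewrite /Rintegral integral_lebesgue_on; last first.
  by move=> x; rewrite eqe => dx; apply: dO; exact: subset_closure.
have [sphi _ _] := tphi.
have dP x : is_derive x (basis_vec i) phi ('D_(basis_vec i) phi x).
  exact/derivableP/smooth_derivable.
have -> // := @integral_derive_rV R d i phi _ `|M| (normr_ge0 M) _ _ dP.
- exact: smooth_continuous.
- exact/smooth_continuous/smooth_derive.
- by move=> x /MP xM j; apply: le_trans (xM j) (ler_norm M).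
Qed.

(** Integration by parts: the derivative of the product [psi * phi] integrates to 0. *)
Lemma weak_derivative_test phi i (tphi : test phi) :
  is_weak_derivative i (test_L2 tphi) (test_L2 (test_derive i tphi)).
Proof.
apply/is_weak_derivativeP => psi tpsi.
apply/eqP; rewrite -subr_eq0 opprK (L2_innerC _ (test_L2 tpsi))
  !L2_inner_test_test.
have [[sphi _ _] [spsi _ _]] := (tphi, tpsi).
have tD := test_function_mull spsi tphi.
have dM x : 'D_(basis_vec i) (fun x => psi x * phi x) x =
    phi x * 'D_(basis_vec i) psi x + psi x * 'D_(basis_vec i) phi x.
  have := is_deriveM (derivableP (@smooth_derivable _ _ psi i x spsi))
    (derivableP (@smooth_derivable _ _ phi i x sphi)).
  by move=> /(@derive_val _ _ _ _ _ _ _) ->; rewrite addrC.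
rewrite -(integral_test_derive i tD) -RintegralD//.
- by apply/eqP; apply: eq_Rintegral => x _; rewrite dM.
- apply/Lfun1_integrable/Lfun2_mul_Lfun1; apply: test_Lfun => //.
  exact: test_derive.
- apply/Lfun1_integrable/Lfun2_mul_Lfun1; apply: test_Lfun => //.
  exact: test_derive.
Qed.

(** Approximating indicators of open sets by test functions, under the dominating function |g|,
    shows that [g] integrates to 0 over every open set. *)
Lemma L2_inner_test_eq0 g :
  (forall phi (tphi : test phi), L2_inner g (test_L2 tphi) = 0) -> g = 0.
Proof.
move=> gt0; apply: L2_eq_ae.
have mg := @L2_measurable _ _ _ mu g.
have ig : mu.-integrable setT (fun x => ((g : L2 mu) x)%:E).
  (* [Omega] has finite measure, so constants are in L^2 and [g] is integrable. *)
  have i1 : (cst 1 : 'rV[R]_d -> R) \in Lfun mu 2%:E.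
    apply: Lfun2P => //; rewrite (eq_integral (cst 1%E)); last first.
      by move=> x _; rewrite /= expr1n.
    by rewrite integral_cst// mul1e; exact: lebesgue_on_finite.
  have := Lfun2_mul_Lfun1 (L2_Lfun g) i1 => /Lfun1_integrable.
  by apply: eq_integrable => // x _; rewrite /= mulr1.
have g0 : (fun x => ((g : L2 mu) x)%:E) = cst 0%E %[ae mu].
  apply: ae_eq0_open => // U oU.
  (* The approximants must be supported in [Omega]; since the measure charges [Omega] only,
     intersecting with it changes no integral. *)
  have oUO : open (U `&` Omega) by exact: openI.
  have [chi [tchi chi1 chiU]] := indicator_test_approx oUO.
  have tchiO k : test (chi k).
    by have [s c sub] := tchi k; split=> // x /sub[].
  have [|||||_ _] := @dominated_convergence _ _ _ mu setT measurableT
    (fun k x => ((g : L2 mu) x * chi k x)%:E)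
    (fun x => ((g : L2 mu) x * \1_U x)%:E) (fun x => `|((g : L2 mu) x)%:E|)%E.
  - move=> k; apply/measurable_EFinP/measurable_funM => //.
    exact: test_measurable (tchiO k).
  - apply/measurable_EFinP/measurable_funM => //; apply: measurable_indic.
    exact: open_measurable_rV.
  - apply: filterS lebesgue_on_ae => x Ox _; apply: cvg_EFin;
    first exact: nearW.
    apply: cvgM; first exact: cvg_cst.
    have := chiU x; rewrite !indicE in_setI (mem_set Ox) andbT; exact.
  - exact: integrable_abse.
  - apply: aeW => x k _; rewrite lee_fin normrM ler_piMr//.
    by have /andP[? ?] := chi1 k x; rewrite ger0_norm.
  move=> lim.
  have {lim} : (\int[mu]_x ((g : L2 mu) x * \1_U x)%:E = 0)%E.
    apply: (cvg_unique _ lim) => //; apply: cvg_near_cst; apply: nearW => k.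
    have := gt0 _ (tchiO k); rewrite L2_inner_test /Rintegral => E.
    rewrite /= -[LHS]fineK ?E//; apply: (integrable_fin_num measurableT).
    apply/Lfun1_integrable/Lfun2_mul_Lfun1; first exact: L2_Lfun.
    exact: test_Lfun (tchiO k).
  move=> <-; rewrite [LHS]integral_mkcond; apply: eq_integral => x _.
  rewrite /patch indicE; case: ifP => _; first by rewrite mulr1.
  by rewrite mulr0.
apply: filterS2 g0 (L2_zeroE mu) => x /(_ I) + /(_ I) + _.
move=> /= [->] E; by rewrite E.
Qed.

End L2on_test.

(** * Weak derivatives and H^1_0 *)

Lemma L2_inner_cvgl d (T : measurableType d) (R : realType)
    (mu : {measure set T -> \bar R}) (u : nat -> L2 mu) (v h : L2 mu) :
  u n @[n --> \oo] --> v -> L2_inner (u n) h @[n --> \oo] --> L2_inner v h.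
Proof.
move=> uv; apply/cvgrPdist_le => e e0.
have h0 : 0 < `|h| + 1 by rewrite ltr_wpDl.
move/cvgrPdist_le : uv => /(_ (e / (`|h| + 1)) (divr_gt0 e0 h0)).
apply: filterS => n un; rewrite -L2_innerBl.
apply: le_trans (L2_cauchy_schwarz _ _) _.
move: un; rewrite ler_pdivlMr//; apply: le_trans.
by rewrite ler_wpM2l// lerDl.
Qed.

Section weak_derivatives.
Context {R : realType} {d : nat} {Omega : set 'rV[R]_d}.
Variable Omega_open : open Omega.
Hypothesis Omega_bounded : bounded_set Omega.
Local Notation mu := (lebesgue_on Omega_open).
Local Notation L2O := (L2on Omega_open).
Local Notation test := (@test_function R d Omega).
Local Notation test_L2 := (test_L2 Omega_open Omega_bounded).
Implicit Types (f g h u v w : L2O) (phi psi : 'rV[R]_d -> R) (i : 'I_d).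

Lemma L2on_complete (f : nat -> L2O) :
  (forall e, 0 < e -> exists N, forall m n, (N <= m)%N -> (N <= n)%N ->
    `|f m - f n| <= e) ->
  exists g : L2O, f n @[n --> \oo] --> g.
Proof. exact: L2_complete. Qed.

Lemma weak_derivative_uniq i u g h : is_weak_derivative i u g ->
  is_weak_derivative i u h -> g = h.
Proof.
move=> /(is_weak_derivativeP Omega_bounded) ug.
move=> /(is_weak_derivativeP Omega_bounded) uh.
apply/eqP; rewrite -subr_eq0; apply/eqP.
apply: (@L2_inner_test_eq0 _ _ _ _ Omega_bounded (g - h)) => phi tphi.
rewrite L2_innerBl; apply: oppr_inj; rewrite oppr0 opprB addrC.
by rewrite -ug -[X in _ + X]opprK -uh subrr.
Qed.

Lemma weak_derivativeE i u g : is_weak_derivative i u g ->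
  weak_derivative i u = g.
Proof.
move=> ug; apply: (@weak_derivative_uniq i u) => //.
by apply: (@xgetPex _ 0 [set g | is_weak_derivative i u g]); exists g.
Qed.

Lemma weak_derivativeP i u : H1 u ->
  is_weak_derivative i u (weak_derivative i u).
Proof. by move=> /(_ i)[g ug]; rewrite (weak_derivativeE ug). Qed.

Lemma is_weak_derivative_lin i a u v g h : is_weak_derivative i u g ->
  is_weak_derivative i v h -> is_weak_derivative i (a *: u + v) (a *: g + h).
Proof.
move=> /(is_weak_derivativeP Omega_bounded) ug.
move=> /(is_weak_derivativeP Omega_bounded) vh.
apply/(is_weak_derivativeP Omega_bounded) => phi tphi.
by rewrite !L2_innerDl !L2_innerZl ug vh mulrN -opprD.
Qed.

(** Each test function defines a continuous functional, so the defining identity passes to the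
    limit: the weak derivative is a closed operator. *)
Lemma is_weak_derivative_cvg i (u g : nat -> L2O) v h :
  (forall n, is_weak_derivative i (u n) (g n)) ->
  u n @[n --> \oo] --> v -> g n @[n --> \oo] --> h -> is_weak_derivative i v h.
Proof.
move=> ug uv gh; apply/(is_weak_derivativeP Omega_bounded) => phi tphi.
have l1 := L2_inner_cvgl (h := test_L2 (test_derive i tphi)) uv.
have l2 := cvgN (L2_inner_cvgl (h := test_L2 tphi) gh).
apply: (cvg_unique _ l1) => //.
rewrite (_ : (fun n => _) = (fun n => - L2_inner (g n) (test_L2 tphi))).
  exact: l2.
by apply/funext => n; have /(is_weak_derivativeP Omega_bounded) -> := ug n.
Qed.

Lemma H1_lin a u v : H1 u -> H1 v -> H1 (a *: u + v).
Proof.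
move=> Hu Hv i; exists (a *: weak_derivative i u + weak_derivative i v).
by apply: is_weak_derivative_lin; exact: weak_derivativeP.
Qed.

(** Additivity can fail outside [H1], where a missing derivative is the default value 0. This is why
    the later forms are linear on a subset only. *)
Lemma weak_derivative_lin i a u v : H1 u -> H1 v ->
  weak_derivative i (a *: u + v) = a *: weak_derivative i u + weak_derivative i
    v.
Proof.
by move=> Hu Hv; apply/weak_derivativeE/is_weak_derivative_lin;
  exact: weak_derivativeP.
Qed.

Lemma H1_0 : H1 (0 : L2O).
Proof.
move=> i; exists 0; apply/(is_weak_derivativeP Omega_bounded) => phi tphi.
by rewrite !L2_inner0l oppr0.
Qed.

Lemma weak_derivative0 i : weak_derivative i (0 : L2O) = 0.
Proof.
have := @weak_derivative_lin i (-1) _ _ H1_0 H1_0.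
by rewrite scaler0 addr0 scaleN1r addNr.
Qed.

Lemma H1B u v : H1 u -> H1 v -> H1 (u - v).
Proof. by move=> Hu Hv; have := H1_lin (-1) Hv Hu; rewrite scaleN1r addrC. Qed.

Lemma weak_derivativeB i u v : H1 u -> H1 v ->
  weak_derivative i (u - v) = weak_derivative i u - weak_derivative i v.
Proof.
move=> Hu Hv; rewrite addrC -[- v]scaleN1r weak_derivative_lin//.
by rewrite scaleN1r addrC.
Qed.

Lemma H2_lin a u v : H2 u -> H2 v -> H2 (a *: u + v).
Proof.
move=> [Hu H1u] [Hv H1v]; split=> [|i]; first exact: H1_lin.
by rewrite weak_derivative_lin//; exact: H1_lin.
Qed.

Lemma laplacian_lin a u v : H2 u -> H2 v ->
  laplacian (a *: u + v) = a *: laplacian u + laplacian v.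
Proof.
move=> [Hu H1u] [Hv H1v]; rewrite /laplacian scaler_sumr -big_split/=.
by apply: eq_bigr => i _; rewrite !weak_derivative_lin.
Qed.

Lemma weak_derivative_test_L2 phi i (tphi : test phi) :
  weak_derivative i (test_L2 tphi) = test_L2 (test_derive i tphi).
Proof. exact/weak_derivativeE/weak_derivative_test. Qed.

Lemma test_H1 f : test_class f -> H1 f.
Proof.
move=> /(test_classP Omega_bounded)[phi [tphi ->]] i.
by exists (test_L2 (test_derive i tphi)); exact: weak_derivative_test.
Qed.

Lemma test_weak_derivative i f : test_class f ->
  test_class (weak_derivative i f).
Proof.
move=> /(test_classP Omega_bounded)[phi [tphi ->]].
by rewrite weak_derivative_test_L2; exact: test_class_test_L2.
Qed.

Lemma test_H2 f : test_class f -> H2 f.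
Proof.
by move=> tf; split=> [|i]; [exact: test_H1|apply/test_H1/test_weak_derivative].
Qed.

Lemma test_class_lin a f g : test_class f -> test_class g ->
  test_class (a *: f + g).
Proof.
move=> [phi tphi fphi] [psi tpsi gpsi].
exists (fun x => a * phi x + psi x).
  by apply: test_functionD => //; exact: test_functionZ.
apply: filterS2 (L2D_ae (a *: f : L2 mu) (g : L2 mu)) (filterI (L2Z_ae a (f :
  L2 mu)) (filterI fphi gpsi)).
move=> x /(_ I) /= -> [/(_ I) + [/(_ I) + /(_ I) +]] _ => -> /=.
by move=> -> ->.
Qed.

Lemma test_class0 : test_class (0 : L2O).
Proof. by exists (fun=> 0); [exact: test_function0|exact: L2_zeroE]. Qed.

(** Limits and linear combinations control [u] and each derivative separately; this form trades the
    Euclidean norm of all the components for one bound per component. *)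
Lemma H10P u : H10 u <-> H1 u /\ forall e, 0 < e -> exists2 f, test_class f &
  `|u - f| <= e /\ forall i, `|weak_derivative i (u - f)| <= e.
Proof.
split=> -[Hu ue]; split=> // e e0.
  have [f tf fe] := ue e e0; exists f => //.
  have S0 : 0 <= \sum_(i < d) `|weak_derivative i (u - f)| ^+ 2.
    by apply: sumr_ge0 => i _; rewrite sqr_ge0.
  have sq (x S : R) : 0 <= x -> x ^+ 2 <= S -> x <= Num.sqrt S.
    move=> x0 xS; rewrite -[leLHS]ger0_norm// -sqrtr_sqr ler_sqrt//.
    by apply: le_trans xS; exact: sqr_ge0.
  split=> [|i]; apply: le_trans (ltW fe); apply: sq => //.
    by rewrite lerDl.
  rewrite (bigD1 i)//= addrCA lerDl addr_ge0 ?sqr_ge0//.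
  by apply: sumr_ge0 => j _; rewrite sqr_ge0.
(* The d + 1 squares add up to (d + 1) c^2 < (d + 2)^2 c^2 = e^2, strictly for every d. *)
have c0 : 0 < e / (d.+2%:R) by rewrite divr_gt0.
have [f tf [f0 f1]] := ue _ c0; exists f => //.
rewrite -[ltRHS]gtr0_norm// -sqrtr_sqr ltr_sqrt ?exprn_gt0//.
have -> : e ^+ 2 = d.+2%:R ^+ 2 * (e / d.+2%:R) ^+ 2.
  by rewrite -exprMn mulrC divfK ?pnatr_eq0.
set c := e / _ in c0 f0 f1 *.
have sq (x : R) : 0 <= x -> x <= c -> x ^+ 2 <= c ^+ 2.
  by move=> x0 xc; rewrite ler_pXn2r ?nnegrE// ltW.
apply: (@le_lt_trans _ _ (c ^+ 2 + \sum_(i < d) c ^+ 2)).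
  by apply: lerD; [exact: sq|apply: ler_sum => i _; exact: sq].
rewrite sumr_const card_ord -mulrS -[ltLHS]mulr_natl ltr_pM2r ?exprn_gt0//.
by rewrite -natrX ltr_nat expnS expn1 mulSn ltn_addr.
Qed.

Lemma test_H10 f : test_class f -> H10 f.
Proof.
move=> tf; apply/H10P; split=> [|e e0]; first exact: test_H1.
exists f => //; rewrite subrr normr0; split=> [|i]; first exact: ltW.
by rewrite weak_derivative0 normr0 ltW.
Qed.

Lemma H10_H1 u : H10 u -> H1 u. Proof. by case. Qed.

Lemma H10_lin a u v : H10 u -> H10 v -> H10 (a *: u + v).
Proof.
move=> /H10P[Hu ue] /H10P[Hv ve]; apply/H10P; split=> [|e e0];
  first exact: H1_lin.
have c0 : 0 < e / (`|a| + 1) by rewrite divr_gt0// ltr_wpDl.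
have [f tf [f0 f1]] := ue _ c0.
have [g tg [g0 g1]] := ve _ c0.
exists (a *: f + g); first exact: test_class_lin.
have E : a *: u + v - (a *: f + g) = a *: (u - f) + (v - g).
  by rewrite scalerBr opprD addrACA.
have tri x y : `|x| <= e / (`|a| + 1) -> `|y| <= e / (`|a| + 1) ->
  `|a *: x + y : L2O| <= e.
  move=> xe ye; apply: le_trans (ler_normD _ _) _; rewrite normrZ.
  apply: le_trans (lerD (ler_wpM2l (normr_ge0 a) xe) ye) _.
  rewrite -[X in _ + X]mul1r -mulrDl mulrC divfK// gt_eqF// ltr_wpDl//.
have [H1f H1g] := (test_H1 tf, test_H1 tg).
rewrite E; split=> [|i]; first exact: tri.
by rewrite weak_derivative_lin; [exact: tri|exact: H1B..].
Qed.

Lemma H10_0 : H10 (0 : L2O). Proof. exact/test_H10/test_class0. Qed.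

Lemma H10B u v : H10 u -> H10 v -> H10 (u - v).
Proof. by move=> Hu Hv; have := H10_lin (-1) Hv Hu; rewrite scaleN1r addrC. Qed.

End weak_derivatives.

Lemma cvg_sumr (R : realType) (I : finType) (u : I -> nat -> R) (l : I -> R) :
  (forall i, u i n @[n --> \oo] --> l i) ->
  \sum_i u i n @[n --> \oo] --> \sum_i l i.
Proof.
move=> ul; elim: (index_enum I) => [|i r IH].
  under eq_fun do rewrite big_nil.
  by rewrite big_nil; exact: cvg_cst.
under eq_fun do rewrite big_cons.
by rewrite big_cons; apply: cvgD.
Qed.

Section Sobolev_H10.
Context {R : realType} {d : nat} {Omega : set 'rV[R]_d}.
Variable Omega_open : open Omega.
Hypothesis Omega_bounded : bounded_set Omega.
Local Notation mu := (lebesgue_on Omega_open).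
Local Notation L2O := (L2on Omega_open).
Local Notation test := (@test_function R d Omega).
Local Notation test_L2 := (test_L2 Omega_open Omega_bounded).
Implicit Types (f g h u v w : L2O) (phi psi : 'rV[R]_d -> R) (i : 'I_d).

Lemma cvg_natSinv (u : nat -> L2O) v :
  (forall n, `|v - u n| <= n.+1%:R^-1) -> u n @[n --> \oo] --> v.
Proof.
move=> uv; apply/cvgrPdist_le => e e0.
near=> n; apply: le_trans (uv n) _; apply: ltW; near: n.
exact: (near_infty_natSinv_lt (PosNum e0)).
Unshelve. all: by end_near. Qed.

Lemma H10_approx u : H10 u -> exists f : nat -> L2O,
  [/\ forall n, test_class (f n), f n @[n --> \oo] --> u &
      forall i, weak_derivative i (f n) @[n --> \oo] --> weak_derivative i u].
Proof.
move=> /(H10P _)[Hu ue].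
have /choice[f fP] n : exists f, test_class f /\ (`|u - f| <= n.+1%:R^-1 /\
    forall i, `|weak_derivative i (u - f)| <= n.+1%:R^-1).
  by have [//|f tf [f0 f1]] := ue n.+1%:R^-1 _; exists f.
exists f; split=> [n||i]; first by have [] := fP n.
  by apply: cvg_natSinv => n; have [_ []] := fP n.
apply: cvg_natSinv => n; have [tf [_ /(_ i)]] := fP n.
by rewrite (weak_derivativeB Omega_bounded) //; exact: (test_H1 Omega_bounded).
Qed.

(** Closedness identifies the limits of the derivatives; approximating one late [u n] by a test
    function then approximates [v]. *)
Lemma H10_limit (u : nat -> L2O) v (h : 'I_d -> L2O) : (forall n, H10 (u n)) ->
  u n @[n --> \oo] --> v ->
  (forall i, weak_derivative i (u n) @[n --> \oo] --> h i) ->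
  H10 v /\ forall i, weak_derivative i v = h i.
Proof.
move=> Hu uv uh.
have vh i : is_weak_derivative i v (h i).
  apply: (is_weak_derivative_cvg Omega_bounded (g :=
    fun n => weak_derivative i (u n)) _ uv (uh i)) => n.
  by apply: (weak_derivativeP Omega_bounded); case: (Hu n).
have Hv : H1 v by move=> i; exists (h i).
have vE i : weak_derivative i v = h i by exact: (weak_derivativeE
  Omega_bounded).
split=> //; apply/(H10P _); split=> // e e0.
have e2 : 0 < e / 2 by rewrite divr_gt0.
have [n [un hn]] : exists n, `|v - u n| <= e / 2 /\
    forall i, `|h i - weak_derivative i (u n)| <= e / 2.
  have nh : \forall n \near \oo, forall i,
    `|h i - weak_derivative i (u n)| <= e / 2.
    by apply: filter_forall => i; move/cvgrPdist_le : (uh i); exact.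
  move/cvgrPdist_le : uv => /(_ _ e2) uv.
  have [n _ nP] := filterI uv nh.
  by exists n; exact: (nP n (leqnn n)).
have /(H10P _)[Hun /(_ _ e2)[f tf [f0 f1]]] := Hu n.
have H1f := test_H1 Omega_bounded tf.
exists f => //; split=> [|i].
  rewrite -(subrK (u n) v) -addrA (splitr e).
  by apply: le_trans (ler_normD _ _) _; rewrite lerD.
rewrite (weak_derivativeB Omega_bounded)// vE.
rewrite -(subrK (weak_derivative i (u n)) (h i)) -addrA (splitr e).
apply: le_trans (ler_normD _ _) _; rewrite lerD//.
by rewrite -(weak_derivativeB Omega_bounded).
Qed.

Lemma grad_innerC u v : grad_inner u v = grad_inner v u.
Proof. by apply: eq_bigr => i _; rewrite L2_innerC. Qed.

Lemma grad_inner_linl a u v w : H1 u -> H1 v ->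
  grad_inner (a *: u + v) w = a * grad_inner u w + grad_inner v w.
Proof.
move=> Hu Hv; rewrite /grad_inner mulr_sumr -big_split/=.
apply: eq_bigr => i _.
by rewrite (weak_derivative_lin Omega_bounded)// L2_innerDl L2_innerZl.
Qed.

Lemma grad_inner_norm u :
  grad_inner u u = \sum_(i < d) `|weak_derivative i u| ^+ 2.
Proof. by apply: eq_bigr => i _; exact: L2_inner_norm. Qed.

Lemma grad_inner_ge0 u : 0 <= grad_inner u u.
Proof. by rewrite grad_inner_norm; apply: sumr_ge0 => i _; exact: sqr_ge0. Qed.

Lemma weak_derivative_le_grad i u : `|weak_derivative i u| ^+ 2 <= grad_inner u
  u.
Proof.
rewrite grad_inner_norm (bigD1 i)// lerDl.
by apply: sumr_ge0 => j _; exact: sqr_ge0.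
Qed.

(** For a test function [v] this is the definition of the second weak derivatives of [u]. Both sides
    are continuous along the approximation of [v] in H^1_0 by test functions. *)
Lemma green u v : H2 u -> H10 v -> grad_inner u v = - L2_inner (laplacian u) v.
Proof.
move=> [Hu H1u] Hv.
have tE f : test_class f -> grad_inner u f = - L2_inner (laplacian u) f.
  move=> /(test_classP Omega_bounded)[phi [tphi ->]].
  have -> : L2_inner (laplacian u) (test_L2 tphi) =
      \sum_(i < d) L2_inner (weak_derivative i (weak_derivative i u)) (test_L2
        tphi).
    exact: L2_inner_suml.
  rewrite -sumrN; apply: eq_bigr => i _.
  rewrite weak_derivative_test_L2.
  have /(is_weak_derivativeP Omega_bounded) -> // :=
    weak_derivativeP Omega_bounded i (H1u i).
have [f [tf fv fdv]] := H10_approx Hv.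
have l1 : grad_inner u (f n) @[n --> \oo] --> grad_inner u v.
  apply: cvg_sumr => i.
  rewrite L2_innerC; under eq_fun do rewrite L2_innerC.
  exact: L2_inner_cvgl.
apply: (cvg_unique _ l1) => //.
rewrite (_ : (fun n => _) = (fun n => - L2_inner (f n) (laplacian u))).
  by rewrite L2_innerC; apply: cvgN; exact: L2_inner_cvgl.
by apply/funext => n; rewrite tE// L2_innerC.
Qed.

End Sobolev_H10.

(** Pythagoras: under [a x y = a y y] the difference x - y is orthogonal to y, so a(x - y, x - y) =
    a(x, x) - a(y, y). The difference is written in the shape of the linearity lemma of the gradient
    form. *)
Lemma form_proj_le (R : realType) (V : lmodType R) (a : V -> V -> R) (x y : V) :
  (forall w, a (-1 *: y + x) w = -1 * a y w + a x w) ->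
  (forall v w, a v w = a w v) -> 0 <= a (-1 *: y + x) (-1 *: y + x) ->
  a x y = a y y -> a y y <= a x x.
Proof.
move=> lin aC; rewrite lin (aC y) (aC x (_ + _)) !lin (aC y x) => a0 xy; lra.
Qed.

(** * Density of test functions, the projection on H^1_0, Poincare's inequality *)

Section H10_estimates.
Context {R : realType} {d : nat} {Omega : set 'rV[R]_d}.
Variable Omega_open : open Omega.
Hypothesis Omega_bounded : bounded_set Omega.
Local Notation mu := (lebesgue_on Omega_open).
Local Notation L2O := (L2on Omega_open).
Local Notation test := (@test_function R d Omega).
Local Notation test_L2 := (test_L2 Omega_open Omega_bounded).
Implicit Types (f g h u v w : L2O) (phi psi : 'rV[R]_d -> R) (i : 'I_d).

Lemma le_sqr_norm_eq u v : u = v -> `|v| ^+ 2 <= `|u| ^+ 2.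
Proof. by move=> ->. Qed.

Lemma grad_inner_cvg (u : nat -> L2O) v :
  (forall i, weak_derivative i (u n) @[n --> \oo] --> weak_derivative i v) ->
  grad_inner (u n) (u n) @[n --> \oo] --> grad_inner v v.
Proof.
move=> uv; rewrite grad_inner_norm; under eq_fun do rewrite grad_inner_norm.
by apply: cvg_sumr => i; apply: cvgM; exact: cvg_norm (uv i).
Qed.

(* Test the definition of the weak derivative of phi against x_i phi. *)
Lemma test_poincare f i K : 0 <= K -> Omega `<=` box K -> test_class f ->
  `|f| <= 2 * K * `|weak_derivative i f|.
Proof.
move=> K0 OK /(test_classP Omega_bounded)[phi [tphi ->]].
rewrite weak_derivative_test_L2; set D := test_L2 (test_derive i tphi).
have [sphi _ phiO] := tphi.
have sc : smooth (fun x : 'rV[R]_d => x 0 i) by move=> k; exact: Ck_coord.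
have tX := test_function_mull sc tphi.
set f0 := test_L2 tphi; pose X := test_L2 tX.
have dX (x : 'rV[R]_d) : 'D_(basis_vec i) (fun y : 'rV[R]_d =>
  y 0 i * phi y) x =
    x 0 i * 'D_(basis_vec i) phi x + phi x.
  have dc : is_derive x (basis_vec i) (fun y : 'rV[R]_d => y 0 i) 1.
    apply: cvg_is_derive; apply: cvg_near_cst; near=> h.
    have h0 : h != 0 by near: h; exact: nbhs_dnbhs_neq.
    rewrite [X in _ *: (X - _)]mxE [X in _ *: (X + _ - _)]mxE basis_vecE eqxx
      mulr1 addrK.
    exact: mulVf.
  have := is_deriveM dc (derivableP (@smooth_derivable _ _ phi i x sphi)).
  move=> /(@derive_val _ _ _ _ _ _ _) ->.
  by rewrite -[LHS]/(_ * _ + _ * _) mulr1.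
have Lphi := test_Lfun Omega_open Omega_bounded tphi.
have LX := test_Lfun Omega_open Omega_bounded tX.
have LD := test_Lfun Omega_open Omega_bounded (test_derive i tphi).
have E : L2_inner f0 f0 = - (2 * L2_inner X D).
  have := weak_derivative_test Omega_open Omega_bounded i tphi.
  move=> /(is_weak_derivativeP Omega_bounded)/(_ _ tX).
  rewrite -/f0 -/D -/X (L2_innerC D).
  have -> : L2_inner f0 (test_L2 (test_derive i tX)) = L2_inner X D + L2_inner
    f0 f0.
    rewrite !L2_inner_test_test -RintegralD//.
    - by apply: eq_Rintegral => x _; rewrite dX; ring.
    - exact/Lfun1_integrable/Lfun2_mul_Lfun1.
    - exact/Lfun1_integrable/Lfun2_mul_Lfun1.
  lra.
have XK : `|X| <= K * `|f0|.
  rewrite -(@ler_pXn2r _ 2) ?nnegrE ?mulr_ge0// exprMn -!L2_inner_norm.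
  rewrite !L2_inner_test_test -RintegralZl//;
    last exact/Lfun1_integrable/Lfun2_mul_Lfun1.
  apply: le_Rintegral => //.
  - exact/Lfun1_integrable/Lfun2_mul_Lfun1.
  - rewrite (_ : _ \o _ = (fun x => (K ^+ 2)%:E * (phi x * phi x)%:E)%E)//.
    apply: integrableZl => //; exact/Lfun1_integrable/Lfun2_mul_Lfun1.
  - move=> x _; have [->|px] := eqVneq (phi x) 0; first by rewrite !mulr0.
    rewrite mulrACA -!expr2 ler_wpM2r ?sqr_ge0//.
    have /(_ i) xK : box K x by apply/OK/phiO/subset_closure.
    by rewrite -real_normK ?num_real// ler_pXn2r ?nnegrE.
have [->|f00] := eqVneq `|f0| 0; first by rewrite !mulr_ge0.
have f0p : 0 < `|f0| by rewrite lt_def f00 normr_ge0.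
rewrite -(ler_pM2r f0p) -expr2 -L2_inner_norm E.
have := L2_cauchy_schwarz X D; rewrite ler_norml => /andP[+ _].
have := ler_wpM2r (normr_ge0 D) XK.
move: (L2_inner X D) `|X| `|D| `|f0| => a b c q; nra.
Unshelve. all: by end_near. Qed.

(* A minimising sequence is Cauchy by the parallelogram law, and v minus its
   limit is orthogonal to all the test functions. *)
Lemma test_dense v e : 0 < e -> exists2 f, test_class f & `|v - f| <= e.
Proof.
move=> e0.
pose A := [set `|v - f| ^+ 2 | f in @test_class R d Omega Omega_open].
have A0 : has_inf A.
  split; first by exists (`|v - 0| ^+ 2); exists 0 => //; exact: test_class0.
  by exists 0 => _ [f _ <-]; exact: sqr_ge0.
have infA f : test_class f -> inf A <= `|v - f| ^+ 2.
  by move=> tf; apply: ge_inf; [exact: A0.2|exists f].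
have par (a b : L2O) : `|b - a| ^+ 2 + `|a + b| ^+ 2 = 2 * `|a| ^+ 2 + 2 * `|b|
  ^+ 2.
  rewrite -!L2_inner_norm L2_innerBl !L2_innerBr L2_innerDl !L2_innerDr.
  by rewrite (L2_innerC b a); ring.
have /choice[f fP] n : exists f,
  test_class f /\ `|v - f| ^+ 2 <= inf A + n.+1%:R^-1.
  have n0 : (0 : R) < n.+1%:R^-1 by rewrite invr_gt0.
  have [_ [f tf <-] /ltW fe] := inf_adherent n0 A0.
  by exists f.
have fmn m n : `|f m - f n| ^+ 2 <= 2 * m.+1%:R^-1 + 2 * n.+1%:R^-1.
  have [[tm fm] [tn fn]] := (fP m, fP n).
  have := par (v - f m) (v - f n).
  have -> : v - f n - (v - f m) = f m - f n.
    by rewrite opprB addrC addrA subrK.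
  (* The midpoint of two test functions competes in the infimum, which bounds the parallelogram's
     other diagonal from below. *)
  have tmn : test_class (2^-1 *: (f m + f n)).
    rewrite scalerDr; apply: test_class_lin => //.
    rewrite -[_ *: _]addr0; apply: test_class_lin => //; exact: test_class0.
  have -> : v - f m + (v - f n) = 2 *: (v - 2^-1 *: (f m + f n)).
    rewrite scalerBr scalerA divff// scale1r scaler_nat mulr2n opprD.
    by rewrite addrACA.
  have := infA _ tmn; rewrite normrZ exprMn ger0_norm//.
  move: (`|v - 2^-1 *: _| ^+ 2) (`|v - f m| ^+ 2) (`|v - f n| ^+ 2) (`|f m - f
    n| ^+ 2) fm fn.
  move: (inf A) (m.+1%:R^-1 : R) (n.+1%:R^-1 : R) => I p q a b c r; lra.
have [w fw] : exists w : L2O, f n @[n --> \oo] --> w.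
  apply: L2on_complete => r r0.
  have r4 : 0 < r ^+ 2 / 4 by rewrite divr_gt0// exprn_gt0.
  have [N _ /(_ N)/(_ (leqnn _)) /= Nr] := near_infty_natSinv_lt (PosNum r4).
  exists N => m n Nm Nn.
  rewrite -(@ler_pXn2r _ 2) ?nnegrE ?(ltW r0)//; apply: le_trans (fmn m n) _.
  have hN k : (N <= k)%N -> k.+1%:R^-1 <= r ^+ 2 / 4.
    move=> Nk; apply: le_trans (ltW Nr).
    by rewrite lef_pV2 ?posrE// ler_nat.
  have := hN m Nm; have := hN n Nn.
  move: (m.+1%:R^-1 : R) (n.+1%:R^-1 : R) (r ^+ 2) => p q a; lra.
have vw : v - w = 0.
  apply: (@L2_inner_test_eq0 _ _ _ _ Omega_bounded (v - w)) => phi tphi.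
  set h := test_L2 tphi; set c := L2_inner _ _; set q := `|h| ^+ 2.
  have q0 : 0 <= q by rewrite sqr_ge0.
  (* Moving [f n] by [t *: h] cannot go below the infimum, and [f n] is within 1/(n+1) of it; let n
     tend to infinity. *)
  have key t : 0 <= t ^+ 2 * q - 2 * t * c.
    have l : n.+1%:R^-1 + (t ^+ 2 * q - 2 * t * L2_inner (v - f n) h) @[n -->
      \oo] -->
        0 + (t ^+ 2 * q - 2 * t * c).
      apply: cvgD; first exact: cvg_harmonic.
      apply: cvgB; first exact: cvg_cst.
      apply: cvgM; first exact: cvg_cst.
      by apply: L2_inner_cvgl; apply: cvgB => //; exact: cvg_cst.
    rewrite -[X in _ <= X]add0r; apply: (ler_cvg_to (cvg_cst 0) l).
    apply: nearW => n; have [tn fn] := fP n.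
    have := infA _ (test_class_lin t (test_class_test_L2 Omega_open
      Omega_bounded tphi) tn).
    rewrite -/h opprD addrCA; move: (v - f n) fn => a fa.
    rewrite -L2_inner_norm L2_innerDl !L2_innerDr.
    rewrite !L2_innerNl !L2_innerNr !L2_innerZl !L2_innerZr opprK
      !L2_inner_norm.
    rewrite -/q (L2_innerC h); move: fa.
    move: (inf A) (n.+1%:R^-1 : R) (L2_inner a h) (`|a| ^+ 2) => I p b x; lra.
  (* Near the minimiser c / q of the quadratic; the denominator [q + 1] also covers q = 0, and the
     value is still negative unless c = 0. *)
  have := key (c / (q + 1)).
  have q1 : 0 < q + 1 by rewrite ltr_wpDl.
  have -> : (c / (q + 1)) ^+ 2 * q - 2 * (c / (q + 1)) * c =
      - (c ^+ 2 * ((q + 2) / (q + 1) ^+ 2)) by field; rewrite gt_eqF.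
  rewrite oppr_ge0 pmulr_lle0; last by rewrite divr_gt0 ?exprn_gt0// ltr_wpDl.
  by move=> c2; apply/eqP; rewrite -sqrf_eq0 eq_le c2 sqr_ge0.
have {}fw : f n @[n --> \oo] --> v by rewrite -(subrK w v) vw add0r.
move/cvgrPdist_le : fw => /(_ e e0)[n _ /(_ n (leqnn n))] fn.
by exists (f n) => //; have [] := fP n.
Qed.

Section projection.
Variable P : {linear L2O -> L2O}.
Hypothesis PD : commutes_with_laplacian P.
Hypothesis PP : orthogonal_projection P.

Lemma proj_norm_le u : `|P u| <= `|u|.
Proof.
have [P2 Psym] := PP.
have [->|Pu0] := eqVneq (P u) 0; first by rewrite normr0.
have : `|P u| ^+ 2 <= `|u| * `|P u|.
  rewrite -L2_inner_norm Psym P2; apply: le_trans (L2_cauchy_schwarz _ _).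
  exact: ler_norm.
by rewrite expr2 ler_pM2r// normr_gt0.
Qed.

Lemma proj_cvg (u : nat -> L2O) v :
  u n @[n --> \oo] --> v -> P (u n) @[n --> \oo] --> P v.
Proof.
move=> /cvgrPdist_le uv; apply/cvgrPdist_le => e e0.
apply: filterS (uv e e0) => n; apply: le_trans.
by rewrite -linearB; exact: proj_norm_le.
Qed.

(* Green's formula gives (grad u, grad (P u)) = |grad (P u)|^2, and then
   |grad (u - P u)|^2 >= 0 is the claim. *)
Lemma grad_proj_le_H2 u : H2 u -> H10 u ->
  grad_inner (P u) (P u) <= grad_inner u u.
Proof.
move=> H2u H10u; have [H2P H10P' PE] := PD H2u H10u.
have [P2 Psym] := PP.
have [H1u H1Pu] := (H10_H1 H10u, H10_H1 H10P').
have E1 : grad_inner u (P u) = grad_inner (P u) (P u).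
  rewrite (green Omega_bounded H2u H10P') (green Omega_bounded H2P H10P').
  by rewrite -PE Psym P2.
apply: (form_proj_le _ _ _ E1).
- by move=> w; exact: (grad_inner_linl Omega_bounded (-1) w H1Pu H1u).
- exact: grad_innerC.
- exact: grad_inner_ge0.
Qed.

(** [grad_proj_le_H2] applied to differences of approximating test functions makes the gradients of
    [P (f n)] Cauchy; since [P (f n)] tends to [P u] in L^2, [H10_limit] identifies their limit as
    the gradient of [P u]. *)
Lemma H10_proj u : H10 u ->
  H10 (P u) /\ grad_inner (P u) (P u) <= grad_inner u u.
Proof.
move=> Hu; have [f [tf fu fdu]] := H10_approx Omega_bounded Hu.
have H1f n : H1 (f n) by exact: (test_H1 Omega_bounded).
have HPf n : H10 (P (f n)).
  by have [] := PD (test_H2 Omega_bounded (tf n)) (test_H10 Omega_bounded (tf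
    n)).
have H1Pf n : H1 (P (f n)) := H10_H1 (HPf n).
have dle i m n : `|weak_derivative i (P (f m)) - weak_derivative i (P (f n))|
  ^+ 2 <=
    \sum_(j < d) `|weak_derivative j (f m) - weak_derivative j (f n)| ^+ 2.
  have tmn : test_class (f m - f n).
    by rewrite addrC -scaleN1r; exact: test_class_lin.
  have E := etrans (congr1 (weak_derivative i) (linearB P (f m) (f n)))
    (weak_derivativeB Omega_bounded i (H1Pf m) (H1Pf n)).
  apply: (le_trans (le_sqr_norm_eq E)).
  apply: le_trans (weak_derivative_le_grad _ _) _.
  apply: le_trans (grad_proj_le_H2 (test_H2 Omega_bounded tmn) (test_H10
    Omega_bounded tmn)) _.
  rewrite grad_inner_norm; apply: ler_sum => j _.
  by rewrite (weak_derivativeB Omega_bounded j (H1f m) (H1f n)).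
have /choice[h hP] i : exists h, weak_derivative i (P (f n)) @[n --> \oo] --> h.
  apply: L2on_complete => e e0.
  (* Each of the d differences is at most 2c, and d (2c)^2 <= (d + 1)^2 (2c)^2 = e^2; using d + 1
     avoids a zero denominator. *)
  pose c := e / (2 * d.+1%:R).
  have c0 : 0 < c by rewrite divr_gt0// mulr_gt0.
  have : \forall n \near \oo, forall j,
    `|weak_derivative j u - weak_derivative j (f n)| <= c.
    by apply: filter_forall => j; move/cvgrPdist_le : (fdu j); exact.
  move=> [N _ NP]; exists N => m n Nm Nn.
  rewrite -(@ler_pXn2r _ 2) ?nnegrE ?(ltW e0)//; apply: le_trans (dle i m n) _.
  have -> : e ^+ 2 = d.+1%:R ^+ 2 * (2 * c) ^+ 2.
    by rewrite -exprMn /c; congr (_ ^+ 2); field; rewrite nat1r pnatr_eq0.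
  apply: (@le_trans _ _ (\sum_(j < d) (2 * c) ^+ 2)).
    have c20 : 0 <= 2 * c by rewrite pmulr_rge0// ltW.
    apply: ler_sum => j _; rewrite ler_pXn2r ?nnegrE//.
    apply: le_trans (ler_distD (weak_derivative j u) _ _) _.
    by rewrite [leRHS]mulr_natl mulr2n; apply: lerD; [rewrite distrC|];
      exact: NP.
  rewrite sumr_const card_ord -[leLHS]mulr_natl ler_wpM2r ?sqr_ge0//.
  by rewrite -natrX ler_nat (leq_trans (leqnSn d))// leq_pmulr.
have [HP PE] := H10_limit Omega_bounded HPf (proj_cvg fu) hP.
split; first exact: HP.
have hP' i : weak_derivative i (P (f n)) @[n --> \oo] --> weak_derivative i (P
  u).
  by move: (hP i); rewrite -(PE i).
apply: (ler_cvg_to (grad_inner_cvg hP') (grad_inner_cvg fdu));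
  apply: nearW => n.
exact: (grad_proj_le_H2 (test_H2 Omega_bounded (tf n)) (test_H10 Omega_bounded
  (tf n))).
Qed.

End projection.

Lemma poincare : (0 < d)%N ->
  exists2 C : R, 0 < C & forall u, H10 u -> `|u| ^+ 2 <= C * grad_inner u u.
Proof.
move=> d0; have [K K0 OK] := bounded_subset_box Omega_bounded.
(* Bounding one direction suffices; the added 1 keeps the constant positive when K = 0. *)
pose i := Ordinal d0; exists (4 * K ^+ 2 + 1).
  by rewrite ltr_wpDl// mulr_ge0// sqr_ge0.
move=> u Hu; have [f [tf fu fdu]] := H10_approx Omega_bounded Hu.
have uK : `|u| <= 2 * K * `|weak_derivative i u|.
  have l : 2 * K * `|weak_derivative i (f n)| @[n --> \oo] --> 2 * K *
    `|weak_derivative i u|.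
    by apply: cvgM; [exact: cvg_cst|exact: cvg_norm (fdu i)].
  apply: (ler_cvg_to (cvg_norm fu) l); apply: nearW => n.
  exact: test_poincare K0 OK (tf n).
have G := weak_derivative_le_grad i u.
have u2 : `|u| ^+ 2 <= (2 * K * `|weak_derivative i u|) ^+ 2.
  by rewrite ler_pXn2r ?nnegrE ?mulr_ge0.
apply: le_trans u2 _; move: G (grad_inner_ge0 u).
move: (`|weak_derivative i u|) (grad_inner u u) => a b ab b0.
have : 4 * K ^+ 2 * a ^+ 2 <= 4 * K ^+ 2 * b by rewrite ler_wpM2l// mulr_ge0//
  sqr_ge0.
rewrite !exprMn mulrDl mul1r; lra.
Qed.

End H10_estimates.

(** * Differentiable curves for a semi-inner product *)

(** The semigroup axioms speak of real limits of energy norms; the abstract arguments below use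
    their epsilon form. *)
Lemma cvg_right0P (R : realType) (f : R -> R) : (forall t, 0 <= f t) ->
  f t @[t --> 0^'+] --> (0 : R) <->
  forall eps, 0 < eps -> exists2 r, 0 < r & forall t, 0 < t -> t < r ->
    f t <= eps.
Proof.
move=> f0; split=> [/cvgrPdist_le cf eps e0|cf].
  have [r /= r0 rP] := cf eps e0; exists r => // t t0 tr.
  have := rP t; rewrite /= !sub0r !normrN !ger0_norm ?(ltW t0)//.
  exact.
apply/cvgrPdist_le => eps e0; have [r r0 rP] := cf eps e0.
exists r => //= t; rewrite /= !sub0r !normrN (ger0_norm (f0 t)) => tr t0.
by apply: rP => //; rewrite gtr0_norm in tr.
Qed.

Lemma is_derive_dist (R : realType) (f : R -> R) (t l : R) :
  (forall eps, 0 < eps -> exists2 r, 0 < r & forall h, h != 0 -> `|h| < r ->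
    `|h^-1 * (f (h + t) - f t) - l| <= eps) -> is_derive t (1 : R) f l.
Proof.
move=> fl; apply: cvg_is_derive; apply/cvgrPdist_le => eps e0.
have [r r0 rP] := fl eps e0; exists r => //= h;
  rewrite /= sub0r normrN => hr h0.
by rewrite distrC [_%:A]mulr1; exact: rP.
Qed.

Lemma cvg_right0_dist (R : realType) (f : R -> R) :
  (forall eps, 0 < eps -> exists2 r, 0 < r &
    forall t, 0 < t -> t < r -> `|f t - f 0| <= eps) ->
  f t @[t --> 0^'+] --> f 0.
Proof.
move=> f0; apply/cvgrPdist_le => eps e0; have [r r0 rP] := f0 eps e0.
exists r => //= s; rewrite /= sub0r normrN => sr s0.
by rewrite distrC; apply: rP => //; rewrite gtr0_norm in sr.
Qed.

(** Along a trajectory the derivative is available for t > 0 only, so right continuity at 0 is a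
    separate assumption. *)
Lemma nonincreasing_right0 (R : realType) (f df : R -> R) :
  f t @[t --> 0^'+] --> f 0 ->
  (forall t : R, 0 < t -> is_derive t (1 : R) f (df t)) ->
  (forall t, 0 < t -> df t <= 0) -> forall t, 0 <= t -> f t <= f 0.
Proof.
move=> f0 fdf df0 t; rewrite le_eqVlt => /predU1P[<-//|t0].
have itv0 x : x \in `]0, t[%R -> 0 < x by rewrite in_itv /= => /andP[].
have fc x : 0 < x -> {for x, continuous f}.
  move=> x0; apply: differentiable_continuous; apply/derivable1_diffP.
  exact: (@ex_derive _ _ _ _ _ _ _ (fdf x x0)).
apply: (@ler0_derive1_nincr R f 0 t _ _ _ 0 t) => //; last exact: ltW.
- by move=> x /itv0 x0; exact: (@ex_derive _ _ _ _ _ _ _ (fdf x x0)).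
- move=> x /itv0 x0; rewrite derive1E (@derive_val _ _ _ _ _ _ _ (fdf x x0)).
  exact: df0.
- apply: derivable_oo_LRcontinuous_within; split => //.
  + by move=> x /itv0 x0; exact: (@ex_derive _ _ _ _ _ _ _ (fdf x x0)).
  + exact: cvg_at_left_filter (fc t t0).
Qed.

Lemma subrACA (V : zmodType) (x y z w : V) : x - y - (z - w) = x - z - (y - w).
Proof. by rewrite !opprD !opprK addrACA. Qed.

Section semi_inner_product.
Context (R : realType) (V : lmodType R) (X : set V) (e : V -> V -> R).

(** Modelled on the gradient form: symmetric and nonnegative everywhere, but linear only on [X],
    where weak derivatives exist. Definiteness is left out. *)
Record semi_inner : Prop := {
  semi_inner0 : X 0 ;
  semi_inner_closed : forall c U W, X U -> X W -> X (c *: U + W) ;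
  semi_inner_lin : forall c U W Z, X U -> X W ->
    e (c *: U + W) Z = c * e U Z + e W Z ;
  semi_innerC : forall U W, e U W = e W U ;
  semi_inner_ge0 : forall U, 0 <= e U U
}.

Hypothesis eP : semi_inner.

Definition semi_norm U := Num.sqrt (e U U).
Local Notation N := semi_norm.

Let lin := semi_inner_lin eP.
Let sC := semi_innerC eP.

Lemma closedZ c U : X U -> X (c *: U).
Proof. by move=> XU; have := semi_inner_closed eP c XU (semi_inner0 eP);
  rewrite addr0. Qed.
Lemma closedD U W : X U -> X W -> X (U + W).
Proof. by move=> XU XW; have := semi_inner_closed eP 1 XU XW;
  rewrite scale1r. Qed.
Lemma closedB U W : X U -> X W -> X (U - W).
Proof. by move=> XU XW; have := semi_inner_closed eP (-1) XW XU;
  rewrite scaleN1r addrC. Qed.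

Lemma semi_innerDl U W Z : X U -> X W -> e (U + W) Z = e U Z + e W Z.
Proof. by move=> XU XW; have := lin 1 Z XU XW; rewrite scale1r mul1r. Qed.
Lemma semi_inner0l Z : e 0 Z = 0.
Proof.
have := semi_innerDl Z (semi_inner0 eP) (semi_inner0 eP).
by rewrite addr0 => /eqP; rewrite -subr_eq subrr eq_sym => /eqP.
Qed.
Lemma semi_innerZl c U Z : X U -> e (c *: U) Z = c * e U Z.
Proof.
by move=> XU; have := lin c Z XU (semi_inner0 eP);
  rewrite addr0 semi_inner0l addr0.
Qed.
Lemma semi_innerBl U W Z : X U -> X W -> e (U - W) Z = e U Z - e W Z.
Proof.
by move=> XU XW; rewrite addrC -scaleN1r lin// mulN1r addrC.
Qed.
Lemma semi_innerDr U W Z : X U -> X W -> e Z (U + W) = e Z U + e Z W.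
Proof. by move=> XU XW; rewrite sC semi_innerDl// !(sC Z). Qed.
Lemma semi_innerZr c U Z : X U -> e Z (c *: U) = c * e Z U.
Proof. by move=> XU; rewrite sC semi_innerZl// (sC Z). Qed.
Lemma semi_innerBr U W Z : X U -> X W -> e Z (U - W) = e Z U - e Z W.
Proof. by move=> XU XW; rewrite sC semi_innerBl// !(sC Z). Qed.

Lemma semi_norm_ge0 U : 0 <= N U. Proof. exact: sqrtr_ge0. Qed.

Lemma semi_norm_sqr U : N U ^+ 2 = e U U.
Proof. by rewrite sqr_sqrtr// (semi_inner_ge0 eP). Qed.

Lemma semi_cauchy_schwarz_sqr U W : X U -> X W -> e U W ^+ 2 <= e U U * e W W.
Proof.
move=> XU XW; have W0 := semi_inner_ge0 eP W.
have key c : 0 <= e U U - 2 * c * e U W + c ^+ 2 * e W W.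
  have := semi_inner_ge0 eP (U - c *: W); have XcW := closedZ c XW.
  rewrite semi_innerBl// !semi_innerBr// !semi_innerZl// !semi_innerZr//.
  by rewrite (sC W U) => h; apply: le_trans h _; rewrite le_eqVlt; apply/orP;
    left; apply/eqP; ring.
move: (e U W) (e U U) (e W W) W0 key => b a c;
  rewrite le_eqVlt => /predU1P[<-|c0] key.
  rewrite mulr0; have [->|b0] := eqVneq b 0; first by rewrite expr0n.
  (* When [e W W] is 0 the quadratic degenerates to an affine function of its parameter, which takes
     the value -1 here unless b = 0. *)
  have := key ((a + 1) / (2 * b)).
  have -> : a - 2 * ((a + 1) / (2 * b)) * b + ((a + 1) / (2 * b)) ^+ 2 * 0 = -1.
    by field.
  by rewrite oppr_ge0 ler10.
have := key (b / c).
have -> : a - 2 * (b / c) * b + (b / c) ^+ 2 * c = (a * c - b ^+ 2) / c.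
  by field; rewrite gt_eqF.
by rewrite pmulr_lge0 ?invr_gt0// subr_ge0.
Qed.

Lemma semi_cauchy_schwarz U W : X U -> X W -> `|e U W| <= N U * N W.
Proof.
move=> XU XW; rewrite -(@ler_pXn2r _ 2) ?nnegrE ?mulr_ge0 ?semi_norm_ge0//.
by rewrite real_normK ?num_real// exprMn !semi_norm_sqr semi_cauchy_schwarz_sqr.
Qed.

Lemma semi_normZ c U : X U -> N (c *: U) = `|c| * N U.
Proof.
move=> XU; rewrite /semi_norm semi_innerZl// semi_innerZr// mulrA -expr2.
by rewrite sqrtrM ?sqr_ge0// sqrtr_sqr.
Qed.

Lemma semi_normN U : X U -> N (- U) = N U.
Proof. by move=> XU; rewrite -scaleN1r semi_normZ// normrN1 mul1r. Qed.

Lemma semi_normD U W : X U -> X W -> N (U + W) <= N U + N W.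
Proof.
move=> XU XW; rewrite -(@ler_pXn2r _ 2) ?nnegrE ?addr_ge0 ?semi_norm_ge0//.
rewrite semi_norm_sqr semi_innerDl// !semi_innerDr// (sC W U).
rewrite sqrrD !semi_norm_sqr.
have := ler_norm (e U W); have := semi_cauchy_schwarz XU XW.
rewrite mulr2n; move: (e U W) (e U U) (e W W) (`|e U W|) (N U * N W) => *; lra.
Qed.

Lemma semi_normB U W : X U -> X W -> N (U - W) <= N U + N W.
Proof.
move=> XU XW; have XN : X (- W) by rewrite -scaleN1r; exact: closedZ.
by rewrite -(semi_normN XW); exact: semi_normD.
Qed.

(** [V] carries no topology, so the two-sided derivative of a curve is expressed by the seminorm
    alone. *)
Definition has_deriv (Y : R -> V) (t : R) (W : V) := forall eps, 0 < eps ->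
  exists2 r, 0 < r & forall h, h != 0 -> `|h| < r ->
    N (h^-1 *: (Y (h + t) - Y t) - W) <= eps.

Definition right_continuous0 (Y : R -> V) := forall eps, 0 < eps ->
  exists2 r, 0 < r & forall t, 0 < t -> t < r -> N (Y t - Y 0) <= eps.

Lemma has_derivB (Y Z : R -> V) (t : R) (U W : V) : 0 < t ->
  (forall s, 0 <= s -> X (Y s)) -> (forall s, 0 <= s -> X (Z s)) -> X U ->
    X W ->
  has_deriv Y t U -> has_deriv Z t W ->
    has_deriv (fun s => Y s - Z s) t (U - W).
Proof.
move=> t0 XY XZ XU XW dY dZ eps e0; have e2 : 0 < eps / 2 by rewrite divr_gt0.
have [[r r0 rP] [q q0 qP]] := (dY _ e2, dZ _ e2).
(* Increments smaller than [t] keep [h + t] nonnegative, where the curves are known to stay in [X];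
   the same device recurs below. *)
exists (Num.min t (Num.min r q)); first by rewrite !lt_min t0 r0.
move=> h h0; rewrite !lt_min => /and3P[ht hr hq].
have th : 0 <= h + t by move: ht; rewrite ltr_norml => /andP[]; lra.
have X1 : X (h^-1 *: (Y (h + t) - Y t) - U).
  by apply: closedB => //; apply/closedZ/closedB; apply: XY => //; exact: ltW.
have X2 : X (h^-1 *: (Z (h + t) - Z t) - W).
  by apply: closedB => //; apply/closedZ/closedB; apply: XZ => //; exact: ltW.
have -> : h^-1 *: (Y (h + t) - Z (h + t) - (Y t - Z t)) - (U - W) =
    (h^-1 *: (Y (h + t) - Y t) - U) - (h^-1 *: (Z (h + t) - Z t) - W).
  by rewrite subrACA scalerBr subrACA.
apply: le_trans (semi_normB X1 X2) _; rewrite [eps]splitr.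
by apply: lerD; [exact: rP|exact: qP].
Qed.

Lemma right_continuous0B (Y Z : R -> V) :
  (forall s, 0 <= s -> X (Y s)) -> (forall s, 0 <= s -> X (Z s)) ->
  right_continuous0 Y -> right_continuous0 Z ->
  right_continuous0 (fun s => Y s - Z s).
Proof.
move=> XY XZ cY cZ eps e0; have e2 : 0 < eps / 2 by rewrite divr_gt0.
have [[r r0 rP] [q q0 qP]] := (cY _ e2, cZ _ e2).
exists (Num.min r q); first by rewrite lt_min r0.
move=> t t0; rewrite lt_min => /andP[tr tq].
have X1 : X (Y t - Y 0) by apply: closedB; apply: XY => //; exact: ltW.
have X2 : X (Z t - Z 0) by apply: closedB; apply: XZ => //; exact: ltW.
have -> : Y t - Z t - (Y 0 - Z 0) = (Y t - Y 0) - (Z t - Z 0).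
  by rewrite subrACA.
apply: le_trans (semi_normB X1 X2) _; rewrite [eps]splitr.
by apply: lerD; [exact: rP|exact: qP].
Qed.

(** Two forms are meant: the energy itself, with [c] equal to 1, for the undamped component, and the
    energy with a cross term for the damped one. *)
Variables (B : V -> V -> R) (c : R).
Hypotheses (B_lin : forall k U W Z, X U -> X W ->
    B (k *: U + W) Z = k * B U Z + B W Z)
  (B_sym : forall U W, B U W = B W U)
  (c0 : 0 <= c)
  (B_le : forall U W, X U -> X W -> `|B U W| <= c * (N U * N W)).

Let B_Dl U W Z : X U -> X W -> B (U + W) Z = B U Z + B W Z.
Proof. by move=> XU XW; have := B_lin 1 Z XU XW; rewrite scale1r mul1r. Qed.

Let B_polar U W : X U -> X W -> B (U + W) (U + W) = B W W + 2 * B U W + B U U.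
Proof.
by move=> XU XW; rewrite B_Dl// !(B_sym _ (U + W)) !B_Dl// (B_sym W U); ring.
Qed.

Lemma form_right_continuous0 (Y : R -> V) : (forall t, 0 <= t -> X (Y t)) ->
  right_continuous0 Y -> forall eps, 0 < eps -> exists2 r, 0 < r &
    forall t, 0 < t -> t < r -> `|B (Y t) (Y t) - B (Y 0) (Y 0)| <= eps.
Proof.
move=> XY cY eps e0; set n0 := N (Y 0).
have n00 : 0 <= n0 by exact: semi_norm_ge0.
(* With Z = Y t - Y 0 of norm at most 1, the increment 2 B(Z, Y 0) + B(Z, Z) is at most c (2 n0 + 1)
   N(Z). *)
pose m := c * (2 * n0 + 1) + 1.
have m0 : 0 < m by rewrite ltr_wpDl// mulr_ge0// addr_ge0// mulr_ge0.
have d0 : 0 < Num.min 1 (eps / m) by rewrite lt_min ltr01 divr_gt0.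
have [r r0 rP] := cY _ d0; exists r => // t t0 tr.
have := rP t t0 tr; rewrite le_min => /andP[Z1 Z2].
have [XYt XY0] := (XY t (ltW t0), XY 0 (lexx 0)).
have XZ := closedB XYt XY0.
set Z := Y t - Y 0 in Z1 Z2 XZ.
have -> : Y t = Z + Y 0 by rewrite subrK.
rewrite B_polar//; have ->
  : forall x y z : R, x + y + z - x = y + z by move=> *; ring.
apply: le_trans (ler_normD _ _) _; rewrite normrM ger0_norm//.
have b1 := B_le XZ XY0; have b2 := B_le XZ XZ.
have Z0 := semi_norm_ge0 Z; move: Z2; rewrite ler_pdivlMr// => Z2.
apply: le_trans Z2; rewrite /m -/n0 in b1 *.
move: b1 b2; move: (`|B Z (Y 0)|) (`|B Z Z|) (N Z) Z0 Z1 => x y z z0 z1 b1 b2.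
have : c * (z * z) <= c * z by rewrite ler_wpM2l// ler_piMr.
nra.
Qed.

Lemma form_is_derive (Y : R -> V) (t : R) (W : V) : 0 < t ->
  (forall s, 0 <= s -> X (Y s)) -> X W -> has_deriv Y t W ->
  is_derive t (1 : R) (fun s => B (Y s) (Y s)) (2 * B W (Y t)).
Proof.
move=> t0 XY XW dY; apply: is_derive_dist => eps e0.
set n0 := N (Y t); set n1 := N W.
have [n00 n10] : 0 <= n0 /\ 0 <= n1 by split; exact: semi_norm_ge0.
(* With Z the error of the difference quotient, the error of the derivative is 2 B(Z, Y t) + h B(Z +
   W, Z + W). The first two terms of [m] bound these when N(Z) and |h| are at most eps / m and N(Z)
   <= 1; the last makes [m] positive. *)
pose m := c * (2 * n0) + c * (n1 + 1) ^+ 2 + 1.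
have m0 : 0 < m.
  by rewrite ltr_wpDl// addr_ge0// mulr_ge0// ?sqr_ge0// mulr_ge0.
have d0 : 0 < Num.min 1 (eps / m) by rewrite lt_min ltr01 divr_gt0.
have [r r0 rP] := dY _ d0; exists (Num.min t (Num.min r (eps / m))).
  by rewrite !lt_min t0 r0 divr_gt0.
move=> h h0; rewrite !lt_min => /and3P[ht hr hm].
have := rP h h0 hr; rewrite le_min => /andP[Z1 Z2].
have XYh : X (Y (h + t)).
  by apply: XY; move: ht; rewrite ltr_norml => /andP[]; lra.
have XYt := XY t (ltW t0).
have XD := closedZ h^-1 (closedB XYh XYt).
set Z := h^-1 *: _ - W in Z1 Z2.
have XZ : X Z by exact: closedB.
have XZW := closedD XZ XW.
have -> : Y (h + t) = h *: (Z + W) + Y t.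
  by rewrite /Z subrK scalerA divff// scale1r subrK.
rewrite B_polar//; last exact: closedZ.
have BZ k U T : X U -> B (k *: U) T = k * B U T.
  move=> XU; have := B_lin k T XU (semi_inner0 eP); rewrite addr0 => ->.
  have := B_lin 1 T (semi_inner0 eP) (semi_inner0 eP).
  rewrite scaler0 addr0 mul1r => E; have -> : B 0 T = 0 by lra.
  by rewrite addr0.
rewrite !BZ// (B_sym _ (h *: _)) BZ//.
have -> : h^-1 * (B (Y t) (Y t) + 2 * (h * B (Z + W) (Y t)) +
    h * (h * B (Z + W) (Z + W)) - B (Y t) (Y t)) - 2 * B W (Y t) =
    2 * B Z (Y t) + h * B (Z + W) (Z + W) by rewrite (B_Dl _ XZ XW); field.
apply: le_trans (ler_normD _ _) _; rewrite !normrM (ger0_norm (ler0n _ 2)).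
have b1 := B_le XZ XYt; have b2 := B_le XZW XZW.
have nZW : N (Z + W) <= n1 + 1.
  by rewrite (addrC n1); apply: le_trans (semi_normD XZ XW) _; rewrite lerD.
have Z0 := semi_norm_ge0 Z; have ZW0 := semi_norm_ge0 (Z + W).
have b3 : `|B (Z + W) (Z + W)| <= c * (n1 + 1) ^+ 2.
  apply: le_trans b2 _; rewrite ler_wpM2l// expr2.
  exact: ler_pM.
have b4 : 2 * `|B Z (Y t)| <= eps / m * (c * (2 * n0)).
  rewrite -/n0 in b1.
  have : c * (N Z * n0) <= c * (eps / m * n0) by rewrite ler_wpM2l// ler_wpM2r.
  by move: b1; move: (`|B Z (Y t)|) (N Z) (eps / m) => *; lra.
have b5 : `|h| * `|B (Z + W) (Z + W)| <= eps / m * (c * (n1 + 1) ^+ 2).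
  exact: (ler_pM (normr_ge0 _) (normr_ge0 _) (ltW hm) b3).
apply: le_trans (lerD b4 b5) _.
rewrite -mulrDr mulrAC ler_pdivrMr// ler_wpM2l ?(ltW e0)// /m.
by rewrite lerDl.
Qed.

End semi_inner_product.

(** * Damped wave semigroups *)

Section wave_energy.
Context (R : realType) (L : lmodType R).
(** In the application [L] is L^2, [K] is H^1_0, [D] is the intersection of H^2 and H^1_0, [a] is
    the gradient form, [ip] the L^2 inner product and [C] the Poincare constant. *)
Variables (K D : set L) (a ip : L -> L -> R) (lap : L -> L) (C : R).
Hypotheses (ipP : semi_inner setT ip) (ip_eq0 : forall u, ip u u = 0 -> u = 0)
  (aP : semi_inner K a) (C0 : 0 < C)
  (DK : D `<=` K)
  (D_lin : forall c u v, D u -> D v -> D (c *: u + v))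
  (lap_lin : forall c u v, D u -> D v -> lap (c *: u + v) = c *: lap u + lap v)
  (green_DK : forall u v, D u -> K v -> a u v = - ip (lap u) v)
  (poincare_K : forall u, K u -> ip u u <= C * a u u).
Implicit Types (U W : (L * L)%type).

Definition energy U W := a U.1 W.1 + ip U.2 W.2.
Definition energy_set : set (L * L)%type := [set U | K U.1].
Definition energy_domain : set (L * L)%type := [set U | D U.1 /\ K U.2].
Local Notation X := energy_set.
Local Notation N := (semi_norm energy).

Lemma energy_semi_inner : semi_inner X energy.
Proof.
split=> [|c U W XU XW|c U W Z XU XW|U W|U].
- exact: (semi_inner0 aP).
- exact: (semi_inner_closed aP).
- by rewrite /energy /= (semi_inner_lin aP)// (semi_inner_lin ipP)//; ring.
- by rewrite /energy (semi_innerC aP) (semi_innerC ipP).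
- by rewrite /energy addr_ge0 ?(semi_inner_ge0 aP) ?(semi_inner_ge0 ipP).
Qed.
Local Notation eP := energy_semi_inner.

Lemma energy_ge U : a U.1 U.1 <= N U ^+ 2 /\ ip U.2 U.2 <= N U ^+ 2.
Proof.
rewrite (semi_norm_sqr eP) /energy.
by have := (semi_inner_ge0 aP U.1); have := (semi_inner_ge0 ipP U.2); split;
  lra.
Qed.

Lemma energy_eq0 U : X U -> N U <= 0 -> U = 0.
Proof.
move=> XU; rewrite le_eqVlt ltNge semi_norm_ge0 orbF => /eqP N0.
have [a0 i0] := energy_ge U; rewrite N0 expr0n in a0 i0.
have a00 : a U.1 U.1 = 0 by apply/eqP; rewrite eq_le a0 (semi_inner_ge0 aP).
have i00 : ip U.2 U.2 = 0 by apply/eqP; rewrite eq_le i0 (semi_inner_ge0 ipP).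
have := poincare_K XU; rewrite a00 mulr0 => ii.
have u0 : ip U.1 U.1 = 0 by apply/eqP; rewrite eq_le ii (semi_inner_ge0 ipP).
by case: U XU N0 a0 i0 a00 ii u0 i00 => u v /= _ _ _ _ _ _ /ip_eq0 ->
  /ip_eq0 ->.
Qed.

Definition damped_generator (A : L ->
  L) U : (L * L)%type := (U.2, lap U.1 - A U.2).

Record damped_semigroup (A : L -> L) (S : R -> L * L -> L * L) : Prop := {
  damped_stable : forall t U, 0 <= t -> X U -> X (S t U) ;
  damped_linear : forall t c U W, 0 <= t -> X U -> X W ->
    S t (c *: U + W) = c *: S t U + S t W ;
  damped_contraction : forall t U, 0 <= t -> X U -> N (S t U) <= N U ;
  damped_0 : forall U, X U -> S 0 U = U ;
  damped_D : forall s t U, 0 <= s -> 0 <= t -> X U ->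
    S (s + t) U = S s (S t U) ;
  damped_continuous : forall U, X U -> forall eps, 0 < eps ->
    exists2 r, 0 < r & forall t, 0 < t -> t < r -> N (S t U - U) <= eps ;
  damped_generatorP : forall U W, X U -> X W ->
    (forall eps, 0 < eps -> exists2 r, 0 < r & forall t, 0 < t -> t < r ->
       N (t^-1 *: (S t U - U) - W) <= eps) <->
    (energy_domain U /\ W = damped_generator A U)
}.

Section semigroup.
Variables (A : L -> L) (S : R -> L * L -> L * L).
Hypothesis SP : damped_semigroup A S.

Lemma domain_energy U : energy_domain U -> X U. Proof. by case=> /DK. Qed.

Lemma generator_energy U : energy_domain U -> X (damped_generator A U).
Proof. by case. Qed.

Lemma damped_B t U W : 0 <= t -> X U -> X W -> S t (U - W) = S t U - S t W.
Proof.
move=> t0 XU XW; have := damped_linear SP (-1) t0 XW XU.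
by rewrite !scaleN1r addrC => ->; rewrite addrC.
Qed.

Lemma damped_Z t c U : 0 <= t -> X U -> S t (c *: U) = c *: S t U.
Proof.
move=> t0 XU; have S0 : S t 0 = 0.
  by have := damped_B t0 XU XU; rewrite !subrr.
by have := damped_linear SP c t0 XU (semi_inner0 eP); rewrite S0 !addr0.
Qed.

(** The contraction property transports error bounds for difference quotients from time 0 to time t;
    invariance of the domain and differentiability both rest on it. *)
Lemma damped_quotient t c U W V : 0 <= t -> X U -> X W -> X V ->
  N (c *: (S t U - S t W) - S t V) <= N (c *: (U - W) - V).
Proof.
move=> t0 XU XW XV; have XB := closedB eP XU XW; have XZ := closedZ eP c XB.
rewrite -damped_B// -damped_Z// -damped_B//.
by apply: (damped_contraction SP) => //; exact: (closedB eP).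
Qed.

(** The difference quotient at [S t U] is the image under [S t] of the one at [U], hence converges
    to the image of the generator; the characterisation of the generator then gives both
    conclusions. *)
Lemma damped_domain t U : 0 <= t -> energy_domain U ->
  energy_domain (S t U) /\ S t (damped_generator A U) = damped_generator A (S t
    U).
Proof.
move=> t0 DU; have [XU XA] := (domain_energy DU, generator_energy DU).
apply: (damped_generatorP SP (damped_stable SP t0 XU) (damped_stable SP t0
  XA)).1.
move=> eps e0.
have [r r0 rP] := (damped_generatorP SP XU XA).2 (conj DU erefl) eps e0.
exists r => // h h0 hr; apply: le_trans (rP h h0 hr).
rewrite -(damped_D SP (ltW h0) t0 XU) (addrC h t) (damped_D SP t0 (ltW h0) XU).
by apply: damped_quotient => //; apply: (damped_stable SP) => //; exact: ltW.
Qed.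

(** For h > 0 the quotient is the image under [S t] of a quotient at time 0. For h < 0 it is the
    image under [S (h + t)] of the quotient with step -h, to be compared with [S (- h)] of the
    generator; strong continuity at the generator's value bounds this shift, whence the two halves
    of [eps]. *)
Lemma damped_has_deriv t U : 0 < t -> energy_domain U ->
  has_deriv energy (S ^~ U) t (damped_generator A (S t U)).
Proof.
move=> t0 DU eps e0; have [XU XA] := (domain_energy DU, generator_energy DU).
have [DSt AE] := damped_domain (ltW t0) DU.
have e2 : 0 < eps / 2 by rewrite divr_gt0.
have [r r0 rP] := (damped_generatorP SP XU XA).2 (conj DU erefl) _ e2.
have [q q0 qP] := damped_continuous SP XA e2.
exists (Num.min t (Num.min r q)); first by rewrite !lt_min t0 r0 q0.
move=> h h0; rewrite !lt_min => /and3P[ht hr hq].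
rewrite -AE; case: (ltgtP h 0) h0 => // hs _.
- have k0 : 0 < - h by rewrite oppr_gt0.
  rewrite ltr0_norm// in ht hr hq.
  have th0 : 0 <= h + t by lra.
  have XSk V : X V -> X (S (- h) V) by apply: (damped_stable SP); exact: ltW.
  have E V : X V -> S t V = S (h + t) (S (- h) V).
    by move=> XV; rewrite -(damped_D SP th0 (ltW k0) XV) addrAC subrr add0r.
  rewrite (E U XU) (E _ XA).
  have -> : h^-1 *: (S (h + t) U - S (h + t) (S (- h) U)) =
      (- h)^-1 *: (S (h + t) (S (- h) U) - S (h + t) U).
    by rewrite invrN scaleNr -scalerN opprB.
  apply: le_trans (damped_quotient _ th0 (XSk _ XU) XU (XSk _ XA)) _.
  rewrite -(subrK (damped_generator A U) ((- h)^-1 *: _)) -addrA [eps]splitr.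
  have X1 := closedZ eP (- h)^-1 (closedB eP (XSk _ XU) XU).
  apply: le_trans (semi_normD eP (closedB eP X1 XA) (closedB eP XA (XSk _ XA)))
    _.
  apply: lerD; first exact: rP.
  rewrite -opprB (semi_normN eP); last exact: (closedB eP (XSk _ XA) XA).
  exact: qP.
- rewrite gtr0_norm// in ht hr hq.
  rewrite (addrC h t) (damped_D SP (ltW t0) (ltW hs) XU).
  apply: le_trans (damped_quotient _ (ltW t0) (damped_stable SP (ltW hs) XU) XU
    XA) _.
  apply: le_trans (rP h hs hr) _; lra.
Qed.

Lemma damped_right_continuous0 U : X U -> right_continuous0 energy (S ^~ U).
Proof.
move=> XU eps e0; have [r r0 rP] := damped_continuous SP XU e0.
by exists r => // t t0 tr; rewrite (damped_0 SP XU); exact: rP.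
Qed.

End semigroup.

(** * The undamped and the damped component of a solution *)

Section projection.
Variable P : {linear L -> L}.
Hypotheses (PK : forall u, K u -> K (P u))
  (Pa : forall u, K u -> a (P u) (P u) <= a u u)
  (PD : forall u, D u -> D (P u))
  (Plap : forall u, D u -> P (lap u) = lap (P u))
  (PP : forall u, P (P u) = P u)
  (Psym : forall u v, ip (P u) v = ip u (P v)).
Variables (S S0 : R -> L * L -> L * L).
Hypotheses (SP : damped_semigroup P S) (S0P : damped_semigroup (fun=> 0) S0)
  (dense : forall U, X U -> forall eps, 0 < eps ->
    exists2 W, energy_domain W & N (U - W) <= eps).

Definition projU U : (L * L)%type := (P U.1, P U.2).

Lemma projUB U W : projU (U - W) = projU U - projU W.
Proof. by rewrite /projU /= !linearB. Qed.

Lemma projUZ c U : projU (c *: U) = c *: projU U.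
Proof. by rewrite /projU /= !linearZ. Qed.

Lemma projU_energy U : X U -> X (projU U).
Proof. by move=> XU; exact: PK. Qed.

Lemma projU_norm U : X U -> N (projU U) <= N U.
Proof.
move=> XU; rewrite -(@ler_pXn2r _ 2) ?nnegrE ?semi_norm_ge0// !(semi_norm_sqr
  eP).
rewrite /energy /=; apply: lerD; first exact: Pa.
have := semi_inner_ge0 ipP (U.2 - P U.2).
rewrite (semi_innerBl ipP)// !(semi_innerBr ipP)//.
by rewrite (Psym U.2 U.2) (Psym U.2 (P U.2)) PP; lra.
Qed.

Lemma coprojU_domain U : energy_domain U -> energy_domain (U - projU U).
Proof.
move=> [DU KU]; split=> /=; last by apply: (closedB aP) => //; exact: PK.
by rewrite addrC -scaleN1r; apply: D_lin => //; exact: PD.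
Qed.

Lemma projU_has_deriv Y t W : 0 < t -> (forall s, 0 <= s -> X (Y s)) -> X W ->
  has_deriv energy Y t W -> has_deriv energy (projU \o Y) t (projU W).
Proof.
move=> t0 XY XW dY eps e0; have [r r0 rP] := dY eps e0.
exists (Num.min t r); first by rewrite lt_min t0.
move=> h h0; rewrite lt_min => /andP[ht hr]; apply: le_trans (rP h h0 hr).
rewrite /= -projUB -projUZ -projUB; apply: projU_norm.
have th : 0 <= h + t by move: ht; rewrite ltr_norml => /andP[]; lra.
apply: (closedB eP) => //; apply: (closedZ eP); apply: (closedB eP);
  apply: XY => //.
exact: ltW.
Qed.

Lemma projU_right_continuous0 Y : (forall s, 0 <= s -> X (Y s)) ->
  right_continuous0 energy Y -> right_continuous0 energy (projU \o Y).
Proof.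
move=> XY cY eps e0; have [r r0 rP] := cY eps e0.
exists r => // t t0 tr; apply: le_trans (rP t t0 tr).
rewrite /= -projUB; apply: projU_norm.
by apply: (closedB eP); apply: XY => //; exact: ltW.
Qed.

Lemma domain_D_lap u v : D u -> D v -> lap (u - v) = lap u - lap v.
Proof.
by move=> Du Dv; rewrite addrC -scaleN1r lap_lin// scaleN1r addrC.
Qed.

Lemma domain_DB u v : D u -> D v -> D (u - v).
Proof. by move=> Du Dv; rewrite addrC -scaleN1r; exact: D_lin. Qed.

(* The difference Y = (y, z) of the two sides satisfies Y' = (z, lap y), which
   is orthogonal to Y for the energy. *)
Lemma coprojU_solution_domain U t : energy_domain U -> 0 <= t ->
  S t U - projU (S t U) = S0 t (U - projU U).
Proof.
move=> DU t0; have XU := domain_energy DU.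
have DQ := coprojU_domain DU; have XQ := domain_energy DQ.
have XS s : 0 <= s -> X (S s U) by move=> s0; exact: (damped_stable SP).
have XPS s : 0 <= s -> X ((projU \o S ^~ U) s) by move=> s0;
  apply/projU_energy/XS.
have XQS s : 0 <= s -> X (S s U - (projU \o S ^~ U) s).
  by move=> s0; apply: (closedB eP); [exact: XS|exact: XPS].
have XS0 s : 0 <= s -> X (S0 s (U - projU U)) by move=> s0;
  exact: (damped_stable S0P).
pose Y s := S s U - (projU \o S ^~ U) s - S0 s (U - projU U).
have XY s : 0 <= s -> X (Y s).
  by move=> s0; apply: (closedB eP); [exact: XQS|exact: XS0].
pose W s := damped_generator P (S s U) - projU (damped_generator P (S s U)) -
  damped_generator (fun=> 0) (S0 s (U - projU U)).
have dY s : 0 < s -> X (W s) /\ has_deriv energy Y s (W s).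
  move=> s0; have [DS _] := damped_domain SP (ltW s0) DU.
  have [DS0 _] := damped_domain S0P (ltW s0) DQ.
  have [X1 X2] := (generator_energy P DS, generator_energy (fun=> 0) DS0).
  have X3 := projU_energy X1; have X4 := closedB eP X1 X3.
  split; first exact: (closedB eP).
  apply: (has_derivB eP) => //; last exact: damped_has_deriv.
  apply: (has_derivB eP) => //; first exact: damped_has_deriv.
  by apply: projU_has_deriv => //; exact: damped_has_deriv.
have cY : right_continuous0 energy Y.
  have cS := damped_right_continuous0 SP XU.
  apply: (right_continuous0B eP XQS XS0 _ (damped_right_continuous0 S0P XQ)).
  exact: (right_continuous0B eP XS XPS cS (projU_right_continuous0 XS cS)).
have CS U1 U2 : X U1 -> X U2 -> `|energy U1 U2| <= 1 * (N U1 * N U2).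
  by move=> ? ?; rewrite mul1r; exact: (semi_cauchy_schwarz eP).
have lin := semi_inner_lin eP; have eC := semi_innerC eP.
have Y0 : Y 0 = 0.
  by rewrite /Y /= (damped_0 SP XU) (damped_0 S0P XQ) subrr.
have orth s : 0 < s -> energy (W s) (Y s) = 0.
  move=> s0; have [[DS KS] _] := damped_domain SP (ltW s0) DU.
  have [[DS0 KS0] _] := damped_domain S0P (ltW s0) DQ.
  rewrite /W /Y /energy /=;
    move: (S s U) (S0 s _) DS KS DS0 KS0 => [u v] [z w] /= Du Kv Dz Kw.
  have DPu := PD Du; have DQu := domain_DB Du DPu.
  have K2 : K (v - P v - w) by do !apply: (closedB aP) => //; exact: PK.
  (* The damping [P v] appears in both [lap u - P v] and its projection, so it cancels and
     [lap (u - P u - z)] remains. Green's formula then makes the two halves of the energy form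
     opposite. *)
  rewrite linearB PP Plap// subr0.
  rewrite (_ : lap u - P v - (lap (P u) - P v) - lap z = lap (u - P u - z)).
    by rewrite (semi_innerC aP) green_DK ?addNr//; exact: domain_DB.
  by rewrite !domain_D_lap// opprB addrA subrK.
have := nonincreasing_right0 (cvg_right0_dist (form_right_continuous0 eP lin eC
  ler01 CS XY cY))
  (fun s s0 => form_is_derive eP lin eC ler01 CS s0 XY (dY s s0).1 (dY s s0).2)
    _ t0.
rewrite Y0 (semi_inner0l eP) => H.
have {}H : energy (Y t) (Y t) <= 0 by apply: H => s s0; rewrite orth// mulr0.
apply/eqP; rewrite -subr_eq0; apply/eqP; apply: (energy_eq0 (XY t t0)).
by rewrite -(@ler_pXn2r _ 2) ?nnegrE ?semi_norm_ge0// (semi_norm_sqr eP) expr0n.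
Qed.

Lemma coprojU_solution U t : X U -> 0 <= t ->
  S t U - projU (S t U) = S0 t (U - projU U).
Proof.
move=> XU t0; apply/eqP; rewrite -subr_eq0; apply/eqP.
have Xc V : X V -> X (V - projU V).
  by move=> XV; apply: (closedB eP) => //; exact: projU_energy.
have Nc V : X V -> N (V - projU V) <= 2 * N V.
  move=> XV; apply: le_trans (semi_normB eP XV (projU_energy XV)) _.
  by have := projU_norm XV; lra.
have XS V : X V -> X (S t V) by exact: (damped_stable SP).
have XS0 V : X V -> X (S0 t V) by exact: (damped_stable S0P).
apply: energy_eq0; first by apply: (closedB eP); [exact/Xc/XS|exact/XS0/Xc].
apply/ler_addgt0Pr => eps e0; rewrite add0r.
(* The complementary projection is bounded by 2 only, through the triangle inequality, and it occurs
   on both sides: 2 * eps / 4 + 2 * eps / 4 = eps. *)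
have e4 : 0 < eps / 4 by rewrite divr_gt0.
have [W DW UW] := dense XU e4; have XW := domain_energy DW.
have XB := closedB eP XU XW.
have -> : S t U - projU (S t U) - S0 t (U - projU U) =
    (S t (U - W) - projU (S t (U - W))) - S0 t (U - W - projU (U - W)).
  rewrite projUB (subrACA U W) (damped_B S0P t0 (Xc _ XU) (Xc _ XW)).
  rewrite (damped_B SP t0 XU XW) projUB (subrACA (S t U)) (subrACA _ _ (S0 t
    _)).
  by rewrite (coprojU_solution_domain DW t0) subrr subr0.
apply: le_trans (semi_normB eP (Xc _ (XS _ XB)) (XS0 _ (Xc _ XB))) _.
have h1 := Nc _ (XS _ XB); have h2 := damped_contraction SP t0 XB.
have h3 := damped_contraction S0P t0 (Xc _ XB); have h4 := Nc _ XB.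
lra.
Qed.

(** Chosen so that [eps0 * (1 + C)] is 1/4: Poincare's inequality then absorbs the cross term
    introduced below into a quarter of the energy. *)
Let eps0 := (4 * (1 + C))^-1.

(* For the fully damped equation y'' - lap y + y' = 0 the energy
   |grad y|^2 + |z|^2, z = y', does not control its own dissipation |z|^2;
     adding
   2 eps0 (y, z) makes the dissipation coercive. *)
Let B U W := energy U W + eps0 * (ip U.1 W.2 + ip U.2 W.1).

Let eps0_gt0 : 0 < eps0.
Proof. by rewrite invr_gt0 mulr_gt0// addr_gt0. Qed.

Let eps0C : eps0 + eps0 * C = 4^-1.
Proof.
have C1 : 1 + C != 0 by rewrite gt_eqF// addr_gt0.
by rewrite /eps0 -[X in X + _]mulr1 -mulrDr; field.
Qed.

(** Divide the nonnegative square of [k *: x - s *: y] by [k], for both signs [s]. *)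
Let ip_young x y k : 0 < k -> 2 * `|ip x y| <= k * ip x x + k^-1 * ip y y.
Proof.
move=> k0.
have sgn (s : R) : s ^+ 2 = 1 -> 2 * (s * ip x y) <= k * ip x x + k^-1 * ip y y.
  move=> s2; have := semi_inner_ge0 ipP (k *: x - s *: y).
  rewrite (semi_innerBl ipP)// !(semi_innerBr ipP)// !(semi_innerZl ipP)//.
  rewrite !(semi_innerZr ipP)// (semi_innerC ipP y x) (mulrA s s) -expr2 s2
    mul1r.
  rewrite -(pmulr_rge0 _ (_ : 0 < k^-1)) ?invr_gt0// => h.
  rewrite -subr_ge0; apply: le_trans h _; rewrite le_eqVlt; apply/orP; left.
  by apply/eqP; field; rewrite gt_eqF.
have := sgn 1 (expr1n _ _); have := sgn (-1) (sqrr_sign _ 1).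
by rewrite mul1r mulN1r; case: (ler0P (ip x y)).
Qed.

Let energyE U : N U ^+ 2 = a U.1 U.1 + ip U.2 U.2.
Proof. exact: (semi_norm_sqr eP). Qed.

(** By Young and Poincare the cross term is at most eps0 (C a(u, u) + |v|^2), and both [eps0 * C]
    and [eps0] are at most 1/4. *)
Let B_equiv U : X U -> 3 / 4 * N U ^+ 2 <= B U U <= 5 / 4 * N U ^+ 2.
Proof.
move=> XU; have h := ip_young U.1 U.2 ltr01.
rewrite invr1 !mul1r in h.
have e1 := poincare_K XU.
have [i0 a0] := (semi_inner_ge0 ipP U.2, semi_inner_ge0 aP U.1).
rewrite energyE /B (semi_innerC ipP U.2 U.1) -mulr2n -[_ *+ 2]mulr_natl /energy.
have {}h : eps0 * (2 * `|ip U.1 U.2|) <= eps0 * (C * a U.1 U.1 + ip U.2 U.2).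
  by rewrite ler_pM2l//; apply: le_trans h _; rewrite lerD2r.
have e2 : eps0 * (C * a U.1 U.1) <= 4^-1 * a U.1 U.1.
  by rewrite mulrA ler_wpM2r// -eps0C lerDr ltW.
have e3 : eps0 * ip U.2 U.2 <= 4^-1 * ip U.2 U.2.
  by rewrite ler_wpM2r// -eps0C lerDl mulr_ge0// ltW.
have : `|eps0 * (2 * ip U.1 U.2)| <= 4^-1 * a U.1 U.1 + 4^-1 * ip U.2 U.2.
  rewrite !normrM (gtr0_norm eps0_gt0) (ger0_norm (ler0n _ 2)).
  by apply: le_trans h _; rewrite mulrDr lerD.
rewrite ler_norml => /andP[]; move: (eps0 * _) => x ? ?.
by apply/andP; split; lra.
Qed.

(** Poincare's inequality would give the square root of C; [C + 1] dominates it and spares the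
    root. *)
Let ip_le_norm U W : X U -> X W -> `|ip U.1 W.2| <= (C + 1) * (N U * N W).
Proof.
move=> XU XW; have C1 : 0 <= C + 1 by rewrite addr_ge0// ltW.
rewrite -(@ler_pXn2r _ 2) ?nnegrE ?mulr_ge0 ?semi_norm_ge0//.
rewrite real_normK ?num_real//.
apply: le_trans (semi_cauchy_schwarz_sqr ipP (I : setT U.1) (I : setT W.2)) _.
have [aU _] := energy_ge U; have [_ iW] := energy_ge W.
have iU : ip U.1 U.1 <= (C + 1) ^+ 2 * N U ^+ 2.
  apply: le_trans (poincare_K XU) _; apply: (@le_trans _ _ (C * N U ^+ 2)).
    by rewrite ler_wpM2l// ltW.
  by rewrite ler_wpM2r ?sqr_ge0//; move: C C0 => k k0; nra.
by rewrite !exprMn mulrA ler_pM// (semi_inner_ge0 ipP).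
Qed.

Let B_le U W : X U -> X W ->
  `|B U W| <= (1 + eps0 * (2 * (C + 1))) * (N U * N W).
Proof.
move=> XU XW; apply: le_trans (ler_normD _ _) _; rewrite mulrDl mul1r.
apply: lerD; first exact: (semi_cauchy_schwarz eP).
rewrite normrM (gtr0_norm eps0_gt0) -mulrA ler_pM2l//.
apply: le_trans (ler_normD _ _) _.
have := ip_le_norm XU XW; have := ip_le_norm XW XU.
by rewrite (semi_innerC ipP W.1) (mulrC (N W)); lra.
Qed.

Let B_lin c U W Z : X U -> X W -> B (c *: U + W) Z = c * B U Z + B W Z.
Proof.
move=> XU XW; rewrite /B (semi_inner_lin eP)// /= !(semi_inner_lin ipP)//; ring.
Qed.

Let B_sym U W : B U W = B W U.
Proof.
by rewrite /B (semi_innerC eP) (semi_innerC ipP U.1) (semi_innerC ipP U.2) [X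
  in eps0 * X]addrC.
Qed.

(** Green's formula cancels a(y, z), leaving -|z|^2 + eps0 |z|^2 - eps0 a(y, y) - eps0 (z, y). Young
    with weight [C] and Poincare bound the last term by eps0 / 2 (C |z|^2 + a(y, y)). The rate is
    small enough: eps0 / 4 * 5 / 4 = 5 / 16 eps0 stays below the eps0 / 2 left in front of a(y, y),
    and |z|^2 keeps a negative coefficient. *)
Let B_dissipation y z : D y -> K z ->
  eps0 / 4 * B (y, z) (y, z) + B (z, lap y - z) (y, z) <= 0.
Proof.
move=> Dy Kz; have Ky := DK Dy; have XY : X (y, z) by exact: Ky.
have /andP[_] := B_equiv XY; rewrite energyE /= => Bu.
have [i0 a0] := (semi_inner_ge0 ipP z, semi_inner_ge0 aP y).
have {}Bu : eps0 / 4 * B (y, z) (y, z) <= eps0 / 4 * (5 / 4 * (a y y + ip z z)).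
  by rewrite ler_wpM2l// divr_ge0// ltW.
have := green_DK Dy Kz; have := green_DK Dy Ky => Eyy Eyz.
rewrite {2}/B /energy /= !(semi_innerBl ipP)// (semi_innerC aP z y).
have := ip_young z y C0.
have e1 : C^-1 * ip y y <= a y y by rewrite ler_pdivrMl//; exact: poincare_K.
move=> h; have {}h : eps0 * (2 * `|ip z y|) <= eps0 * (C * ip z z + a y y).
  by rewrite ler_pM2l//; apply: le_trans h _; rewrite lerD2l.
have h2 : eps0 * (- ip z y) <= eps0 * `|ip z y| by rewrite ler_pM2l// -normrN
  ler_norm.
have e2 : eps0 * (C * ip z z) <= 4^-1 * ip z z.
  by rewrite mulrA ler_wpM2r// -eps0C lerDr ltW.
have e3 : eps0 * ip z z <= 4^-1 * ip z z.
  by rewrite ler_wpM2r// -eps0C lerDl mulr_ge0// ltW.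
have e4 : 0 <= eps0 * a y y by rewrite mulr_ge0// ltW.
have e5 : 0 <= eps0 * ip z z by rewrite mulr_ge0// ltW.
have -> : ip (lap y) z = - a y z by rewrite Eyz opprK.
have -> : ip (lap y) y = - a y y by rewrite Eyy opprK.
move: Bu h h2 e2 e3 e4 e5; rewrite !mulrDr !mulrN.
have -> : eps0 / 4 * (5 / 4 * a y y) = 5 / 16 * (eps0 * a y y) by field.
have -> : eps0 / 4 * (5 / 4 * ip z z) = 5 / 16 * (eps0 * ip z z) by field.
rewrite (mulrCA eps0 2).
move: (eps0 / 4 * _) (eps0 * (C * _)) (eps0 * `|_|) (eps0 * ip z y) (eps0 * a y
  y) (eps0 * ip z z).
move: (a y y) (ip z z) a0 i0 (a y z).
move=> A0 I0 ? ? ? b ? ? ? ? ? *; lra.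
Qed.

Lemma projU_decay_domain U t : energy_domain U -> 0 <= t ->
  N (projU (S t U)) <= 2 * expR (- (eps0 / 4) * t) * N U.
Proof.
move=> DU t0; have XU := domain_energy DU.
have XS s : 0 <= s -> X (S s U) by move=> s0; exact: (damped_stable SP).
pose Y s := (projU \o S ^~ U) s.
have XY s : 0 <= s -> X (Y s) by move=> s0; apply/projU_energy/XS.
pose W s := projU (damped_generator P (S s U)).
have dY s : 0 < s -> X (W s) /\ has_deriv energy Y s (W s).
  move=> s0; have [DS _] := damped_domain SP (ltW s0) DU.
  have X1 := generator_energy P DS.
  split; first exact: projU_energy.
  by apply: projU_has_deriv => //; exact: damped_has_deriv.
have cY : right_continuous0 energy Y.
  exact: projU_right_continuous0 XS (damped_right_continuous0 SP XU).
have c0 : 0 <= 1 + eps0 * (2 * (C + 1)).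
  by rewrite addr_ge0// mulr_ge0// ?ltW// mulr_gt0// addr_gt0.
pose g := eps0 / 4.
(* Gronwall by an integrating factor: the derivative of [f] is 2 e^(2 g s) times the quantity that
   [B_dissipation] shows to be nonpositive. *)
pose f s := expR (2 * g * s) * B (Y s) (Y s).
have dE s : is_derive s (1 : R) (fun s : R =>
  expR (2 * g * s)) (expR (2 * g * s) * (2 * g)).
  apply: (@is_derive_comp R R (fun s : R => 2 * g * s) expR).
  have := is_deriveZ (2 * g) (is_derive_id s (1 : R)).
  by rewrite [_ *: 1]mulr1.
have df (s : R) : 0 < s -> is_derive s (1 : R) f
    (expR (2 * g * s) * (2 * B (W s) (Y s)) + B (Y s) (Y s) * (expR (2 * g * s)
      * (2 * g))).
  move=> s0; apply: is_deriveM (dE s) _.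
  exact: (form_is_derive eP B_lin B_sym c0 B_le s0 XY (dY s s0).1 (dY s s0).2).
have f0 : f s @[s --> 0^'+] --> f 0.
  apply: cvgM.
    have ce : {for (0 : R), continuous (fun s : R => expR (2 * g * s))}.
      by apply/differentiable_continuous/derivable1_diffP; have [] := dE 0.
    exact: cvg_at_right_filter ce.
  exact: cvg_right0_dist (form_right_continuous0 eP B_lin B_sym c0 B_le XY cY).
have ft : f t <= f 0.
  apply: (nonincreasing_right0 f0 df) => // s s0.
  have [[DS KS] _] := damped_domain SP (ltW s0) DU.
  have := B_dissipation (PD DS) (PK KS).
  rewrite /W /Y /= /projU /damped_generator;
    move: (S s U) DS KS => [u v] /= Du Kv.
  rewrite linearB PP Plap// -/g => h.
  have -> : forall E b w : R,
    E * (2 * w) + b * (E * (2 * g)) = 2 * E * (g * b + w).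
    by move=> *; ring.
  by rewrite pmulr_rle0// mulr_gt0// expR_gt0.
have /andP[l1 _] := B_equiv (XY t t0).
have /andP[_ l2] := B_equiv (XY 0 (lexx 0)).
have l3 : N (Y 0) <= N U.
  by rewrite /Y /= (damped_0 SP XU); exact: projU_norm.
have Et0 : 0 < expR (2 * g * t) by exact: expR_gt0.
rewrite -(@ler_pXn2r _ 2) ?nnegrE ?mulr_ge0 ?expR_ge0 ?semi_norm_ge0//.
rewrite !exprMn -expRM_natl.
have -> : expR (2 * (- (eps0 / 4) * t)) = (expR (2 * g * t))^-1.
  by rewrite -expRN; congr expR; rewrite /g; ring.
(* The bounds of [B_equiv] cost a factor 5/3 on squares, rounded up to 4, hence the factor 2 on
   norms. *)
have -> : (2 : R) ^+ 2 = 4 by rewrite -natrX.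
rewrite mulrAC ler_pdivlMr// [leLHS]mulrC -/(Y t).
move: ft; rewrite /f mulr0 expR0 mul1r => ft.
have l4 : N (Y 0) ^+ 2 <= N U ^+ 2 by rewrite ler_pXn2r ?nnegrE ?semi_norm_ge0.
have l5 : expR (2 * g * t) * (3 / 4 * N (Y t) ^+ 2) <= expR (2 * g * t) * B (Y
  t) (Y t).
  by rewrite ler_pM2l.
have := sqr_ge0 (N U).
move: l5 ft l2 l4; rewrite mulrCA -[projU (S t U)]/(Y t).
move: (expR _ * N (Y t) ^+ 2) (expR _ * B (Y t) (Y t)) (B (Y 0) (Y 0)).
move: (N (Y 0) ^+ 2) (N U ^+ 2) => *; lra.
Qed.

Lemma projU_decay U t : X U -> 0 <= t ->
  N (projU (S t U)) <= 2 * expR (- (eps0 / 4) * t) * N U.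
Proof.
move=> XU t0; set k := 2 * _.
have k0 : 0 < k by rewrite mulr_gt0// expR_gt0.
have XS V : X V -> X (S t V) by exact: (damped_stable SP).
apply/ler_addgt0Pr => eps e0.
(* The distance to [W] is paid k times in [k * N W] and once in the image of [U - W]. *)
have e1 : 0 < eps / (k + 1) by rewrite divr_gt0// addr_gt0.
have [W DW UW] := dense XU e1; have XW := domain_energy DW.
have XB := closedB eP XU XW.
have -> : S t U = S t W + S t (U - W) by rewrite (damped_B SP t0 XU XW) addrC
  subrK.
have -> : projU (S t W + S t (U - W)) = projU (S t W) + projU (S t (U - W)).
  by rewrite /projU /= !linearD.
apply: le_trans (semi_normD eP (projU_energy (XS _ XW)) (projU_energy (XS _
  XB))) _.
have h1 := projU_decay_domain DW t0; rewrite -/k in h1.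
have h2 := le_trans (projU_norm (XS _ XB)) (damped_contraction SP t0 XB).
have h3 : N W <= N U + N (U - W).
  have -> : N W = N (U - (U - W)) by rewrite opprB addrC subrK.
  exact: (semi_normB eP).
have h4 : k * N W <= k * (N U + N (U - W)) by rewrite ler_pM2l.
have h5 : (k + 1) * N (U - W) <= eps by rewrite mulrC -ler_pdivlMr// addr_gt0.
by move: h4 h5; rewrite mulrDr mulrDl mul1r; lra.
Qed.

End projection.

End wave_energy.

(** * Wave semigroups on H^1_0 x L^2 as instances *)

Section wave_semigroup.
Context {R : realType} {d : nat} {Omega : set 'rV[R]_d}.
Variable Omega_open : open Omega.
Hypothesis Omega_bounded : bounded_set Omega.
Local Notation L2O := (L2on Omega_open).

Lemma L2_semi_inner : semi_inner setT (fun u v : L2O => L2_inner u v).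
Proof.
split=> // [c u v w _ _|u v|u].
- by rewrite L2_innerDl L2_innerZl.
- exact: L2_innerC.
- by rewrite L2_inner_norm sqr_ge0.
Qed.

Lemma grad_semi_inner : semi_inner (@H10 R d Omega Omega_open) (@grad_inner R d
  Omega Omega_open).
Proof.
split=> [|c u v|c u v w Hu Hv|u v|u].
- exact: (H10_0 Omega_open Omega_bounded).
- exact: (H10_lin Omega_bounded).
- exact: (grad_inner_linl Omega_bounded c w (H10_H1 Hu) (H10_H1 Hv)).
- exact: grad_innerC.
- exact: grad_inner_ge0.
Qed.

Definition laplacian_domain : set L2O := [set u | H2 u /\ H10 u].

Lemma laplacian_domain_lin c (u v : L2O) :
  laplacian_domain u -> laplacian_domain v -> laplacian_domain (c *: u + v).
Proof.
move=> [H2u Hu] [H2v Hv]; split; first exact: (H2_lin Omega_bounded c H2u H2v).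
exact: (H10_lin Omega_bounded c Hu Hv).
Qed.

(** The abstract energy unfolds to [energy_inner], so most axioms transfer as they stand; limits
    pass to epsilons, and the sign of [wave_operator] is absorbed into the generator. *)
Lemma damped_wave_semigroup (A : L2O -> L2O) S : wave_semigroup A S ->
  damped_semigroup (@H10 R d Omega Omega_open) laplacian_domain
    (@grad_inner R d Omega Omega_open) (fun u v : L2O => L2_inner u v)
    (@laplacian R d Omega Omega_open) A S.
Proof.
move=> [[st lin contr s0 sD cont] gen]; split.
- exact: st.
- exact: lin.
- exact: contr.
- exact: s0.
- exact: sD.
- move=> U XU; apply/cvg_right0P; last exact: cont.
  by move=> t; exact: sqrtr_ge0.
- move=> U W XU XW; have := gen U W XU XW.
  rewrite cvg_right0P => [gUW|t]; last exact: sqrtr_ge0.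
  have E : damped_generator (@laplacian R d Omega Omega_open) A U = -
    wave_operator A U.
    by rewrite /wave_operator /damped_generator; congr pair => /=;
      rewrite ?opprK// opprD opprK.
  rewrite E; split=> [h|[[[H2U H10U] KU] WE]].
    by have [[H2U H10U KU] WE] := gUW.1 h;
      exact: (conj (conj (conj H2U H10U) KU) WE).
  exact: (gUW.2 (conj (And3 H2U H10U KU) WE)).
Qed.

Lemma wave_domain_dense (U : L2O * L2O) : H10 U.1 -> forall eps, 0 < eps ->
  exists2 W, energy_domain (@H10 R d Omega Omega_open) laplacian_domain W &
    semi_norm (energy (@grad_inner R d Omega Omega_open)
      (fun u v : L2O => L2_inner u v)) (U - W) <= eps.
Proof.
case: U => u v /= Hu eps e0.
(* With c = eps / (d + 1), the d squares from the gradient and the one from the velocity add up to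
   (d + 1) c^2 <= eps^2. *)
have c0 : 0 < eps / d.+1%:R by rewrite divr_gt0.
have [_ /(_ _ c0)[f tf [_ f1]]] := (H10P u).1 Hu.
have [g tg gv] := test_dense Omega_bounded v c0.
exists (f, g).
  by split=> /=; [split; [exact: (test_H2 Omega_bounded tf)|]|];
    exact: (test_H10 Omega_bounded).
have sq (x : R) : 0 <= x -> x <= eps / d.+1%:R ->
  x ^+ 2 <= (eps / d.+1%:R) ^+ 2.
  by move=> x0 xc; rewrite ler_pXn2r ?nnegrE// ltW.
have h1 : grad_inner (u - f) (u - f) <= d%:R * (eps / d.+1%:R) ^+ 2.
  rewrite grad_inner_norm mulr_natl -[X in _ *+ X]card_ord -sumr_const.
  by apply: ler_sum => i _; exact: sq (normr_ge0 _) (f1 i).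
have h2 : L2_inner (v - g) (v - g) <= (eps / d.+1%:R) ^+ 2.
  by apply: le_trans (sq _ (normr_ge0 (v - g)) gv);
    rewrite le_eqVlt L2_inner_norm eqxx.
have h3 : grad_inner (u - f) (u - f) + L2_inner (v - g) (v - g) <= eps ^+ 2.
  apply: le_trans (lerD h1 h2) _; rewrite -[X in _ + X]mul1r -mulrDl natr1.
  have -> : eps ^+ 2 = d.+1%:R ^+ 2 * (eps / d.+1%:R) ^+ 2.
    by rewrite -exprMn mulrC divfK// pnatr_eq0.
  by rewrite ler_wpM2r ?sqr_ge0// -natrX ler_nat leq_pmulr.
rewrite -[leRHS](ger0_norm (ltW e0)) -sqrtr_sqr; exact: ler_wsqrtr.
Qed.

End wave_semigroup.

Unset Implicit Arguments.

Theorem theorem4p5 (R : realType) (d : nat) (Omega : set 'rV[R]_d)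
    (Omega_open : open Omega)
    (P : {linear L2on Omega_open -> L2on Omega_open})
    (SP S0 : R -> L2on Omega_open * L2on Omega_open ->
                  L2on Omega_open * L2on Omega_open)
    (u0 v0 : L2on Omega_open) (u v : R -> L2on Omega_open) :
  (0 < d)%N -> bounded_set Omega -> connected Omega -> C2_boundary Omega ->
  bounded_operator P -> commutes_with_laplacian P -> orthogonal_projection P ->
  wave_semigroup P SP -> wave_semigroup (fun=> 0) S0 ->
  H10 u0 -> semigroup_solution SP (u0, v0) (fun t => (u t, v t)) ->
  let Q := fun f : L2on Omega_open => f - P f in
  [/\ forall t, 0 <= t ->
        (u t, v t) = (Q (u t), Q (v t)) + (P (u t), P (v t)),
      semigroup_solution S0 (Q u0, Q v0) (fun t => (Q (u t), Q (v t))) &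
      exists gamma M : R, [/\ 0 < gamma, 0 < M & forall t, 0 <= t ->
        H10_norm (u t - Q (u t)) + `|v t - Q (v t)|
          <= M * expR (- gamma * t)]].
Proof.
move=> d0 bO _ _ _ PL PP SPw S0w Hu0 [_ uvE] Q.
have [PP2 Psym] := PP.
have [C C0 poi] := poincare Omega_open bO d0.
have SPd := damped_wave_semigroup SPw.
have S0d := damped_wave_semigroup S0w.
have ip_eq0 (w : L2on Omega_open) : L2_inner w w = 0 ->
  w = 0 := @L2_inner_eq0 _ _ _ _ w.
have DK : laplacian_domain (Omega_open :=
  Omega_open) `<=` @H10 R d Omega Omega_open.
  by move=> w [].
have lapl c (w z : L2on Omega_open) (Dw : laplacian_domain w) (Dz :
  laplacian_domain z) :=
  laplacian_lin bO c Dw.1 Dz.1.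
have gr (w z : L2on Omega_open) (Dw : laplacian_domain w) (Kz : H10 z) :=
  green bO Dw.1 Kz.
have poi' (w : L2on Omega_open) : H10 w -> L2_inner w w <= C * grad_inner w w.
  by move=> /poi; rewrite -L2_inner_norm.
have PK w (Kw : H10 w) := (H10_proj bO PL PP Kw).1.
have Pa w (Kw : H10 w) := (H10_proj bO PL PP Kw).2.
have PDo w : laplacian_domain w -> laplacian_domain (P w).
  by move=> [H2w Hw]; have [] := PL w H2w Hw; split.
have Pl w : laplacian_domain w -> P (laplacian w) = laplacian (P w).
  by move=> [H2w Hw]; have [] := PL w H2w Hw.
have dense := wave_domain_dense (Omega_open := Omega_open) bO.
have ipP := L2_semi_inner Omega_open.
have XU : energy_set (@H10 R d Omega Omega_open) (u0, v0) := Hu0.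
have aP := grad_semi_inner Omega_open bO.
split.
- by move=> t _; rewrite /Q; congr pair; rewrite subrK.
- split; first exact: (H10B bO Hu0 (PK _ Hu0)).
  move=> t t0.
  have := coprojU_solution ipP ip_eq0 aP DK (laplacian_domain_lin bO) lapl gr
    poi'
    PK Pa PDo Pl PP2 Psym SPd S0d dense XU t0.
  by rewrite -(uvE t t0).
- pose N := semi_norm (energy (@grad_inner R d Omega Omega_open)
    (fun f g : L2on Omega_open => L2_inner f g)).
  (* The rate is [eps0 / 4] from [projU_decay]. The H^1_0 and the L^2 part are each at most the
     energy norm, itself at most 2 e^(-gamma t) times the initial one, which gives the factor 4 in
     the second witness; its added 1 keeps it positive. *)
  pose gamma := (4 * (1 + C))^-1 / 4.
  exists gamma, (4 * N (u0, v0) + 1).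
  have N0 : 0 <= N (u0, v0) by exact: sqrtr_ge0.
  split; first by rewrite divr_gt0// invr_gt0 mulr_gt0// addr_gt0.
    by rewrite ltr_wpDl// mulr_ge0.
  move=> t t0; rewrite /Q !subKr.
  have := projU_decay ipP aP C0 DK gr poi' PK Pa PDo Pl PP2 Psym SPd dense XU
    t0.
  rewrite -(uvE t t0) -/N -/gamma => decay.
  have n1 : H10_norm (P (u t)) <= N (P (u t), P (v t)).
    by apply: ler_wsqrtr; rewrite /energy /= lerDl L2_inner_norm sqr_ge0.
  have n2 : `|P (v t)| <= N (P (u t), P (v t)).
    rewrite -[leLHS]ger0_norm// -sqrtr_sqr -L2_inner_norm.
    by apply: ler_wsqrtr; rewrite /energy /= lerDr grad_inner_ge0.
  have := expR_gt0 (- gamma * t).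
  move: decay n1 n2; rewrite /projU /=.
  move: (N (P (u t), P (v t))) (H10_norm _) (`|_|) (expR _) (N (u0, v0)) N0.
  move=> a b c e n n0 ae ba ca e0; rewrite mulrDl mul1r.
  have : 4 * n * e = 2 * (2 * e * n) by ring.
  by move=> ->; lra.
Qed.
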